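(* Any complex Lie algebra $\mathfrak{g}$ satisfying the following conditions is Borcherds–Kac–Moody: 1. $\mathfrak{g}$ admits a nonsingular invariant symmetric bilinear form, i.e., $(x,y)=(y,x)$ and $(x,[y,z])=([x,y],z)$ for all $x,y,z\in\mathfrak{g}$, and if $(x,y)=0$ for all $y\in\mathfrak{g}$ then $x=0$. 2. $\mathfrak{g}$ has a self-centralizing subalgebra $H$, called a Cartan subalgebra, such that $\mathfrak{g}$ is the sum of eigenspaces under the action of $H$, and the nonzero eigenvalues, called roots, have finite multiplicity. 3. $H$ has a totally real structure $H_{\mathbb{R}}\subset H$ (i.e., such that $H=H_{\mathbb{R}}\oplus\sqrt{-1}H_{\mathbb{R}}$), such that the restriction of the bilinear form to $H_{\mathbb{R}}$ is real-valued, and all roots are elements of the dual $H_{\mathbb{R}}^\vee$. 4. There exists an element $h\in H_{\mathbb{R}}$ such that: (a) the centralizer of $h$ in $\mathfrak{g}$ is $H$; (b) for any $M\in\mathbb{R}$, there exist at most finitely many roots $\alpha$ such that $|\alpha(h)|<M$. A root $\alpha$ is called negative if $\alpha(h)<0$ and positive if $\alpha(h)>0$. 5. The norms of roots under the inner product $(,)$ are bounded above. 6. Any two roots of non-positive norm that are both positive or both negative have inner product at most zero, and if the inner product is zero, then their root spaces commute.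
   Context: For a countable index set $I$, a real matrix $A=(a_{i,j})_{i,j\in I}$ is a generalized Cartan matrix if (1) there is a diagonal matrix $Q$ with positive real diagonal entries such that $QA$ is symmetric; (2) $a_{i,j}\le0$ for $i\ne j$; (3) if $a_{i,i}>0$ then $a_{i,i}=2$ and $a_{i,j}\in\mathbb{Z}$ for all $j\in I$. The universal Borcherds–Kac–Moody algebra $\mathfrak{g}(A)$ is the complex Lie algebra with generators $h_i,e_i,f_i$ ($i\in I$) and relations: $[h_i,h_k]=0$, $[h_i,e_k]=a_{i,k}e_k$, $[h_i,f_k]=-a_{i,k}f_k$, $[e_i,f_j]=\delta_{i,j}h_i$; if $a_{i,i}>0$ and $i\ne j$, then $\mathrm{ad}(e_i)^{1-a_{i,j}}(e_j)=\mathrm{ad}(f_i)^{1-a_{i,j}}(f_j)=0$; if $a_{i,j}=0$, then $[e_i,e_j]=[f_i,f_j]=0$. A Borcherds–Kac–Moody algebra is a Lie algebra of the form $(\mathfrak{g}(A)/C).D$ (extension of $\mathfrak{g}(A)/C$ by $D$), where $C$ is a central ideal of $\mathfrak{g}(A)$ and $D$ is a commutative Lie algebra of outer derivations. The inner product of roots is the one induced on the span of the roots by the bilinear form on $H$.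
   Formalization: D is a commutative Lie algebra acting on g(A)/C by derivations, none inner except 0, but the action need not be faithful, so D may contain central summands; with D literally made of outer derivations the claim fails, e.g. for the 1-dimensional abelian Lie algebra. *)

(* Defs.v *)
From HB Require Import structures.
From mathcomp Require Import all_boot all_order all_algebra.
From mathcomp Require Import boolp classical_sets functions cardinality reals.
From mathcomp Require Import complex.

Set Implicit Arguments.
Unset Strict Implicit.
Unset Printing Implicit Defensive.

Import Order.TTheory GRing.Theory Num.Theory.
Local Open Scope classical_set_scope.
Local Open Scope quotient_scope.
Local Open Scope ring_scope.

HB.mixin Record Lmodule_isLie (K : fieldType) V of GRing.Lmodule K V := {
  lie : V -> V -> V;
  lieDl : forall x y z, lie (x + y) z = lie x z + lie y z;
  lieDr : forall x y z, lie x (y + z) = lie x y + lie x z;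
  lieZl : forall a x y, lie (a *: x) y = a *: lie x y;
  lieZr : forall a x y, lie x (a *: y) = a *: lie x y;
  liexx : forall x, lie x x = 0;
  lie_jacobi : forall x y z,
    lie x (lie y z) + lie y (lie z x) + lie z (lie x y) = 0
}.

#[short(type="lieAlgType")]
HB.structure Definition LieAlgebra (K : fieldType) :=
  {V of Lmodule_isLie K V & GRing.Lmodule K V}.

Declare Scope lie_scope.
Delimit Scope lie_scope with lie.
Notation "[ 'Lie' x , y ]" := (lie x y)
  (at level 0, x, y at level 99, format "[ 'Lie'  x ,  y ]") : lie_scope.
Local Open Scope lie_scope.

Definition lie_morphism (K : fieldType) (L M : lieAlgType K)
    (f : {linear L -> M}) : Prop :=
  forall x y, f [Lie x, y] = [Lie f x, f y].

Definition subspace (K : fieldType) (V : lmodType K) (S : set V) : Prop :=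
  [/\ S 0, (forall x y, S x -> S y -> S (x + y))
    & forall a x, S x -> S (a *: x)].

Definition subalgebra (K : fieldType) (L : lieAlgType K) (S : set L) : Prop :=
  subspace S /\ forall x y, S x -> S y -> S [Lie x, y].

Definition finite_dim (K : fieldType) (V : lmodType K) (S : set V) : Prop :=
  exists s : seq V, [set` s] `<=` S /\
    forall x, S x -> exists c : nat -> K, x = \sum_(i < size s) c i *: s`_i.

Definition derivation (K : fieldType) (L : lieAlgType K)
    (d : {linear L -> L}) : Prop :=
  forall x y, d [Lie x, y] = [Lie d x, y] + [Lie x, d y].

Definition inner (K : fieldType) (L : lieAlgType K) (d : L -> L) : Prop :=
  exists m, forall x, d x = [Lie m, x].

Definition commutative_lie (K : fieldType) (L : lieAlgType K) : Prop :=
  forall x y : L, [Lie x, y] = 0.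

Record lie_ideal (K : fieldType) (L : lieAlgType K) := LieIdeal {
  ideal_set :> L -> Prop;
  ideal_subspace : subspace ideal_set;
  ideal_lie : forall x y, ideal_set y -> ideal_set [Lie x, y]
}.

Definition central (K : fieldType) (L : lieAlgType K) (C : L -> Prop) : Prop :=
  forall c x, C c -> [Lie c, x] = 0.

Section LieTheory.
Context (K : fieldType) (L : lieAlgType K).
Implicit Types x y z : L.

Lemma lieC x y : [Lie x, y] = - [Lie y, x].
Proof.
apply/eqP; rewrite -addr_eq0; apply/eqP.
by have := liexx (x + y); rewrite lieDl !lieDr !liexx add0r addr0.
Qed.

Lemma lieNl x y : [Lie - x, y] = - [Lie x, y].
Proof. by rewrite -scaleN1r lieZl scaleN1r. Qed.

Lemma lieNr x y : [Lie x, - y] = - [Lie x, y].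
Proof. by rewrite -scaleN1r lieZr scaleN1r. Qed.

End LieTheory.

Section Quotient.
Context (K : fieldType) (L : lieAlgType K) (C : lie_ideal L).

Definition ideal_rel (x y : L) : bool := `[< C (x - y) >].

Let C0 : C 0. Proof. by case: (ideal_subspace C). Qed.
Let CD x y : C x -> C y -> C (x + y).
Proof. by case: (ideal_subspace C) => _ h _; exact: h. Qed.
Let CZ a x : C x -> C (a *: x).
Proof. by case: (ideal_subspace C) => _ _; exact. Qed.
Let CN x : C x -> C (- x). Proof. by rewrite -scaleN1r; exact: CZ. Qed.

Lemma ideal_rel_refl : reflexive ideal_rel.
Proof. by move=> x; apply/asboolP; rewrite subrr. Qed.
Lemma ideal_rel_sym : symmetric ideal_rel.
Proof.
move=> x y; apply: asbool_equiv_eq; split=> /CN; by rewrite opprB.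
Qed.
Lemma ideal_rel_trans : transitive ideal_rel.
Proof.
move=> y x z /asboolP Cxy /asboolP Cyz; apply/asboolP.
by rewrite -(subrKA y); exact: CD.
Qed.

Canonical ideal_equiv :=
  EquivRel ideal_rel ideal_rel_refl ideal_rel_sym ideal_rel_trans.

Definition lie_quot := {eq_quot ideal_equiv}.
HB.instance Definition _ := Choice.on lie_quot.
HB.instance Definition _ := EqQuotient.on lie_quot.

Lemma lie_quotP x y : C (x - y) -> \pi_lie_quot x = \pi_lie_quot y.
Proof. by move=> h; apply/eqmodP/asboolP. Qed.
Lemma lie_quot_repr x : C (repr (\pi_lie_quot x) - x).
Proof.
by apply/asboolP; rewrite -/(ideal_rel _ _); apply/eqmodP; rewrite reprK.
Qed.

Definition lq_add (u v : lie_quot) : lie_quot := \pi_lie_quot (repr u + repr v).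
Definition lq_opp (u : lie_quot) : lie_quot := \pi_lie_quot (- repr u).
Definition lq_scale (a : K) (u : lie_quot) : lie_quot :=
  \pi_lie_quot (a *: repr u).
Definition lq_lie (u v : lie_quot) : lie_quot :=
  \pi_lie_quot [Lie repr u, repr v].

Lemma lq_addE x y : lq_add (\pi_lie_quot x) (\pi_lie_quot y) =
  \pi_lie_quot (x + y).
Proof.
apply: lie_quotP; rewrite opprD addrACA.
by apply: CD; exact: lie_quot_repr.
Qed.
Lemma lq_oppE x : lq_opp (\pi_lie_quot x) = \pi_lie_quot (- x).
Proof. by apply: lie_quotP; rewrite -opprD; apply/CN/lie_quot_repr. Qed.
Lemma lq_scaleE a x : lq_scale a (\pi_lie_quot x) = \pi_lie_quot (a *: x).
Proof. by apply: lie_quotP; rewrite -scalerBr; apply/CZ/lie_quot_repr. Qed.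
Lemma lq_lieE x y : lq_lie (\pi_lie_quot x) (\pi_lie_quot y) =
  \pi_lie_quot [Lie x, y].
Proof.
apply: lie_quotP.
rewrite -(subrKA [Lie repr (\pi_lie_quot x), y]); apply: CD.
  by rewrite -lieNr -lieDr; apply/ideal_lie/lie_quot_repr.
rewrite -lieNl -lieDl lieC; apply/CN/ideal_lie/lie_quot_repr.
Qed.

Lemma lq_addA : associative lq_add.
Proof.
elim/quotW=> x; elim/quotW=> y; elim/quotW=> z.
rewrite (lq_addE x y) (lq_addE y z) !lq_addE addrA //.
Qed.
Lemma lq_addC : commutative lq_add.
Proof. by elim/quotW=> x; elim/quotW=> y; rewrite !lq_addE addrC. Qed.
Lemma lq_add0 : left_id (\pi_lie_quot 0) lq_add.
Proof. by elim/quotW=> x; rewrite lq_addE add0r. Qed.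
Lemma lq_addN : left_inverse (\pi_lie_quot 0) lq_opp lq_add.
Proof. by elim/quotW=> x; rewrite lq_oppE lq_addE addNr. Qed.

HB.instance Definition _ :=
  GRing.isZmodule.Build lie_quot lq_addA lq_addC lq_add0 lq_addN.

Let piD x y : \pi_lie_quot x + \pi_lie_quot y = \pi_lie_quot (x + y).
Proof. exact: lq_addE. Qed.

Lemma lq_scaleA a b v : lq_scale a (lq_scale b v) = lq_scale (a * b) v.
Proof. by elim/quotW: v => x; rewrite (lq_scaleE b) !lq_scaleE scalerA. Qed.
Lemma lq_scale1 : left_id 1 lq_scale.
Proof. by elim/quotW=> x; rewrite !lq_scaleE scale1r. Qed.
Lemma lq_scaleDr : right_distributive lq_scale +%R.
Proof.
move=> a; elim/quotW=> x; elim/quotW=> y.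
by rewrite (piD x y) !lq_scaleE piD scalerDr.
Qed.
Lemma lq_scaleDl v : {morph lq_scale^~ v : a b / a + b >-> a + b}.
Proof.
move=> a b; elim/quotW: v => x.
by rewrite !lq_scaleE piD scalerDl.
Qed.

HB.instance Definition _ := GRing.Zmodule_isLmodule.Build K lie_quot
  lq_scaleA lq_scale1 lq_scaleDr lq_scaleDl.

Let piZ a x : a *: \pi_lie_quot x = \pi_lie_quot (a *: x).
Proof. exact: lq_scaleE. Qed.

Lemma lq_lieDl u v w : lq_lie (u + v) w = lq_lie u w + lq_lie v w.
Proof.
elim/quotW: u => x; elim/quotW: v => y; elim/quotW: w => z.
by rewrite (piD x y) (lq_lieE x z) (lq_lieE y z) lq_lieE piD lieDl.
Qed.
Lemma lq_lieDr u v w : lq_lie u (v + w) = lq_lie u v + lq_lie u w.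
Proof.
elim/quotW: u => x; elim/quotW: v => y; elim/quotW: w => z.
by rewrite (piD y z) (lq_lieE x y) (lq_lieE x z) lq_lieE piD lieDr.
Qed.
Lemma lq_lieZl a u v : lq_lie (a *: u) v = a *: lq_lie u v.
Proof.
elim/quotW: u => x; elim/quotW: v => y.
by rewrite (piZ a x) !lq_lieE piZ lieZl.
Qed.
Lemma lq_lieZr a u v : lq_lie u (a *: v) = a *: lq_lie u v.
Proof.
elim/quotW: u => x; elim/quotW: v => y.
by rewrite (piZ a y) !lq_lieE piZ lieZr.
Qed.
Lemma lq_liexx u : lq_lie u u = 0.
Proof. by elim/quotW: u => x; rewrite lq_lieE liexx. Qed.
Lemma lq_jacobi u v w :
  lq_lie u (lq_lie v w) + lq_lie v (lq_lie w u) + lq_lie w (lq_lie u v) = 0.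
Proof.
elim/quotW: u => x; elim/quotW: v => y; elim/quotW: w => z.
by rewrite (lq_lieE y z) (lq_lieE z x) (lq_lieE x y) !lq_lieE !piD lie_jacobi.
Qed.

HB.instance Definition _ := Lmodule_isLie.Build K lie_quot
  lq_lieDl lq_lieDr lq_lieZl lq_lieZr lq_liexx lq_jacobi.

End Quotient.

Inductive lie_term (K X : Type) : Type :=
| LGen of X
| LZero
| LAdd of lie_term K X & lie_term K X
| LScale of K & lie_term K X
| LBr of lie_term K X & lie_term K X.

Arguments LGen {K X} _.
Arguments LZero {K X}.

HB.instance Definition _ (K X : Type) := gen_eqMixin (lie_term K X).
HB.instance Definition _ (K X : Type) := gen_choiceMixin (lie_term K X).

Section Presentation.
Context (K : fieldType) (X : Type).
Local Notation term := (lie_term K X).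
Variable rel : term -> term -> Prop.

(* The least congruence on Lie expressions that contains [rel] and for which
   the quotient is a Lie algebra over [K]. *)
Inductive lie_cong : term -> term -> Prop :=
| lc_rel s t : rel s t -> lie_cong s t
| lc_refl s : lie_cong s s
| lc_sym s t : lie_cong s t -> lie_cong t s
| lc_trans t s u : lie_cong s t -> lie_cong t u -> lie_cong s u
| lc_add s s' t t' : lie_cong s s' -> lie_cong t t' ->
    lie_cong (LAdd s t) (LAdd s' t')
| lc_scale a s s' : lie_cong s s' -> lie_cong (LScale a s) (LScale a s')
| lc_br s s' t t' : lie_cong s s' -> lie_cong t t' ->
    lie_cong (LBr s t) (LBr s' t')
| lc_addA s t u : lie_cong (LAdd s (LAdd t u)) (LAdd (LAdd s t) u)
| lc_addC s t : lie_cong (LAdd s t) (LAdd t s)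
| lc_add0 s : lie_cong (LAdd LZero s) s
| lc_addN s : lie_cong (LAdd (LScale (- 1) s) s) LZero
| lc_scaleA a b s : lie_cong (LScale a (LScale b s)) (LScale (a * b) s)
| lc_scale1 s : lie_cong (LScale 1 s) s
| lc_scaleDr a s t :
    lie_cong (LScale a (LAdd s t)) (LAdd (LScale a s) (LScale a t))
| lc_scaleDl a b s :
    lie_cong (LScale (a + b) s) (LAdd (LScale a s) (LScale b s))
| lc_brDl s t u : lie_cong (LBr (LAdd s t) u) (LAdd (LBr s u) (LBr t u))
| lc_brDr s t u : lie_cong (LBr s (LAdd t u)) (LAdd (LBr s t) (LBr s u))
| lc_brZl a s t : lie_cong (LBr (LScale a s) t) (LScale a (LBr s t))
| lc_brZr a s t : lie_cong (LBr s (LScale a t)) (LScale a (LBr s t))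
| lc_brxx s : lie_cong (LBr s s) LZero
| lc_jacobi s t u : lie_cong
    (LAdd (LAdd (LBr s (LBr t u)) (LBr t (LBr u s))) (LBr u (LBr s t))) LZero.

Definition lie_congb (s t : term) : bool := `[< lie_cong s t >].

Lemma lie_congb_refl : reflexive lie_congb.
Proof. by move=> s; apply/asboolP/lc_refl. Qed.
Lemma lie_congb_sym : symmetric lie_congb.
Proof. by move=> s t; apply: asbool_equiv_eq; split; exact: lc_sym. Qed.
Lemma lie_congb_trans : transitive lie_congb.
Proof.
by move=> t s u /asboolP st /asboolP tu; apply/asboolP; exact: lc_trans tu.
Qed.

Canonical lie_cong_equiv :=
  EquivRel lie_congb lie_congb_refl lie_congb_sym lie_congb_trans.

Definition presented := {eq_quot lie_cong_equiv}.
HB.instance Definition _ := Choice.on presented.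
HB.instance Definition _ := EqQuotient.on presented.

Lemma presentedP s t : lie_cong s t -> \pi_presented s = \pi_presented t.
Proof. by move=> h; apply/eqmodP/asboolP. Qed.
Lemma presented_repr s : lie_cong (repr (\pi_presented s)) s.
Proof.
by apply/asboolP; rewrite -/(lie_congb _ _); apply/eqmodP; rewrite reprK.
Qed.

Definition pr_zero : presented := \pi_presented LZero.
Definition pr_add (u v : presented) : presented :=
  \pi_presented (LAdd (repr u) (repr v)).
Definition pr_scale (a : K) (u : presented) : presented :=
  \pi_presented (LScale a (repr u)).
Definition pr_opp (u : presented) : presented := pr_scale (- 1) u.
Definition pr_lie (u v : presented) : presented :=
  \pi_presented (LBr (repr u) (repr v)).

Lemma pr_addE s t : pr_add (\pi_presented s) (\pi_presented t) =
  \pi_presented (LAdd s t).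
Proof. by apply: presentedP; apply: lc_add; exact: presented_repr. Qed.
Lemma pr_scaleE a s : pr_scale a (\pi_presented s) = \pi_presented (LScale a s).
Proof. by apply: presentedP; apply: lc_scale; exact: presented_repr. Qed.
Lemma pr_lieE s t : pr_lie (\pi_presented s) (\pi_presented t) =
  \pi_presented (LBr s t).
Proof. by apply: presentedP; apply: lc_br; exact: presented_repr. Qed.

Lemma pr_addA : associative pr_add.
Proof.
elim/quotW=> x; elim/quotW=> y; elim/quotW=> z.
rewrite (pr_addE x y) (pr_addE y z) !pr_addE; exact/presentedP/lc_addA.
Qed.
Lemma pr_addC : commutative pr_add.
Proof.
by elim/quotW=> x; elim/quotW=> y; rewrite !pr_addE; apply/presentedP/lc_addC.
Qed.
Lemma pr_add0 : left_id pr_zero pr_add.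
Proof. by elim/quotW=> x; rewrite pr_addE; apply/presentedP/lc_add0. Qed.
Lemma pr_addN : left_inverse pr_zero pr_opp pr_add.
Proof.
elim/quotW=> x; rewrite /pr_opp pr_scaleE pr_addE.
exact/presentedP/lc_addN.
Qed.

HB.instance Definition _ :=
  GRing.isZmodule.Build presented pr_addA pr_addC pr_add0 pr_addN.

Let piD x y : \pi_presented x + \pi_presented y = \pi_presented (LAdd x y).
Proof. exact: pr_addE. Qed.

Lemma pr_scaleA a b v : pr_scale a (pr_scale b v) = pr_scale (a * b) v.
Proof.
by elim/quotW: v => x; rewrite (pr_scaleE b) !pr_scaleE;
  apply/presentedP/lc_scaleA.
Qed.
Lemma pr_scale1 : left_id 1 pr_scale.
Proof. by elim/quotW=> x; rewrite !pr_scaleE; apply/presentedP/lc_scale1. Qed.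
Lemma pr_scaleDr : right_distributive pr_scale +%R.
Proof.
move=> a; elim/quotW=> x; elim/quotW=> y.
by rewrite (piD x y) !pr_scaleE piD; apply/presentedP/lc_scaleDr.
Qed.
Lemma pr_scaleDl v : {morph pr_scale^~ v : a b / a + b >-> a + b}.
Proof.
move=> a b; elim/quotW: v => x.
by rewrite !pr_scaleE piD; apply/presentedP/lc_scaleDl.
Qed.

HB.instance Definition _ := GRing.Zmodule_isLmodule.Build K presented
  pr_scaleA pr_scale1 pr_scaleDr pr_scaleDl.

Let piZ a x : a *: \pi_presented x = \pi_presented (LScale a x).
Proof. exact: pr_scaleE. Qed.

Lemma pr_lieDl u v w : pr_lie (u + v) w = pr_lie u w + pr_lie v w.
Proof.
elim/quotW: u => x; elim/quotW: v => y; elim/quotW: w => z.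
by rewrite (piD x y) (pr_lieE x z) (pr_lieE y z) pr_lieE piD;
  apply/presentedP/lc_brDl.
Qed.
Lemma pr_lieDr u v w : pr_lie u (v + w) = pr_lie u v + pr_lie u w.
Proof.
elim/quotW: u => x; elim/quotW: v => y; elim/quotW: w => z.
by rewrite (piD y z) (pr_lieE x y) (pr_lieE x z) pr_lieE piD;
  apply/presentedP/lc_brDr.
Qed.
Lemma pr_lieZl a u v : pr_lie (a *: u) v = a *: pr_lie u v.
Proof.
elim/quotW: u => x; elim/quotW: v => y.
by rewrite (piZ a x) !pr_lieE piZ; apply/presentedP/lc_brZl.
Qed.
Lemma pr_lieZr a u v : pr_lie u (a *: v) = a *: pr_lie u v.
Proof.
elim/quotW: u => x; elim/quotW: v => y.
by rewrite (piZ a y) !pr_lieE piZ; apply/presentedP/lc_brZr.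
Qed.
Lemma pr_liexx u : pr_lie u u = 0.
Proof. by elim/quotW: u => x; rewrite pr_lieE; apply/presentedP/lc_brxx. Qed.
Lemma pr_jacobi u v w :
  pr_lie u (pr_lie v w) + pr_lie v (pr_lie w u) + pr_lie w (pr_lie u v) = 0.
Proof.
elim/quotW: u => x; elim/quotW: v => y; elim/quotW: w => z.
by rewrite (pr_lieE y z) (pr_lieE z x) (pr_lieE x y) !pr_lieE !piD;
  apply/presentedP/lc_jacobi.
Qed.

HB.instance Definition _ := Lmodule_isLie.Build K presented
  pr_lieDl pr_lieDr pr_lieZl pr_lieZr pr_liexx pr_jacobi.

End Presentation.

Definition generalized_cartan (R : realType) (I : countType)
    (A : I -> I -> R) : Prop :=
  [/\ (exists q : I -> R, (forall i, 0 < q i) /\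
         forall i j, q i * A i j = q j * A j i),
      (forall i j, i != j -> A i j <= 0)
    & forall i, 0 < A i i ->
        A i i = 2 /\ forall j, A i j \is a Num.int].

Inductive bkm_gen (I : Type) := GenH of I | GenE of I | GenF of I.

Section UniversalBKM.
Context (R : realType) (I : countType) (A : I -> I -> R).
Local Notation term := (lie_term R[i] (bkm_gen I)).
Local Notation "x %:C" := (real_complex R x).

Definition bkm_h i : term := LGen (GenH i).
Definition bkm_e i : term := LGen (GenE i).
Definition bkm_f i : term := LGen (GenF i).

(* In the Serre relations, [n] is the exponent [1 - A i j], which is a
   natural number when [A] is a generalized Cartan matrix. *)
Inductive bkm_rel : term -> term -> Prop :=
| bkm_hh i k : bkm_rel (LBr (bkm_h i) (bkm_h k)) LZero
| bkm_he i k :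
    bkm_rel (LBr (bkm_h i) (bkm_e k)) (LScale (A i k)%:C (bkm_e k))
| bkm_hf i k :
    bkm_rel (LBr (bkm_h i) (bkm_f k)) (LScale (- (A i k)%:C) (bkm_f k))
| bkm_ef i j :
    bkm_rel (LBr (bkm_e i) (bkm_f j)) (if i == j then bkm_h i else LZero)
| bkm_serre_e i j (n : nat) : 0 < A i i -> i != j -> n%:R = 1 - A i j ->
    bkm_rel (iter n (LBr (bkm_e i)) (bkm_e j)) LZero
| bkm_serre_f i j (n : nat) : 0 < A i i -> i != j -> n%:R = 1 - A i j ->
    bkm_rel (iter n (LBr (bkm_f i)) (bkm_f j)) LZero
| bkm_ee i j : A i j = 0 -> bkm_rel (LBr (bkm_e i) (bkm_e j)) LZero
| bkm_ff i j : A i j = 0 -> bkm_rel (LBr (bkm_f i) (bkm_f j)) LZero.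

Definition universal_bkm : lieAlgType R[i] := presented bkm_rel.

End UniversalBKM.

(* The extension N.D: a short exact sequence 0 -> N -> g -> D -> 0 together
   with an action [delta] of D on N by derivations that is realized inside [g]
   by lifts of the elements of D, where no derivation [delta d] other than 0 is
   inner.  The map [delta] need not be injective, so that D may contain a
   central direct summand of [g] (as in gl_2 = sl_2.C); the extension need not
   split. *)
Definition extension_by_outer_derivations (K : fieldType)
    (N g D : lieAlgType K) : Prop :=
  exists (iota : {linear N -> g}) (pi : {linear g -> D})
         (delta : D -> {linear N -> N}),
    [/\ [/\ lie_morphism iota, lie_morphism pi, injective iota,
            (forall d, exists x, pi x = d)
          & forall x, pi x = 0 <-> exists n, iota n = x],
        [/\ (forall d, derivation (delta d)),
            (forall a d d' n,
               delta (a *: d + d') n = a *: delta d n + delta d' n)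
          & forall d d' n,
              delta [Lie d, d'] n =
                delta d (delta d' n) - delta d' (delta d n)],
        (forall d, exists2 x, pi x = d &
           forall n, [Lie x, iota n] = iota (delta d n))
      & forall d, inner (delta d) -> forall n, delta d n = 0].

Definition borcherds_kac_moody (R : realType) (g : lieAlgType R[i]) : Prop :=
  exists (I : countType) (A : I -> I -> R)
         (C : lie_ideal (universal_bkm A)) (D : lieAlgType R[i]),
    [/\ generalized_cartan A, central C, commutative_lie D
      & extension_by_outer_derivations (lie_quot C) g D].

Section Roots.
Context (R : realType) (g : lieAlgType R[i]) (form : {biscalar g}).
Variable H : set g.
Implicit Types alpha beta : H -> R[i].

Definition centralizer (S : set g) : set g :=
  [set x | forall k, S k -> [Lie k, x] = 0].

(* A weight is a function on [H]; when its weight_space is nonzero, it is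
   automatically linear. *)
Definition weight_space alpha : set g :=
  [set x | forall k : H, [Lie val k, x] = alpha k *: x].

Definition is_root alpha : Prop :=
  alpha <> (fun=> 0) /\ exists2 x, weight_space alpha x & x <> 0.

(* The element of [H] that represents [alpha] with respect to the form.  It
   exists and is unique when [alpha] is in the span of the roots, [H] is
   self-centralizing and the form is nonsingular and invariant. *)
Definition dual_vector alpha : g :=
  xget 0 [set t | H t /\ forall k : H, form t (val k) = alpha k].

(* The values are real for roots; inequalities in [R[i]] include this. *)
Definition root_product alpha beta : R[i] :=
  form (dual_vector alpha) (dual_vector beta).

End Roots.

Definition totally_real_structure (R : realType) (V : lmodType R[i])
    (H HR : set V) : Prop :=
  [/\ HR `<=` H,
      [/\ HR 0, (forall x y, HR x -> HR y -> HR (x + y))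
        & forall (a : R) x, HR x -> HR (real_complex R a *: x)]
    & forall x, H x -> exists! p : V * V,
        [/\ HR p.1, HR p.2 & x = p.1 + 'i%C *: p.2]].

(* Main.v *)
Require Import Defs.
From HB Require Import structures.
From mathcomp Require Import all_boot all_order all_algebra.
From mathcomp Require Import boolp classical_sets functions cardinality reals.
From mathcomp Require Import complex ring lra.

Set Implicit Arguments.
Unset Strict Implicit.
Unset Printing Implicit Defensive.

Import Order.TTheory GRing.Theory Num.Theory.
Local Open Scope classical_set_scope.
Local Open Scope ring_scope.
Local Open Scope lie_scope.

(** A complex Lie algebra [g] as in the theorem is recovered from the vectors
    that lie as low as possible in its positive root spaces.

    Call a vector of a positive root space [g_t] simple when it is annihilated
    by every negative root space whose height is smaller than that of [t] in
    absolute value; by invariance of the form, these are the vectors orthogonal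
    to the brackets of negative root vectors.  Simple vectors of weights [s] and
    [- t] commute if [s <> t], and dual bases of those of weights [t] and [- t]
    behave like Chevalley generators.  A simple root [t] of positive norm makes
    its generators act locally nilpotently, since norms of roots are bounded
    above while [s + n t] has quadratically growing norm; sl2 theory then gives the
    integrality and sign of the Cartan matrix and the Serre relations
    ([real_root_lowest], [ss_serre]).  Simple roots of nonpositive norm are
    governed by the last hypothesis of the theorem ([ss_ee]).

    Two facts carry the proof: positive root vectors are sums of brackets of
    simple ones ([decomposable_pair], [spanned_pos]), and there are no more
    relations among simple vectors than the defining ones
    ([phi_injective_pos]).  Both come from one computation with a partial
    Casimir operator.  For dual bases [e_j], [f_j] of the positive and negative
    root spaces put [S z = \sum_j [e_j, [f_j, z]]], the sum being over the
    heights below that of [z].  Invariance of the form yields, for root vectors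
    of positive weights [s] and [t],
      [S [x, y] = [S x, y] + [x, S y] - 2 (s, t) [x, y]],
    and [S] kills simple vectors.  So [S] multiplies a bracket monomial with
    letters of weights [t_1, ..., t_n] by the scalar
    [\sum_i (t_i, t_i) - (\sum_i t_i, \sum_i t_i)], called its defect.  The
    same identity holds with outer brackets taken in an algebra [U] mapping to
    [g], provided that the brackets are lifted along a partial inverse of
    [U -> g] ([casimir_lie]); this replaces the Verma modules and enveloping
    algebras of the Gabber-Kac theorem.

    Consider now an obstruction: a simple vector of [g] that is a sum of
    brackets, or an element of the kernel of [U -> g] of lowest height.  The
    operator kills it, so only monomials of defect zero matter
    ([eigen_expansion_eq0]).  As it is killed by lowering operators, its weight
    has nonpositive product with every simple root of positive norm; a sign
    count then shows that in a monomial of defect zero all letters have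
    nonpositive norm and are pairwise orthogonal ([defect0_orth]), hence
    commute, and a monomial of length at least two in commuting letters
    vanishes ([mon_commute]).

    Finally, a triangular decomposition of the universal algebra shows that the
    kernel of its map to [g] is central ([kernel_central]).  The image [N]
    contains all brackets of [g], so that [g / N] is commutative, and it acts on
    [N] through a complement of [N] in [g] that lies in [H] and is chosen
    compatibly with the center ([outer_complement]): this is the required extension. *)

(** * Complements, eigenvectors and dual bases *)

Section Complements.
Context (K : fieldType) (V : lmodType K).
Implicit Types (A B C : set V) (x y : V).

Lemma subspaceN A x : subspace A -> A x -> A (- x).
Proof. by case=> _ _ AZ Ax; rewrite -scaleN1r; exact: AZ. Qed.

Lemma subspaceB A x y : subspace A -> A x -> A y -> A (x - y).
Proof. by move=> sA Ax Ay; case: (sA) => _ AD _; apply: AD => //; exact: subspaceN. Qed.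

Lemma subspaceI A B : subspace A -> subspace B -> subspace (A `&` B).
Proof.
move=> [A0 AD AZ] [B0 BD BZ]; split=> //.
  by move=> x y [Ax Bx] [Ay By]; split; [exact: AD|exact: BD].
by move=> a x [Ax Bx]; split; [exact: AZ|exact: BZ].
Qed.

Definition sum_space A B : set V := [set x | exists2 a, A a & B (x - a)].

Lemma subspace_sum A B : subspace A -> subspace B -> subspace (sum_space A B).
Proof.
move=> [A0 AD AZ] [B0 BD BZ]; split.
- by exists 0; rewrite ?subrr.
- move=> x y [a Aa Bx] [b Ab By]; exists (a + b); first exact: AD.
  by rewrite opprD addrACA; exact: BD.
- by move=> c x [a Aa Bx]; exists (c *: a); [exact: AZ|rewrite -scalerBr; exact: BZ].
Qed.

(** Zorn's lemma for the subspaces of [B] that meet [A] trivially. *)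
Lemma complement_exists A B : subspace A -> subspace B -> A `<=` B ->
  exists C, [/\ subspace C, C `<=` B, forall x, A x -> C x -> x = 0
              & B `<=` sum_space A C].
Proof.
move=> sA sB AB; case: (sA) => A0 AD AZ; case: (sB) => B0 BD BZ.
(* The union of an empty chain is empty: [0 \in C] is not part of [P], and follows
   from maximality. *)
pose P C := [/\ C `<=` B, forall a x y, C x -> C y -> C (a *: x + y)
              & forall x, A x -> C x -> x = 0].
case: (@Zorn_bigcup V P) => [F FP Ftot|C [[CB CL CA] Cmax]].
  split.
  - by move=> x [C FC Cx]; case: (FP _ FC) => CB _ _; exact: CB.
  - move=> a x y [C FC Cx] [C' FC' C'y].
    have [CC'|C'C] := Ftot _ _ FC FC'.
      by exists C' => //; case: (FP _ FC') => _ CL _; apply: CL => //; exact: CC'.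
    by exists C => //; case: (FP _ FC) => _ CL _; apply: CL => //; exact: C'C.
  - by move=> x Ax [C FC Cx]; case: (FP _ FC) => _ _ CA; exact: CA.
have C0 : C 0.
  apply: contrapT => nC0; apply: (Cmax [set 0]); last first.
    split=> [x ->//|a x y -> ->|x _ ->//].
    by rewrite scaler0 addr0.
  split=> [x Cx|/(_ 0 erefl)//].
  by case: nC0; rewrite -(addNr x) -(scaleN1r x); exact: CL.
have sC : subspace C.
  split=> // [x y Cx Cy|a x Cx]; first by rewrite -[x]scale1r; exact: CL.
  by rewrite -[a *: x]addr0; exact: CL.
exists C; split=> // x Bx; apply: contrapT => nx.
pose C' := [set y | exists a, C (y - a *: x)].
apply: (Cmax C').
  split=> [y Cy|/(_ x) xC]; first by exists 0; rewrite scale0r subr0.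
  apply: nx; exists 0 => //; rewrite subr0; apply: xC; exists 1.
  by rewrite scale1r subrr.
split.
- move=> y [a /CB yC]; rewrite -(subrK (a *: x) y).
  by apply: BD => //; exact: BZ.
- move=> a y z [b yC] [c zC]; exists (a * b + c).
  have -> : a *: y + z - (a * b + c) *: x =
      a *: (y - b *: x) + (z - c *: x).
    by rewrite scalerDl scalerBr scalerA opprD addrACA.
  exact: CL.
- move=> y Ay [a yC].
  have [a0|a0] := eqVneq a 0.
    by move: yC; rewrite a0 scale0r subr0; exact: CA.
  case: nx; exists (a^-1 *: y); first exact: AZ.
  have -> : x - a^-1 *: y = (- a^-1) *: (y - a *: x) + 0.
    by rewrite addr0 scalerBr scalerA mulNr mulVf// scaleN1r opprK scaleNr addrC.
  exact: CL.
Qed.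

Lemma direct_projection A C : subspace A -> subspace C ->
    (forall x, A x -> C x -> x = 0) -> (forall x, sum_space A C x) ->
  exists p : {linear V -> V}, (forall x, A (p x)) /\ (forall x, C (x - p x)).
Proof.
move=> sA sC AC0 ACT.
have /choice[p pP] : forall x, exists y, A y /\ C (x - y).
  by move=> x; have [y Ay Cy] := ACT x; exists y.
have uniqp x y : A y -> C (x - y) -> p x = y.
  move=> Ay Cy; have [Ap Cp] := pP x; apply/eqP; rewrite -subr_eq0; apply/eqP.
  apply: AC0; first exact: subspaceB.
  have -> : p x - y = (x - y) - (x - p x) by rewrite opprB [RHS]addrC subrKA.
  exact: subspaceB.
have linp : linear p.
  case: (sA) => _ AD AZ; case: (sC) => _ CD CZ.
  move=> a x y; have [Ax Cx] := pP x; have [Ay Cy] := pP y; apply: uniqp.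
    by apply: AD => //; exact: AZ.
  rewrite opprD addrACA -scalerBr; apply: CD => //; exact: CZ.
pose pL := GRing.isLinear.Build K V V *:%R p linp.
pose q : {linear V -> V} := HB.pack p pL.
by exists q; split=> x; case: (pP x).
Qed.

Lemma projection_exists A : subspace A ->
  exists p : {linear V -> V}, (forall x, A (p x)) /\ (forall x, A x -> p x = x).
Proof.
move=> sA; have sT : subspace [set: V] by [].
have [C [sC _ AC0 ACT]] := complement_exists sA sT (@subsetT _ _).
have [|p [pA pC]] := direct_projection sA sC AC0 _; first by move=> x; exact: ACT.
exists p; split=> // x Ax; apply/eqP; rewrite eq_sym -subr_eq0; apply/eqP.
by apply: AC0 => //; exact: subspaceB.
Qed.

End Complements.

Section LinearAlgebra.
Context (K : fieldType) (V : lmodType K).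

(** The product of the [S - a], for [a] among the nonzero eigenvalues, kills
    every [v i], while it multiplies [x] by a nonzero scalar because [S x = 0]. *)
Lemma eigen_expansion_eq0 (S : {linear V -> V}) (x : V) (I : eqType)
    (r : seq I) (s : I -> K) (v : I -> V) :
  x = \sum_(i <- r) v i -> S x = 0 ->
  (forall i, i \in r -> S (v i) = s i *: v i) ->
  (forall i, i \in r -> s i = 0 -> v i = 0) -> x = 0.
Proof.
move=> xE Sx0 Sv v0.
have key t : \sum_(i <- r) (\prod_(a <- t) (s i - a)) *: v i =
    (\prod_(a <- t) (0 - a)) *: x.
  elim: t => [|a t IH].
    by rewrite big_nil scale1r xE; apply: eq_bigr => i _; rewrite big_nil scale1r.
  rewrite big_cons mulrC -scalerA sub0r scaleNr -sub0r.
  have -> : 0 - a *: x = S x - a *: x by rewrite Sx0.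
  rewrite scalerBr -linearZ /= [_ *: (a *: x)]scalerA mulrC -scalerA -IH.
  rewrite linear_sum scaler_sumr -sumrB !big_seq; apply: eq_bigr => i ir.
  by rewrite linearZ /= Sv// big_cons !scalerA -scalerBl; congr (_ *: _); ring.
(* At the list of nonzero eigenvalues, each term on the left vanishes. *)
pose t := [seq a <- map s r | a != 0].
have := key t; rewrite big_seq big1 => [/esym/eqP|i ir].
  rewrite scaler_eq0 => /orP[|/eqP//]; rewrite prodf_seq_eq0 => /hasP[a].
  by rewrite mem_filter => /andP[a0 _] /=; rewrite sub0r oppr_eq0 (negPf a0).
have [si0|si0] := eqVneq (s i) 0; first by rewrite (v0 i)// scaler0.
apply/eqP; rewrite scaler_eq0 prodf_seq_eq0; apply/orP; left; apply/hasP.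
by exists (s i) => /=; rewrite ?subrr// mem_filter si0 map_f.
Qed.

(** Defined by recursion on the list, so that inductions on dimension remove
    one vector at a time; the list need not lie in the space that it bounds. *)
Fixpoint lspan (s : seq V) (x : V) : Prop :=
  if s is v :: s' then exists a, lspan s' (x - a *: v) else x = 0.

Lemma lspan_map (p : {linear V -> V}) s x : lspan s x -> lspan (map p s) (p x).
Proof.
elim: s x => [|v s IH] x /= => [->|[a /IH]]; first by rewrite linear0.
by rewrite linearB linearZ /= => h; exists a.
Qed.

Lemma lspan_sum (s : seq V) (c : nat -> K) :
  lspan s (\sum_(i < size s) c i *: s`_i).
Proof.
elim: s c => [|v s IH] c /=; first by rewrite big_ord0.
exists (c 0%N); rewrite big_ord_recl /= addrC addKr.
exact: (IH (fun i => c i.+1)).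
Qed.

Lemma lspan_subspace s : subspace (lspan s).
Proof.
elim: s => [|v s [s0 sD sZ]] /=.
  by split=> // [x y -> ->|a x ->]; rewrite ?addr0 ?scaler0.
split.
- by exists 0; rewrite scale0r subr0.
- by move=> x y [a xa] [b yb]; exists (a + b); rewrite scalerDl opprD addrACA; exact: sD.
- by move=> a x [b xb]; exists (a * b); rewrite -scalerA -scalerBr; exact: sZ.
Qed.

Lemma finite_dim_lspan (A : set V) : finite_dim A ->
  exists s, A `<=` lspan s.
Proof. by case=> s [_ As]; exists s => x /As[c ->]; exact: lspan_sum. Qed.

End LinearAlgebra.

Section DualBases.
Context (K : fieldType) (V : lmodType K) (b : {biscalar V}).

Lemma bilDl x y z : b (x + y) z = b x z + b y z.
Proof. exact: linearDl. Qed.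
Lemma bilDr x y z : b x (y + z) = b x y + b x z.
Proof. exact: linearD. Qed.
Lemma bilZl a x y : b (a *: x) y = a * b x y.
Proof. exact: linearZl_LR. Qed.
Lemma bilZr a x y : b x (a *: y) = a * b x y.
Proof. exact: linearZr_LR. Qed.
Lemma bilNl x y : b (- x) y = - b x y.
Proof. by rewrite -scaleN1r bilZl mulN1r. Qed.
Lemma bilNr x y : b x (- y) = - b x y.
Proof. by rewrite -scaleN1r bilZr mulN1r. Qed.
Lemma bilBl x y z : b (x - y) z = b x z - b y z.
Proof. by rewrite bilDl bilNl. Qed.
Lemma bilBr x y z : b x (y - z) = b x y - b x z.
Proof. by rewrite bilDr bilNr. Qed.
Lemma bil0l y : b 0 y = 0.
Proof. by rewrite -(scale0r 0) bilZl mul0r. Qed.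
Lemma bil0r x : b x 0 = 0.
Proof. by rewrite -(scale0r 0) bilZr mul0r. Qed.
Lemma bil_suml I (r : seq I) P F y :
  b (\sum_(i <- r | P i) F i) y = \sum_(i <- r | P i) b (F i) y.
Proof.
by apply: (big_morph (fun x => b x y)) => [u v|]; [exact: bilDl|exact: bil0l].
Qed.
Lemma bil_sumr I (r : seq I) P F x :
  b x (\sum_(i <- r | P i) F i) = \sum_(i <- r | P i) b x (F i).
Proof. by apply: (big_morph (b x)) => [u v|]; [exact: bilDr|exact: bil0r]. Qed.

Definition dual_bases (A B : set V) (r : seq (V * V)) : Prop :=
  [/\ uniq r, (forall p, p \in r -> A p.1 /\ B p.2),
      (forall p q, p \in r -> q \in r -> b p.1 q.2 = (p == q)%:R),
      (forall x, A x -> x = \sum_(p <- r) b x p.2 *: p.1)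
    & (forall y, B y -> y = \sum_(p <- r) b p.1 y *: p.2)].

(** A vector [x0] of [A] outside the span of the tail of [s], and [w] in [B] with
    [b x0 w = 1], form the first pair; the orthogonal of [w] in [A] and that of
    [x0] in [B] are again in duality, and project into a shorter span. *)
Lemma dual_bases_exist (s : seq V) (A B : set V) :
    subspace A -> subspace B -> A `<=` lspan s ->
    (forall x, A x -> (forall y, B y -> b x y = 0) -> x = 0) ->
    (forall y, B y -> (forall x, A x -> b x y = 0) -> y = 0) ->
  exists r, dual_bases A B r.
Proof.
have [n] := ubnP (size s); elim: n => // n IH in s A B *.
case: s => [_|v s sz] sA sB As ndA ndB.
  exists [::]; split=> // [x /As /= ->|y By]; first by rewrite big_nil.
  by rewrite big_nil; apply: ndB => // x /As /= ->; rewrite bil0l.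
have [Ass|] := pselect (A `<=` lspan s); first exact: (IH s).
move=> /existsNP[x0 /not_implyP[Ax0 nx0]].
have [a0 x0a] := As _ Ax0.
have a00 : a0 != 0.
  by apply/eqP => a00; apply: nx0; move: x0a; rewrite a00 scale0r subr0.
have [w Bw xw] : exists2 w, B w & b x0 w = 1.
  apply: contrapT => nw; apply: nx0.
  have -> : x0 = 0; last by case: (lspan_subspace s).
  apply: ndA => // y By; apply: contrapT => /eqP bxy; case: nw.
  exists ((b x0 y)^-1 *: y); first by case: sB => _ _; exact.
  by rewrite bilZr mulVf.
case: (sA) => A0 AD AZ; case: (sB) => B0 BD BZ.
pose pr x := x - b x w *: x0.
have linpr : linear pr.
  move=> a x y; rewrite /pr bilDl bilZl scalerDl scalerBr scalerA opprD.
  by rewrite addrACA.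
pose prL := GRing.isLinear.Build K V V *:%R pr linpr.
pose p : {linear V -> V} := HB.pack pr prL.
pose A1 := A `&` [set x | b x w = 0].
pose B1 := B `&` [set y | b x0 y = 0].
have sA1 : subspace A1.
  apply: subspaceI => //; split=> /= [|x y xw0 yw0|a x xw0].
  - exact: bil0l.
  - by rewrite bilDl xw0 yw0 addr0.
  - by rewrite bilZl xw0 mulr0.
have sB1 : subspace B1.
  apply: subspaceI => //; split=> /= [|x y xw0 yw0|a x xw0].
  - exact: bil0r.
  - by rewrite bilDr xw0 yw0 addr0.
  - by rewrite bilZr xw0 mulr0.
have pA x : A x -> A1 (x - b x w *: x0).
  move=> Ax; split; first by apply: subspaceB => //; exact: AZ.
  by rewrite /= bilBl bilZl xw mulr1 subrr.
have pB y : B y -> B1 (y - b x0 y *: w).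
  move=> By; split; first by apply: subspaceB => //; exact: BZ.
  by rewrite /= bilBr bilZr xw mulr1 subrr.
have A1s : A1 `<=` lspan (map p s).
  move=> x [Ax xw0]; have [c xc] := As _ Ax.
  have px0 : pr x0 = 0 by rewrite /pr xw scale1r subrr.
  have -> : x = p (x - (c / a0) *: x0).
    rewrite linearB linearZ /= px0 scaler0 subr0 /pr.
    by move: xw0 => /= ->; rewrite scale0r subr0.
  apply: lspan_map.
  (* [c] and [a0] are the coefficients of [v] in [x] and [x0]. *)
  have -> : x - (c / a0) *: x0 = (x - c *: v) - (c / a0) *: (x0 - a0 *: v).
    rewrite scalerBr scalerA divfK// opprB.
    by rewrite subrKA.
  have sL := lspan_subspace s.
  by apply: subspaceB => //; case: sL => _ _; exact.
have [|||r [ur rAB rd rA rB]] := IH _ A1 B1 _ sA1 sB1 A1s.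
- by rewrite size_map.
- move=> x [Ax xw0] xB1; apply: ndA => // y By.
  rewrite -(subrK (b x0 y *: w) y) bilDr bilZr xw0 mulr0 addr0.
  by apply: xB1; exact: pB.
- move=> y [By yw0] yA1; apply: ndB => // x Ax.
  rewrite -(subrK (b x w *: x0) x) bilDl bilZl yw0 mulr0 addr0.
  by apply: yA1; exact: pA.
have r0w q : q \in r -> b q.1 w = 0 /\ b x0 q.2 = 0.
  by move=> /rAB[[_ ?] [_ ?]].
exists ((x0, w) :: r); split.
- rewrite /= ur andbT; apply/negP => /r0w[/= /eqP].
  by rewrite xw oner_eq0.
- by move=> q; rewrite inE => /orP[/eqP->//|/rAB[[? _] [? _]]].
- move=> q q'; rewrite !inE => /orP[/eqP->|qr] /orP[/eqP->|qr'] /=.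
  + by rewrite xw eqxx.
  + have [_ ->] := r0w _ qr'; case: eqP => // e; move: (r0w _ qr').
    by rewrite -e /= xw => -[/eqP]; rewrite oner_eq0.
  + have [-> _] := r0w _ qr; case: eqP => // e; move: (r0w _ qr).
    by rewrite e /= xw => -[/eqP]; rewrite oner_eq0.
  + exact: rd.
- move=> x Ax; rewrite big_cons /=.
  rewrite -[LHS](subrK (b x w *: x0)) [LHS]addrC; congr (_ + _).
  rewrite [LHS]rA; last exact: pA.
  rewrite !big_seq; apply: eq_bigr => q /r0w[_ q0].
  by rewrite bilBl bilZl q0 mulr0 subr0.
- move=> y By; rewrite big_cons /=.
  rewrite -[LHS](subrK (b x0 y *: w)) [LHS]addrC; congr (_ + _).
  rewrite [LHS]rB; last exact: pB.
  rewrite !big_seq; apply: eq_bigr => q /r0w[q0 _].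
  by rewrite bilBr bilZr q0 mulr0 subr0.
Qed.

End DualBases.

(** * Brackets, sl2 and Lie monomials *)

Section LieLemmas.
Context (K : fieldType) (L : lieAlgType K).
Implicit Types (x y z e f v : L).

Lemma lie0l x : [Lie 0, x] = 0.
Proof. by have := lieZl 0 0 x; rewrite !scale0r. Qed.
Lemma lie0r x : [Lie x, 0] = 0.
Proof. by have := lieZr 0 x 0; rewrite !scale0r. Qed.
Lemma lieBl x y z : [Lie x - y, z] = [Lie x, z] - [Lie y, z].
Proof. by rewrite lieDl lieNl. Qed.
Lemma lieBr x y z : [Lie x, y - z] = [Lie x, y] - [Lie x, z].
Proof. by rewrite lieDr lieNr. Qed.
Lemma lie_suml I (r : seq I) P F y :
  [Lie \sum_(i <- r | P i) F i, y] = \sum_(i <- r | P i) [Lie F i, y].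
Proof.
by apply: (big_morph (fun x => [Lie x, y])) => [u v|]; [exact: lieDl|exact: lie0l].
Qed.
Lemma lie_sumr I (r : seq I) P F x :
  [Lie x, \sum_(i <- r | P i) F i] = \sum_(i <- r | P i) [Lie x, F i].
Proof.
by apply: (big_morph (fun y => [Lie x, y])) => [u v|]; [exact: lieDr|exact: lie0r].
Qed.

Lemma lie_leibniz x y z :
  [Lie x, [Lie y, z]] = [Lie [Lie x, y], z] + [Lie y, [Lie x, z]].
Proof.
have := lie_jacobi x y z; rewrite (lieC z x) lieNr (lieC z [Lie x, y]).
by move/eqP; rewrite subr_eq add0r subr_eq => /eqP.
Qed.

Lemma lie_leibnizl x y z :
  [Lie [Lie x, y], z] = [Lie x, [Lie y, z]] - [Lie y, [Lie x, z]].
Proof. by rewrite lie_leibniz addrK. Qed.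

Lemma iter_lie0 e n : iter n (lie e) 0 = 0.
Proof. by elim: n => //= n ->; rewrite lie0r. Qed.

Lemma iter_lieD e n x y :
  iter n (lie e) (x + y) = iter n (lie e) x + iter n (lie e) y.
Proof. by elim: n => //= n ->; rewrite lieDr. Qed.

Lemma iter_lieZ e n a x : iter n (lie e) (a *: x) = a *: iter n (lie e) x.
Proof. by elim: n => //= n ->; rewrite lieZr. Qed.

Lemma iter_lie_le e n m x :
  (n <= m)%N -> iter n (lie e) x = 0 -> iter m (lie e) x = 0.
Proof. by move=> nm x0; rewrite -(subnK nm) iterD x0 iter_lie0. Qed.

(** Of [n + m] applications of [e], at least [n] fall on [x] or at least [m] on
    [y]. *)
Lemma nilpotent_lie e n m x y : iter n (lie e) x = 0 -> iter m (lie e) y = 0 ->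
  iter (n + m) (lie e) [Lie x, y] = 0.
Proof.
have [k] := ubnP (n + m)%N; elim: k => // k IH in n m x y *.
case: n => [|n] nmk; first by move=> /= ->; rewrite lie0l iter_lie0.
case: m nmk => [|m] nmk x0 y0; first by rewrite [y]y0 lie0r iter_lie0.
rewrite addSn iterSr lie_leibniz iter_lieD.
rewrite (IH n m.+1) ?add0r -?iterSr//.
by rewrite addnS -addSn (IH n.+1 m) -?iterSr//; move: nmk; rewrite !addnS !addSn !ltnS.
Qed.

End LieLemmas.

Section SL2.
Context (K : numFieldType) (L : lieAlgType K) (e f v : L) (c : K).
Hypotheses (ee : [Lie [Lie e, f], e] = 2 *: e) (ev : [Lie [Lie e, f], v] = c *: v).
Hypothesis fv : [Lie f, v] = 0.

Let hw n : [Lie [Lie e, f], iter n (lie e) v] = (c + 2 * n%:R) *: iter n (lie e) v.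
Proof.
elim: n => [|n IH]; first by rewrite mulr0 addr0.
rewrite iterS lie_leibniz ee IH lieZl lieZr -scalerDl; congr (_ *: _).
by rewrite -natr1; ring.
Qed.

Let fw n : [Lie f, iter n.+1 (lie e) v] =
  - (n.+1%:R * (c + n%:R)) *: iter n (lie e) v.
Proof.
elim: n => [|n IH].
  rewrite /= lie_leibniz fv lie0r addr0 (lieC f e) lieNl ev -scaleNr. congr (_ *: _); ring.
rewrite iterS lie_leibniz IH lieZr -iterS (lieC f e) lieNl hw -scaleNr -scalerDl.
by congr (_ *: _); rewrite -[n.+2%:R]natr1 -[n.+1%:R]natr1; ring.
Qed.

(** In [f e^(n+1) v = - (n+1) (c + n) e^n v] the scalar must vanish at the first
    power of [e] that kills [v]. *)
Lemma sl2_lowest N : v <> 0 -> iter N (lie e) v = 0 ->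
  exists m : nat, c = - m%:R /\ iter m.+1 (lie e) v = 0.
Proof.
move=> v0; elim: N => [//|N IH] eN.
have [|nN] := pselect (iter N (lie e) v = 0); first exact: IH.
exists N; split=> //; have := fw N; rewrite eN lie0r => /esym/eqP.
rewrite scaler_eq0 oppr_eq0 mulf_eq0 pnatr_eq0 /= => /orP[|/eqP//].
by rewrite addr_eq0 => /eqP.
Qed.

End SL2.

Section Monomials.
Context (K : fieldType) (V : lieAlgType K) (W : zmodType) (L : W -> V -> Prop).

(** Monomials remember the list of weights of their letters and not only its
    sum: linear dependences between simple roots give different lists with the
    same sum, and the Casimir eigenvalue depends on the list. *)
Inductive mon : seq W -> V -> Prop :=
| mon1 w x of L w x : mon [:: w] x
| monB l l' x y of mon l x & mon l' y : mon (l ++ l') [Lie x, y].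

Inductive msum (Q : seq W -> Prop) : V -> Prop :=
| msum0 : msum Q 0
| msumA l x y of mon l x & Q l & msum Q y : msum Q (x + y).

Lemma mon_msum (Q : seq W -> Prop) l x : mon l x -> Q l -> msum Q x.
Proof. by move=> lx Ql; rewrite -[x]addr0; apply: msumA lx Ql _; exact: msum0. Qed.

Lemma msumD (Q : seq W -> Prop) x y : msum Q x -> msum Q y -> msum Q (x + y).
Proof.
move=> Qx Qy; elim: Qx => [|l u v lu Ql _ IH]; first by rewrite add0r.
by rewrite -addrA; exact: msumA lu Ql IH.
Qed.

Lemma msum_sub (Q Q' : seq W -> Prop) x : (forall l, Q l -> Q' l) ->
  msum Q x -> msum Q' x.
Proof.
move=> QQ'; elim=> [|l u v lu Ql _ IH]; first exact: msum0.
exact: msumA lu (QQ' _ Ql) IH.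
Qed.

Lemma msum_lie (Q Q1 Q2 : seq W -> Prop) x y :
    (forall l l', Q1 l -> Q2 l' -> Q (l ++ l')) ->
  msum Q1 x -> msum Q2 y -> msum Q [Lie x, y].
Proof.
move=> QQ; elim=> [|l u v lu Ql _ IH] Qy; first by rewrite lie0l; exact: msum0.
rewrite lieDl; apply: msumD; last exact: IH.
elim: Qy => [|l' u' v' lu' Ql' _ IH']; first by rewrite lie0r; exact: msum0.
by rewrite lieDr; apply: msumD => //; apply: mon_msum (monB lu lu') _; exact: QQ.
Qed.

Lemma msum_list (Q : seq W -> Prop) x : msum Q x ->
  exists r : seq (seq W * V), x = \sum_(p <- r) p.2 /\
    forall p, p \in r -> mon p.1 p.2 /\ Q p.1.
Proof.
elim=> [|l u v lu Ql _ [r [-> rP]]]; first by exists [::]; rewrite big_nil.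
exists ((l, u) :: r); rewrite big_cons; split=> // p.
by rewrite inE => /orP[/eqP->//|/rP].
Qed.

Lemma msum_scale (Q : seq W -> Prop) a x :
  (forall w y, L w y -> L w (a *: y)) -> msum Q x -> msum Q (a *: x).
Proof.
move=> La; have lZ l u : mon l u -> mon l (a *: u).
  elim=> [w z Lz|l1 l2 z t _ IHz lt _]; first exact/mon1/La.
  by rewrite -lieZl; exact: monB.
elim=> [|l u v lu Ql _ IH]; first by rewrite scaler0; exact: msum0.
by rewrite scalerDr; exact: msumA (lZ _ _ lu) Ql IH.
Qed.

Lemma mon_size l x : mon l x -> (0 < size l)%N.
Proof. by elim=> // l1 l2 y z _ l1y _ _; rewrite size_cat ltn_addr. Qed.

Lemma mon_all (P : pred W) l x : (forall w y, L w y -> P w) -> mon l x -> all P l.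
Proof.
move=> LP; elim=> [w y /LP /= ->//|l1 l2 y z _ l1P _ l2P].
by rewrite all_cat l1P.
Qed.

(** Two letters commute; a longer monomial has a factor of length at least two. *)
Lemma mon_commute (r : rel W) l x :
    (forall w w' y z, r w w' -> L w y -> L w' z -> [Lie y, z] = 0) ->
  mon l x -> pairwise r l -> (1 < size l)%N -> x = 0.
Proof.
move=> rC; elim=> // l1 l2 y z l1y IHy l2z IHz.
rewrite pairwise_cat => /and3P[r12 r1 r2] _.
have [s1|s1] := ltnP 1 (size l1); first by rewrite IHy// lie0l.
have [s2|s2] := ltnP 1 (size l2); first by rewrite IHz// lie0r.
case: l1y r12 s1 {IHy r1} => [w y' Ly|k k' u u' ku ku' _]; last first.
  by rewrite size_cat => /(leq_trans (leq_add (mon_size ku) (mon_size ku'))).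
case: l2z s2 {IHz r2} => [w' z' Lz|k k' u u' ku ku']; last first.
  by rewrite size_cat => /(leq_trans (leq_add (mon_size ku) (mon_size ku'))).
by move=> _ /allrelP/(_ w w'); rewrite !inE !eqxx => /(_ isT isT) rw _; exact: rC Ly Lz.
Qed.

End Monomials.

(** * Lie algebras graded by roots *)

Section RootGrading.
Context (R : realType) (g : lieAlgType R[i]) (form : {biscalar g}) (H HR : set g).
Local Notation "a %:C" := (real_complex R a).
Implicit Types (s t k h x y z : g).

Definition ip x y : R := complex.Re (form x y).

(** A weight is represented by the vector of [H] that is dual to it.  Adding
    weights is then adding vectors, and the inner product of weights is the
    form itself. *)
Definition wsp t : set g := [set x | forall k, H k -> [Lie k, x] = form t k *: x].

Definition root t : Prop := [/\ HR t, t <> 0 & exists2 x, wsp t x & x <> 0].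

Record root_graded : Prop := RootGraded {
  rg_sym : forall x y, form x y = form y x;
  rg_inv : forall x y z, form x [Lie y, z] = form [Lie x, y] z;
  rg_nd : forall x, (forall y, form x y = 0) -> x = 0;
  rg_HRH : HR `<=` H;
  rg_HR0 : HR 0;
  rg_HRD : forall x y, HR x -> HR y -> HR (x + y);
  rg_HRN : forall x, HR x -> HR (- x);
  rg_H : forall x, H x <-> wsp 0 x;
  rg_Hnd : forall t, H t -> (forall k, H k -> form t k = 0) -> t = 0;
  rg_real : forall s t, HR s -> HR t -> form s t = (ip s t)%:C;
  rg_dec : forall x, exists r : seq (g * g), x = \sum_(p <- r) p.2 /\
    forall p, p \in r -> HR p.1 /\ wsp p.1 p.2;
  rg_fin : forall t, root t -> exists r, wsp t `<=` lspan r;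
  rg_bound : exists M, forall t, root t -> ip t t <= M
}.

(** These conditions are invariant under [h |-> - h], which exchanges positive and
    negative roots; every statement on positive roots thus has a mirror image. *)
Record height_vector h : Prop := HeightVector {
  hv_HR : HR h;
  hv_neq0 : forall t, root t -> ip t h != 0;
  hv_fin : forall M, exists r : seq g,
    forall t, root t -> `|ip t h| < M -> t \in r;
  hv_imag : forall s t, root s -> root t -> ip s s <= 0 -> ip t t <= 0 ->
    0 < ip s h * ip t h -> ip s t <= 0 /\
    (ip s t = 0 -> forall x y, wsp s x -> wsp t y -> [Lie x, y] = 0)
}.

Lemma ipDl x y z : ip (x + y) z = ip x z + ip y z.
Proof. by rewrite /ip bilDl; case: (form x z) (form y z) => a b []. Qed.
Lemma ipDr x y z : ip x (y + z) = ip x y + ip x z.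
Proof. by rewrite /ip bilDr; case: (form x y) (form x z) => a b []. Qed.
Lemma ipNl x y : ip (- x) y = - ip x y.
Proof. by rewrite /ip bilNl; case: (form x y). Qed.
Lemma ipNr x y : ip x (- y) = - ip x y.
Proof. by rewrite /ip bilNr; case: (form x y). Qed.
Lemma ip0l x : ip 0 x = 0.
Proof. by rewrite /ip bil0l. Qed.
Lemma ip_suml I (r : seq I) F y : ip (\sum_(i <- r) F i) y = \sum_(i <- r) ip (F i) y.
Proof. by apply: (big_morph (fun x => ip x y)) => [u v|]; [exact: ipDl|exact: ip0l]. Qed.

Hypothesis X : root_graded.

Lemma ipC x y : ip x y = ip y x.
Proof. by rewrite /ip (rg_sym X). Qed.

Lemma form_lie_l x y z : form [Lie x, y] z = - form y [Lie x, z].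
Proof. by rewrite lieC bilNl (rg_inv X). Qed.

Lemma wsp_subspace t : subspace (wsp t).
Proof.
split=> [k _|x y tx ty k Hk|a x tx k Hk]; first by rewrite lie0r scaler0.
  by rewrite lieDr (tx k)// (ty k)// scalerDr.
by rewrite lieZr (tx k)// !scalerA mulrC.
Qed.

Lemma wsp0 t : wsp t 0. Proof. by case: (wsp_subspace t). Qed.
Lemma wspD t x y : wsp t x -> wsp t y -> wsp t (x + y).
Proof. by case: (wsp_subspace t) => _ h _; exact: h. Qed.
Lemma wspZ t a x : wsp t x -> wsp t (a *: x).
Proof. by case: (wsp_subspace t) => _ _; exact. Qed.
Lemma wsp_sum t (I : eqType) (r : seq I) (P : pred I) F :
  (forall i, i \in r -> P i -> wsp t (F i)) -> wsp t (\sum_(i <- r | P i) F i).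
Proof.
move=> tF; rewrite big_seq_cond; elim/big_ind: _ => [|x y|i /andP[]].
- exact: wsp0.
- exact: wspD.
- exact: tF.
Qed.

Lemma wsp_lie s t x y : wsp s x -> wsp t y -> wsp (s + t) [Lie x, y].
Proof.
move=> sx ty k Hk; rewrite lie_leibniz (sx k)// (ty k)// lieZl lieZr -scalerDl.
by rewrite bilDl.
Qed.

Lemma H_subspace : subspace H.
Proof.
have [h0 hD hZ] := wsp_subspace 0; split.
- by apply/(rg_H X); exact: h0.
- by move=> x y /(rg_H X) Hx /(rg_H X) Hy; apply/(rg_H X); exact: hD.
- by move=> a x /(rg_H X) Hx; apply/(rg_H X); exact: hZ.
Qed.

Lemma wsp_orth s t x y : H s -> H t -> s + t != 0 -> wsp s x -> wsp t y ->
  form x y = 0.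
Proof.
move=> Hs Ht st0 sx ty; apply: contrapT => /eqP xy0.
have Hst : H (s + t) by case: H_subspace => _ HD _; exact: HD.
move/eqP: st0; apply; apply: (rg_Hnd X) Hst _ => k Hk.
have := form_lie_l k x y; rewrite (sx k Hk) (ty k Hk) bilZl bilZr => /eqP.
by rewrite -addr_eq0 -mulrDl mulf_eq0 (negPf xy0) orbF bilDl => /eqP.
Qed.

Lemma HRB s t : HR s -> HR t -> HR (s - t).
Proof. by move=> Hs Ht; apply: (rg_HRD X) => //; exact: (rg_HRN X). Qed.

Lemma wsp_orthR s t x y : HR s -> HR t -> s + t != 0 -> wsp s x -> wsp t y ->
  form x y = 0.
Proof. by move=> /(rg_HRH X) Hs /(rg_HRH X) Ht; exact: wsp_orth. Qed.

(** Both sides lie in [H], where they have the same products with all elements. *)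
Lemma wsp_lie0 t x y : HR t -> wsp t x -> wsp (- t) y ->
  [Lie x, y] = form x y *: t.
Proof.
move=> Ht tx ty; apply/eqP; rewrite -subr_eq0; apply/eqP.
have H0 := rg_H X.
have [s0 sD sZ] := wsp_subspace 0.
have wt : wsp 0 t by apply/H0; exact: (rg_HRH X).
apply: (rg_Hnd X).
  apply/H0; apply: (@subspaceB _ _ (wsp 0)); [exact: wsp_subspace| |exact: wspZ].
  by rewrite -(subrr t); exact: wsp_lie.
move=> k Hk; rewrite bilBl bilZl -(rg_inv X) (lieC y) (ty k)// bilNl scaleNr opprK bilZr.
by rewrite mulrC subrr.
Qed.

Lemma wsp_nd t x : HR t -> wsp t x ->
  (forall y, wsp (- t) y -> form x y = 0) -> x = 0.
Proof.
move=> Ht tx xy; apply: (rg_nd X) => y.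
have [r [-> rP]] := rg_dec X y; rewrite bil_sumr big_seq big1// => p /rP[Hp pp].
have [tp|tp] := eqVneq (t + p.1) 0; last exact: wsp_orthR tp tx pp.
by apply: xy; rewrite -(addKr t p.1) tp addr0 in pp.
Qed.

(** The partial sum is orthogonal to all weight vectors, as pairing with one of
    weight [- t] does not see the terms of weight other than [t]. *)
Lemma wsp_indep (I : eqType) (r : seq I) (w v : I -> g) t :
    (forall i, i \in r -> HR (w i) /\ wsp (w i) (v i)) -> HR t ->
  \sum_(i <- r) v i = 0 -> \sum_(i <- r | w i == t) v i = 0.
Proof.
move=> rP Ht r0; apply: (wsp_nd Ht).
  by apply: wsp_sum => i /rP[_ wi] /eqP<-.
move=> y ty; transitivity (form (\sum_(i <- r) v i) y); last by rewrite r0 bil0l.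
rewrite !bil_suml [RHS](bigID (fun i => w i == t)) /=.
rewrite [X in _ + X]big_seq_cond [X in _ + X]big1 ?addr0//.
move=> i /andP[/rP[Hi wi] it]; apply: wsp_orthR _ _ _ wi ty => //.
  exact: (rg_HRN X).
by rewrite subr_eq0.
Qed.

Lemma root_opp t : root t -> root (- t).
Proof.
move=> [Ht t0 [x tx x0]]; split; first exact: (rg_HRN X).
  by move/eqP; rewrite oppr_eq0 => /eqP.
apply: contrapT => n; apply: x0; apply: (wsp_nd Ht tx) => y ty.
suff -> : y = 0 by rewrite bil0r.
by apply: contrapT => y0; apply: n; exists y.
Qed.

Lemma wsp_root t x : HR t -> t != 0 -> wsp t x -> x <> 0 -> root t.
Proof. by move=> Ht /eqP t0 tx x0; split=> //; exists x. Qed.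

Lemma height_vectorN h : height_vector h -> height_vector (- h).
Proof.
case=> Hh h0 hf hi; split; first exact: (rg_HRN X).
- by move=> t /h0; rewrite ipNr oppr_eq0.
- by move=> M; have [r rP] := hf M; exists r => t; rewrite ipNr normrN; exact: rP.
- by move=> s t rs rt s0 t0; rewrite !ipNr mulrNN; exact: hi.
Qed.

Section Height.
Context (h : g) (Y : height_vector h).

Lemma wsp_ht t x : HR t -> ip t h != 0 -> wsp t x -> x <> 0 -> root t.
Proof.
move=> Ht th; apply: wsp_root => //; apply: contra_neq th => ->.
by rewrite ip0l.
Qed.

Lemma wsp_ht0 t x : HR t -> t != 0 -> ip t h = 0 -> wsp t x -> x = 0.
Proof.
move=> Ht t0 th tx; apply: contrapT => x0.
by have := hv_neq0 Y (wsp_root Ht t0 tx x0); rewrite th eqxx.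
Qed.

(** Only finitely many roots have height below 1. *)
Lemma height_gap : exists2 eps : R, 0 < eps &
  forall t x, HR t -> 0 < ip t h -> wsp t x -> x <> 0 -> eps <= ip t h.
Proof.
have [r rP] := hv_fin Y 1.
pose m := \big[Num.min/1]_(t <- r | 0 < ip t h) ip t h.
exists m.
  rewrite /m; elim/big_ind: _ => // x y x0 y0; rewrite lt_min x0//.
move=> t x Ht th tx x0.
have rt : root t by apply: wsp_ht tx x0 => //; rewrite gt_eqF.
have [t1|t1] := ltP (ip t h) 1.
  have tr : t \in r by apply: rP => //; rewrite gtr0_norm.
  rewrite /m; elim: r tr {rP m} => // u r IH; rewrite inE big_cons => /orP[/eqP<-|/IH le].
    by rewrite th ge_min lexx.
  by case: ifP => // _; rewrite ge_min le orbT.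
apply: le_trans t1; rewrite /m; elim: r {rP m} => [|u r IH]; first by rewrite big_nil.
by rewrite big_cons; case: ifP => // _; rewrite ge_min IH orbT.
Qed.

End Height.

(** Sums of positive roots have heights that need not be well ordered a priori;
    steps of fixed size [eps] make the induction possible. *)
Lemma height_ind (eps : R) (P : R -> Prop) : 0 < eps ->
  (forall c : R, (forall c' : R, 0 <= c' -> c' + eps <= c -> P c') -> P c) ->
  forall c : R, P c.
Proof.
move=> e0 IH c.
have [n cn] : exists n : nat, c < n%:R * eps.
  exists (Num.bound (c / eps)).
  rewrite -ltr_pdivrMr//; apply: le_lt_trans (ler_norm _) _.
  have := @archi_boundP R `|c / eps| (normr_ge0 _).
  by rewrite /Num.bound normr_id.
elim: n c cn => [|n IHn] c cn; apply: IH => c' c0 cc.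
  by exfalso; move: cn; rewrite mul0r; lra.
by apply: IHn; move: cn; rewrite -natr1 mulrDl mul1r; lra.
Qed.

End RootGrading.

(** * The Casimir identity *)

Section Casimir.
Context (R : realType) (g : lieAlgType R[i]) (form : {biscalar g}) (H HR : set g).
Local Notation "a %:C" := (real_complex R a).
Local Notation ip := (ip form).
Local Notation wsp := (wsp form H).
Local Notation root := (root form H HR).
Hypothesis X : root_graded form H HR.
Context (h : g) (Y : height_vector form H HR h).
Implicit Types (s t k x y z : g).

(** An entry [(t, (e, f))] of [B] consists of a positive root [t] of height below
    [c] and of a pair of dual basis vectors of the root spaces of [t] and [- t]. *)
Record dual_system (c : R) (B : seq (g * (g * g))) : Prop := DualSystem {
  ds_mem : forall p, p \in B -> [/\ root p.1, 0 < ip p.1 h,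
    wsp p.1 p.2.1 & wsp (- p.1) p.2.2];
  ds_pos : forall t x, HR t -> 0 < ip t h -> ip t h < c -> wsp t x ->
    x = \sum_(p <- B) form x p.2.2 *: p.2.1;
  ds_neg : forall t y, HR t -> 0 < ip t h -> ip t h < c -> wsp (- t) y ->
    y = \sum_(p <- B) form p.2.1 y *: p.2.2
}.

Lemma dual_system_exists (c : R) : exists B, dual_system c B.
Proof.
have [r rP] := hv_fin Y c.
have /choice[d dP] : forall t, exists d, root t ->
    dual_bases form (wsp t) (wsp (- t)) d.
  move=> t; have [rt|nt] := pselect (root t); last by exists [::].
  have [b bP] := rg_fin X rt; have [Ht _ _] := rt.
  have ndt x : wsp t x -> (forall y, wsp (- t) y -> form x y = 0) -> x = 0.
    exact: (wsp_nd X Ht).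
  have ndNt y : wsp (- t) y -> (forall x, wsp t x -> form x y = 0) -> y = 0.
    move=> ty yx; apply: (wsp_nd X _ ty) => [|x]; first exact: (rg_HRN X).
    by rewrite opprK (rg_sym X); exact: yx.
  have [d dd] := dual_bases_exist (wsp_subspace _ _ t) (wsp_subspace _ _ (- t)) bP ndt ndNt.
  by exists d.
pose rs := [seq t <- undup r | `[< root t >] && (0 < ip t h)].
have rsP t : t \in rs -> root t /\ 0 < ip t h.
  by rewrite mem_filter => /andP[/andP[/asboolP ? ?] _].
have mem_rs t : root t -> 0 < ip t h -> ip t h < c -> t \in rs.
  move=> rt t0 tc; rewrite mem_filter asboolT// t0 mem_undup.
  by apply: rP => //; rewrite gtr0_norm.
have urs : uniq rs by rewrite filter_uniq ?undup_uniq.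
have dmem t p : t \in rs -> p \in d t -> wsp t p.1 /\ wsp (- t) p.2.
  by move=> /rsP[/dP[_ + _ _ _] _]; exact.
exists [seq (t, p) | t <- rs, p <- d t]; split.
- move=> p /allpairsPdep[t [q [trs qd ->]]] /=.
  by have [? ?] := rsP _ trs; have [? ?] := dmem _ _ trs qd.
- move=> t x Ht t0 tc tx; rewrite big_allpairs_dep /=.
  have [x0|/eqP x0] := eqVneq x 0.
    rewrite {1}x0 big1// => s _; rewrite big1// => p _.
    by rewrite x0 bil0l scale0r.
  have rt : root t by apply: (wsp_ht (h := h) Ht _ tx x0); rewrite gt_eqF.
  have [_ _ _ dpos _] := dP _ rt.
  rewrite (bigD1_seq t) ?mem_rs//= -dpos//.
  rewrite big_seq_cond big1 ?addr0// => s /andP[srs st].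
  rewrite big_seq big1// => p pd; have [_ sp] := dmem _ _ srs pd.
  rewrite (wsp_orthR X _ _ _ tx sp) ?scale0r//.
    by apply: (rg_HRN X); case: (rsP _ srs) => -[].
  by rewrite subr_eq0 eq_sym.
- move=> t y Ht t0 tc ty; rewrite big_allpairs_dep /=.
  have [y0|/eqP y0] := eqVneq y 0.
    rewrite {1}y0 big1// => s _; rewrite big1// => p _.
    by rewrite y0 bil0r scale0r.
  have HNt : HR (- t) by apply: (rg_HRN X).
  have rt : root t.
    rewrite -(opprK t); apply: (root_opp X).
    by apply: (wsp_ht (h := h) HNt _ ty y0); rewrite ipNl oppr_eq0 gt_eqF.
  have [_ _ _ _ dneg] := dP _ rt.
  rewrite (bigD1_seq t) ?mem_rs//= -dneg//.
  rewrite big_seq_cond big1 ?addr0// => s /andP[srs st].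
  rewrite big_seq big1// => p pd; have [sp _] := dmem _ _ srs pd.
  rewrite (wsp_orthR X _ _ _ sp ty) ?scale0r//.
    by case: (rsP _ srs) => -[].
  by rewrite subr_eq0.
Qed.

Section DualSystem.
Context (c : R) (B : seq (g * (g * g))) (dB : dual_system c B).

Lemma ds_pos_cond (P : pred (g * (g * g))) t x : HR t -> 0 < ip t h ->
    ip t h < c -> wsp t x -> (forall p, p \in B -> p.1 = t -> P p) ->
  x = \sum_(p <- B | P p) form x p.2.2 *: p.2.1.
Proof.
move=> Ht t0 tc tx tP; rewrite {1}(ds_pos dB Ht t0 tc tx) (bigID P) /=.
rewrite [X in _ + X]big_seq_cond [X in _ + X]big1 ?addr0// => p /andP[pB nP].
have [[Hp _ _] _ _ sp] := ds_mem dB pB.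
rewrite (wsp_orthR X _ _ _ tx sp) ?scale0r//; first exact: (rg_HRN X).
by rewrite subr_eq0; apply: contra nP => /eqP tp; exact: tP.
Qed.

Lemma ds_neg_cond (P : pred (g * (g * g))) t y : HR t -> 0 < ip t h ->
    ip t h < c -> wsp (- t) y -> (forall p, p \in B -> p.1 = t -> P p) ->
  y = \sum_(p <- B | P p) form p.2.1 y *: p.2.2.
Proof.
move=> Ht t0 tc ty tP; rewrite {1}(ds_neg dB Ht t0 tc ty) (bigID P) /=.
rewrite [X in _ + X]big_seq_cond [X in _ + X]big1 ?addr0// => p /andP[pB nP].
have [[Hp _ _] _ sp _] := ds_mem dB pB.
rewrite (wsp_orthR X _ _ _ sp ty) ?scale0r//; first exact: (rg_HRN X).
by rewrite subr_eq0; apply: contra nP => /eqP tp; exact: tP.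
Qed.

Context (eps : R) (eps0 : 0 < eps).
Hypothesis gap : forall t x, HR t -> 0 < ip t h -> wsp t x -> x <> 0 -> eps <= ip t h.

Let ds_gap p : p \in B -> eps <= ip p.1 h.
Proof. by move=> /(ds_mem dB)[[Hp _ [x px x0]] p0 _ _]; exact: gap px x0. Qed.

Section PartialMorphism.
Context (U : lieAlgType R[i]) (psi : {linear g -> U}).

Section Half.
Context (s t x y : g).
Hypotheses (Hs : HR s) (Ht : HR t) (sx : wsp s x) (ty : wsp t y).
Let a := ip s h.
Let b := ip t h.
Hypotheses (ea : eps <= a) (eb : eps <= b) (abc : a + b <= c).
Hypothesis psi_lie : forall s t x y, HR s -> HR t -> wsp s x -> wsp t y ->
  0 < ip s h -> 0 < ip t h -> ip s h + ip t h + eps <= a + b ->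
  psi [Lie x, y] = [Lie psi x, psi y].

Let a0 : 0 < a. Proof. exact: lt_le_trans ea. Qed.
Let b0 : 0 < b. Proof. exact: lt_le_trans eb. Qed.

(** The entries of [B] are sorted by comparing their height with that of [x].
    Below it, [[f, x]] is a positive root vector and [psi] is multiplicative; at
    that height, [[f, x]] is a multiple of [s]; above it, expanding [[f, x]] and
    then [[e', x]] in dual bases moves [x] from one slot to the other. *)
Lemma casimir_half :
  \sum_(p <- B | ip p.1 h < a + b) [Lie psi p.2.1, psi [Lie [Lie p.2.2, x], y]] =
  [Lie psi (\sum_(p <- B | ip p.1 h < a) [Lie p.2.1, [Lie p.2.2, x]]), psi y]
  + \sum_(p <- B | ip p.1 h < a) [Lie psi [Lie p.2.2, x], psi [Lie p.2.1, y]]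
  - form t s *: [Lie psi x, psi y]
  - \sum_(p <- B | ip p.1 h < b) [Lie psi [Lie p.2.1, x], psi [Lie p.2.2, y]].
Proof.
have lea p : ip p.1 h < a -> ip p.1 h < a + b by move=> /lt_trans; apply; rewrite ltrDl.
have cHs : H s by exact: (rg_HRH X).
have zP p : p \in B -> wsp (s - p.1) [Lie p.2.2, x].
  by move=> /(ds_mem dB)[_ _ _ fp]; rewrite addrC; exact: wsp_lie.
have HB p : p \in B -> HR p.1 by move=> /(ds_mem dB)[[]].
have part1 : \sum_(p <- B | ip p.1 h < a)
      [Lie psi p.2.1, psi [Lie [Lie p.2.2, x], y]] =
    [Lie psi (\sum_(p <- B | ip p.1 h < a) [Lie p.2.1, [Lie p.2.2, x]]), psi y]
    + \sum_(p <- B | ip p.1 h < a) [Lie psi [Lie p.2.2, x], psi [Lie p.2.1, y]].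
  rewrite linear_sum lie_suml -big_split /= big_seq_cond [RHS]big_seq_cond.
  apply: eq_bigr => p /andP[pB pa].
  have [_ p0 ep fp] := ds_mem dB pB; have Hp := HB _ pB.
  have [z0|/eqP z0] := eqVneq [Lie p.2.2, x] 0.
    by rewrite z0 !lie0l !lie0r !linear0 !lie0l !lie0r addr0.
  have Hz : HR (s - p.1) by exact: (HRB X).
  have hz : ip (s - p.1) h = a - ip p.1 h by rewrite ipDl ipNl.
  have ez : eps <= a - ip p.1 h.
    by rewrite -hz; apply: gap Hz _ (zP _ pB) z0; rewrite hz subr_gt0.
  have gp := ds_gap pB.
  rewrite (psi_lie Hz Ht (zP _ pB) ty) ?hz ?subr_gt0//; last first.
    by rewrite -/b; move: gp; lra.
  rewrite lie_leibniz (psi_lie Hp Hz ep (zP _ pB)) ?hz ?subr_gt0//; last first.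
    by move: eb; lra.
  by rewrite (psi_lie Hp Ht ep ty)// -/b; move: ez; lra.
(* Entries with [p.1 = s] contribute the expansion of [x]; the others vanish. *)
have part2 : \sum_(p <- B | ip p.1 h == a)
      [Lie psi p.2.1, psi [Lie [Lie p.2.2, x], y]] =
    - (form t s *: [Lie psi x, psi y]).
  rewrite {2}(@ds_pos_cond (fun p => ip p.1 h == a) s x)//; first last.
  - by move=> p _ ->.
  - by rewrite -/a; apply: lt_le_trans abc; rewrite ltrDl.
  rewrite linear_sum lie_suml scaler_sumr -sumrN big_seq_cond [RHS]big_seq_cond.
  apply: eq_bigr => p /andP[pB /eqP pa].
  have [_ p0 ep fp] := ds_mem dB pB; have Hp := HB _ pB.
  have -> : [Lie p.2.2, x] = - (form x p.2.2 *: s).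
    have [ps|ps] := eqVneq p.1 s.
      by rewrite lieC (wsp_lie0 X Hs sx)// -ps.
    have sp : s - p.1 != 0 by rewrite subr_eq0 eq_sym.
    have hz : ip (s - p.1) h = 0 by rewrite ipDl ipNl pa subrr.
    rewrite (wsp_ht0 Y (HRB X Hs Hp) sp hz (zP _ pB)).
    by rewrite (wsp_orthR X Hs (rg_HRN X Hp) sp sx fp) scale0r oppr0.
  rewrite lieNl lieZl (ty cHs) scalerA -scaleNr !linearZ /= lieZr lieZl.
  by rewrite -scaleNr scalerA mulrN mulrC -mulrN.
have part3 : \sum_(p <- B | (a < ip p.1 h) && (ip p.1 h < a + b))
      [Lie psi p.2.1, psi [Lie [Lie p.2.2, x], y]] =
    - \sum_(p <- B | ip p.1 h < b) [Lie psi [Lie p.2.1, x], psi [Lie p.2.2, y]].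
  (* [[f_p, x]] has weight [- (p.1 - s)], a negative weight of height above [- b]. *)
  transitivity (\sum_(p <- B | (a < ip p.1 h) && (ip p.1 h < a + b))
      \sum_(q <- B | ip q.1 h < b)
        form q.2.1 [Lie p.2.2, x] *: [Lie psi p.2.1, psi [Lie q.2.2, y]]).
    rewrite big_seq_cond [RHS]big_seq_cond.
    apply: eq_bigr => p /andP[pB /andP[ap pab]].
    rewrite {1}(@ds_neg_cond (fun q => ip q.1 h < b) (p.1 - s) [Lie p.2.2, x]).
    - rewrite lie_suml linear_sum lie_sumr; apply: eq_bigr => q _.
      by rewrite lieZl linearZ /= lieZr.
    - by apply: (HRB X) => //; exact: HB.
    - by rewrite ipDl ipNl subr_gt0.
    - rewrite ipDl ipNl; move: pab abc a0; rewrite -/a; lra.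
    - by rewrite opprB; exact: zP.
    - by move=> q _ ->; rewrite ipDl ipNl; move: pab; rewrite -/a; lra.
  rewrite exchange_big -sumrN /= big_seq_cond [RHS]big_seq_cond.
  apply: eq_bigr => q /andP[qB qb].
  have [_ q0 eq fq] := ds_mem dB qB; have Hq := HB _ qB.
  rewrite {1}(@ds_pos_cond (fun p : g * (g * g) => (a < ip p.1 h) && (ip p.1 h < a + b))
    (q.1 + s) [Lie q.2.1, x]).
  - rewrite linear_sum lie_suml -sumrN; apply: eq_bigr => p _.
    rewrite linearZ /= lieZl -scaleNr; congr (_ *: _).
    by rewrite (rg_inv X) (form_lie_l X q.2.1 x) opprK (rg_sym X).
  - by apply: (rg_HRD X).
  - by rewrite ipDl; move: a0; rewrite -/a; lra.
  - by rewrite ipDl; move: abc qb; rewrite -/a; lra.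
  - exact: wsp_lie.
  - by move=> p _ ->; rewrite ipDl -/a; move: q0 qb; lra.
rewrite (bigID (fun p => ip p.1 h < a)) /= -!addrA addrA.
rewrite [X in X + _ = _](_ : _ = \sum_(p <- B | ip p.1 h < a)
      [Lie psi p.2.1, psi [Lie [Lie p.2.2, x], y]]); last first.
  by apply: eq_bigl => p; case: (boolP (_ < a)) => [/lea->//|]; rewrite andbF.
rewrite part1 -!addrA; congr (_ + (_ + _)).
rewrite (bigID (fun p => ip p.1 h == a)) /= -part2 -part3; congr (_ + _).
  apply: eq_bigl => p; case: (eqVneq (ip p.1 h) a) => [->|]; last by rewrite andbF.
  by rewrite ltxx ltrDl b0.
apply: eq_bigl => p; rewrite -andbA andbC -leNgt; congr (_ && _).
by rewrite lt_neqAle eq_sym andbC.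
Qed.

End Half.

(** By the Jacobi identity the left side is the difference of two instances of
    [casimir_half], in which the mixed sums cancel.  The identity is stated for
    a map [psi] that is multiplicative only on pairs whose total height is at
    least [eps] below that of [[x, y]]: this is what a section of [U -> g] satisfies when
    injectivity is known up to that height. *)
Lemma casimir_lie s t x y : HR s -> HR t -> wsp s x -> wsp t y ->
    eps <= ip s h -> eps <= ip t h -> ip s h + ip t h <= c ->
    (forall s' t' x' y', HR s' -> HR t' -> wsp s' x' -> wsp t' y' ->
      0 < ip s' h -> 0 < ip t' h -> ip s' h + ip t' h + eps <= ip s h + ip t h ->
      psi [Lie x', y'] = [Lie psi x', psi y']) ->
  \sum_(p <- B | ip p.1 h < ip s h + ip t h)
     [Lie psi p.2.1, psi [Lie p.2.2, [Lie x, y]]] =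
  [Lie psi (\sum_(p <- B | ip p.1 h < ip s h) [Lie p.2.1, [Lie p.2.2, x]]), psi y]
  + [Lie psi x, psi (\sum_(p <- B | ip p.1 h < ip t h) [Lie p.2.1, [Lie p.2.2, y]])]
  - (2 * ip s t)%:C *: [Lie psi x, psi y].
Proof.
move=> Hs Ht sx ty es et stc psi_lie.
have E1 := casimir_half Hs Ht sx ty es et stc psi_lie.
rewrite addrC in stc; rewrite (addrC (ip s h) (ip t h)) in psi_lie.
have E2 := casimir_half Ht Hs ty sx et es stc psi_lie.
transitivity (\sum_(p <- B | ip p.1 h < ip s h + ip t h)
     [Lie psi p.2.1, psi [Lie [Lie p.2.2, x], y]] -
   \sum_(p <- B | ip p.1 h < ip t h + ip s h)
     [Lie psi p.2.1, psi [Lie [Lie p.2.2, y], x]]).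
  rewrite (addrC (ip t h)) -sumrB; apply: eq_bigr => p _.
  by rewrite -lieBr -linearB /= lie_leibniz (lieC x) .
rewrite {}E1 {}E2 (rg_sym X t s) (rg_real X Hs Ht) (lieC (psi x) (psi (\sum_(p <- B | _) _))).
have -> : (2 * ip s t)%:C *: [Lie psi x, psi y] =
   (ip s t)%:C *: [Lie psi x, psi y] - (ip s t)%:C *: [Lie psi y, psi x].
  by rewrite (lieC (psi y)) scalerN opprK -scalerDl -rmorphD /= -mulr2n mulr_natl.
have -> : \sum_(p <- B | ip p.1 h < ip t h) [Lie psi [Lie p.2.2, y], psi [Lie p.2.1, x]]
   = - \sum_(p <- B | ip p.1 h < ip t h) [Lie psi [Lie p.2.1, x], psi [Lie p.2.2, y]].
  by rewrite -sumrN; apply: eq_bigr => p _; rewrite lieC.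
have -> : \sum_(p <- B | ip p.1 h < ip s h) [Lie psi [Lie p.2.1, y], psi [Lie p.2.2, x]]
   = - \sum_(p <- B | ip p.1 h < ip s h) [Lie psi [Lie p.2.2, x], psi [Lie p.2.1, y]].
  by rewrite -sumrN; apply: eq_bigr => p _; rewrite lieC.
set a1 := [Lie psi (\sum_(p <- B | _) _), psi y].
set a2 := [Lie psi (\sum_(p <- B | _) _), psi x].
set b1 := \sum_(p <- B | _) _; set b2 := \sum_(p <- B | _) _.
set d1 := _ *: [Lie psi x, _]; set d2 := _ *: [Lie psi y, _].
have -> : a1 + b1 - d1 - b2 = (a1 - d1) + (b1 - b2) by rewrite (addrAC a1) addrA.
have -> : a2 - b2 - d2 - - b1 = (a2 - d2) + (b1 - b2).
  by rewrite opprK (addrAC a2) -[LHS]addrA [- b2 + _]addrC.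
by rewrite (opprD (a2 - d2)) addrACA subrr addr0 !opprD !opprK addrACA.
Qed.

End PartialMorphism.

(** Simple vectors of weight [t].  By invariance, they are orthogonal to all
    brackets of negative root vectors of total weight [- t]. *)
Definition simple_space t : set g := [set x | wsp t x /\
  forall s y, root s -> 0 < ip s h -> ip s h < ip t h -> wsp (- s) y ->
    [Lie y, x] = 0].

Definition simple t : Prop :=
  [/\ root t, 0 < ip t h & exists2 x, simple_space t x & x <> 0].

Definition letter t x : Prop := simple t /\ simple_space t x.

(** With an element [rho] such that [2 (rho, t) = (t, t)] for simple [t], this is
    [2 (rho, b) - (b, b)] for the total weight [b].  Reading the first term off
    the list of letters makes sense even if no such [rho] exists. *)
Definition defect (l : seq g) : R :=
  \sum_(t <- l) ip t t - ip (\sum_(t <- l) t) (\sum_(t <- l) t).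

Lemma defect1 t : defect [:: t] = 0.
Proof. by rewrite /defect !big_seq1 subrr. Qed.

Lemma defect_cat l l' : defect (l ++ l') =
  defect l + defect l' - 2 * ip (\sum_(t <- l) t) (\sum_(t <- l') t).
Proof.
rewrite /defect !big_cat /= !ipDl !ipDr (ipC X (\sum_(t <- l') t)); ring.
Qed.

Lemma simple_gap t : simple t -> eps <= ip t h.
Proof. by case=> -[Ht _ [x tx x0]] t0 _; exact: gap tx x0. Qed.

Lemma mon_letter_wsp l x : mon letter l x ->
  [/\ HR (\sum_(t <- l) t), eps <= ip (\sum_(t <- l) t) h
    & wsp (\sum_(t <- l) t) x].
Proof.
elim=> [t y [st [ty _]]|l1 l2 y z _ [H1 e1 w1] _ [H2 e2 w2]].
  by rewrite big_seq1; split=> //; [case: st => -[]|exact: simple_gap].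
rewrite big_cat; split; first exact: (rg_HRD X).
  by rewrite ipDl; move: eps0 e1 e2; lra.
exact: wsp_lie.
Qed.

(** [defect_cat] is the recursion that [casimir_lie] imposes on eigenvalues, and
    simple vectors have eigenvalue 0. *)
Lemma casimir_mon l x : mon letter l x -> ip (\sum_(t <- l) t) h <= c ->
  \sum_(p <- B | ip p.1 h < ip (\sum_(t <- l) t) h) [Lie p.2.1, [Lie p.2.2, x]]
  = (defect l)%:C *: x.
Proof.
elim=> [t y [st [ty tE]]|l1 l2 y z l1y IHy l2z IHz] lc.
  rewrite big_seq1 defect1 scale0r big_seq_cond big1// => p /andP[pB pt].
  have [rp p0 ep fp] := ds_mem dB pB.
  by rewrite (tE p.1)// lie0r.
have [H1 e1 w1] := mon_letter_wsp l1y; have [H2 e2 w2] := mon_letter_wsp l2z.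
move: lc; rewrite big_cat ipDl => lc.
have := @casimir_lie g idfun _ _ _ _ H1 H2 w1 w2 e1 e2 lc.
rewrite /= => ->//; rewrite IHy ?IHz; first last.
- by move: eps0 e1 lc; lra.
- by move: eps0 e2 lc; lra.
by rewrite lieZl lieZr -!scalerDl -scalerBl -!rmorphD -rmorphB /= defect_cat.
Qed.

End DualSystem.
End Casimir.

(** * Real roots and simple vectors *)

Section SimpleRoots.
Context (R : realType) (g : lieAlgType R[i]) (form : {biscalar g}) (H HR : set g).
Local Notation "a %:C" := (real_complex R a).
Local Notation ip := (ip form).
Local Notation wsp := (wsp form H).
Local Notation root := (root form H HR).
Local Notation simple_space := (simple_space form H HR).
Local Notation simple := (simple form H HR).
Local Notation letter := (letter form H HR).
Local Notation defect := (defect form).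
Hypothesis X : root_graded form H HR.
Implicit Types (s t h k x y z : g).

Section RealRoots.
Context (t : g) (rt : root t) (t0 : 0 < ip t t).

Let Ht : HR t. Proof. by case: rt. Qed.

(** The norm of [s + n t] grows quadratically in [n], whereas the norms of roots
    are bounded above. *)
Lemma real_root_nilpotent e s v : wsp t e -> HR s -> wsp s v ->
  exists n, iter n (lie e) v = 0.
Proof.
move=> te Hs sv.
have [M MP] := rg_bound X.
have wn n : wsp (s + t *+ n) (iter n (lie e) v).
  elim: n => [|n IH]; first by rewrite addr0.
  by rewrite iterS mulrS addrCA; exact: wsp_lie.
have Hn n : HR (s + t *+ n).
  elim: n => [|n IH]; first by rewrite addr0.
  by rewrite mulrS addrCA; exact: (rg_HRD X).
have nn n : ip (s + t *+ n) (s + t *+ n) =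
    ip s s + 2 * n%:R * ip s t + n%:R ^+ 2 * ip t t.
  have ipn z : ip (t *+ n) z = n%:R * ip t z.
    elim: n => [|n IH]; first by rewrite ip0l mul0r.
    by rewrite mulrS ipDl IH -natr1; ring.
  by rewrite !ipDl !ipDr !ipn !(ipC X _ (t *+ n)) !ipn (ipC X t s); ring.
(* With [n >= 1] and [n * ip t t > K], the quadratic polynomial in [n] that gives
   the norm exceeds [M]. *)
pose K := `|M| + `|ip s s| + 2 * `|ip s t|.
pose n := (Num.bound (K / ip t t)).+1.
have n1 : 1 <= n%:R :> R by rewrite ler1n.
have nK : K < n%:R * ip t t.
  rewrite -ltr_pdivrMr//; apply: le_lt_trans (ler_norm _) _.
  apply: lt_le_trans (archi_boundP (normr_ge0 _)) _.
  by rewrite /n /Num.bound normr_id ler_nat.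
have big : `|M| < ip (s + t *+ n) (s + t *+ n).
  rewrite nn; move: nK; rewrite /K.
  have := ler_norm (- ip s s); have := ler_norm (- ip s t).
  have := normr_ge0 M; have := normr_ge0 (ip s s); have := normr_ge0 (ip s t).
  rewrite !normrN; set a := `|_|; set b := `|_|; set m := `|_|; set u := ip s s.
  move: n1; set q := n%:R; set w := ip s t; set z := ip t t => q1 a0 b0 m0 wa ub.
  move=> K1.
  have h1 : q * (m + b + 2 * a) <= q * (q * z).
    by apply: ler_wpM2l; [lra|exact: ltW].
  have h2 : 0 <= (q - 1) * m by apply: mulr_ge0; lra.
  have h3 : 0 <= (q - 1) * b by apply: mulr_ge0; lra.
  have h4 : 0 <= q * (w + a) by apply: mulr_ge0; lra.
  have h5 : m + b + 2 * q * a < q ^+ 2 * z.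
    have : (q - 1) * (m + b) + (m + b + 2 * q * a) < q * (q * z).
      by nra.
    by nra.
  by nra.
exists n; apply: contrapT => nz.
have sn0 : s + t *+ n != 0.
  by apply/eqP => e0; move: big; rewrite e0 ip0l ltNge normr_ge0.
have := MP _ (wsp_root (Hn n) sn0 (wn n) nz).
by apply/negP; rewrite -ltNge; apply: le_lt_trans big; exact: ler_norm.
Qed.

(** [e], a multiple of [f] and [2 t / (t, t)] form an sl2-triple, which acts on [v]
    with weight [2 (s, t) / (t, t)]. *)
Lemma real_root_lowest e f s v : wsp t e -> wsp (- t) f -> form e f <> 0 ->
    HR s -> wsp s v -> v <> 0 -> [Lie f, v] = 0 ->
  exists m : nat, 2 * ip s t / ip t t = - m%:R /\ iter m.+1 (lie e) v = 0.
Proof.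
move=> te tf /eqP ef Hs sv v0 fv.
have ttC : (ip t t)%:C != 0 by rewrite fmorph_eq0 gt_eqF.
pose a := 2 / ((ip t t)%:C * form e f).
have Ha : H t by exact: (rg_HRH X).
have eaf : [Lie e, a *: f] = (2 / (ip t t)%:C) *: t.
  rewrite lieZr (wsp_lie0 X Ht te tf) scalerA; congr (_ *: _).
  by rewrite /a; field; rewrite ttC.
have [n nv] := real_root_nilpotent te Hs sv.
have [||//|m [mE me]] := @sl2_lowest _ g e (a *: f) v (2 * ip s t / ip t t)%:C _ _ _ n v0 nv.
- rewrite eaf lieZl (te t)// scalerA (rg_real X Ht Ht); congr (_ *: _).
  by rewrite divfK.
- rewrite eaf lieZl (sv t)// scalerA (rg_real X Hs Ht); congr (_ *: _).
  by rewrite !rmorphM fmorphV rmorph_nat /=; ring.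
- by rewrite lieZl fv scaler0.
exists m; split=> //; apply: (fmorph_inj (real_complex R)).
by rewrite rmorphN rmorph_nat; exact: mE.
Qed.

Lemma real_root_lowest_le0 e f s v : wsp t e -> wsp (- t) f -> form e f <> 0 ->
  HR s -> wsp s v -> v <> 0 -> [Lie f, v] = 0 -> ip s t <= 0.
Proof.
move=> te tf ef Hs sv v0 fv.
have [m [mE _]] := real_root_lowest te tf ef Hs sv v0 fv.
have : 2 * ip s t = - m%:R * ip t t by rewrite -mE divfK// gt_eqF.
have : 0 <= m%:R * ip t t by rewrite mulr_ge0// ltW.
by rewrite mulNr; lra.
Qed.

End RealRoots.

(** Span of the brackets of positive root vectors of total weight [t].  Scalars are
    absorbed by the factors of a bracket. *)
Inductive bracket_space h t : g -> Prop :=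
| bracket_space0 : bracket_space h t 0
| bracket_spaceD x y of bracket_space h t x & bracket_space h t y : bracket_space h t (x + y)
| bracket_spaceB s1 s2 x y of HR s1 & HR s2 & 0 < ip s1 h & 0 < ip s2 h & s1 + s2 = t &
    wsp s1 x & wsp s2 y : bracket_space h t [Lie x, y].

Lemma bracket_space_wsp h t x : bracket_space h t x -> wsp t x.
Proof.
elim=> [|y z _ ty _ tz|s1 s2 y z _ _ _ _ <-]; [exact: wsp0|exact: wspD|exact: wsp_lie].
Qed.

Lemma bracket_space_subspace h t : subspace (bracket_space h t : set g).
Proof.
split=> [|x y|a x]; [exact: bracket_space0|exact: bracket_spaceD|].
elim=> [|y z _ ty _ tz|s1 s2 y z H1 H2 p1 p2 st sy sz].
- by rewrite scaler0; exact: bracket_space0.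
- by rewrite scalerDr; exact: bracket_spaceD.
- by rewrite -lieZl; apply: bracket_spaceB st _ sz => //; exact: wspZ.
Qed.

Definition decomposable h t := forall x, wsp t x ->
  exists y z, [/\ bracket_space h t y, simple_space h t z & x = y + z].

Definition paired h t := forall x, simple_space h t x -> x <> 0 ->
  exists2 y, simple_space (- h) (- t) y & form x y <> 0.

(** For [y] of weight [- s] and [z] of weight [s - t], the product of [[y, x]] with
    [z] is that of [x] with [[y, z]], up to sign; so [[y, x]] is orthogonal to
    everything. *)
Lemma simple_space_of_orth h t x : HR t -> wsp t x ->
  (forall z, bracket_space (- h) (- t) z -> form x z = 0) -> simple_space h t x.
Proof.
move=> Ht tx xz; split=> // s y [Hs _ _] s0 st sy.
have Hts : HR (t - s) by exact: (HRB X).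
apply: (wsp_nd X Hts) => [|z]; first by rewrite addrC; exact: wsp_lie.
rewrite opprB => tz; rewrite (form_lie_l X) xz ?oppr0//.
apply: (@bracket_spaceB _ _ (- s) (s - t)) => //.
- exact: (rg_HRN X).
- exact: (HRB X).
- by rewrite ipNl ipNr opprK.
- by rewrite ipDl ipNl !ipNr opprK addrC subr_gt0.
- by rewrite addKr.
Qed.

Lemma simple_space_orth h t x z : simple_space h t x ->
  bracket_space (- h) (- t) z -> form x z = 0.
Proof.
move=> [tx tE]; elim=> [|u v _ xu _ xv|s1 s2 u v H1 H2 p1 p2 st su sv].
- exact: bil0r.
- by rewrite bilDr xu xv addr0.
- have [->|/eqP u0] := eqVneq u 0; first by rewrite lie0l bil0r.
  rewrite (rg_inv X) lieC bilNl (tE (- s1)) ?bil0l ?oppr0 ?opprK//.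
  + apply: (root_opp X); apply: (@wsp_ht _ _ _ _ _ (- h)) su u0 => //.
    by rewrite gt_eqF.
  + by rewrite ipNl -ipNr.
  + have e : - t = s1 + s2 by [].
    move: p2; rewrite -(opprK t) e opprD ipDl !ipNl !ipNr; lra.
Qed.

Section Step.
Context (h : g) (Y : height_vector form H HR h).

(** If neither bracket space contains a nonzero simple vector then they are
    dual to each other, and subtracting the projection to the first one leaves a
    simple vector. *)
Lemma decomposable_of_disjoint t : root t ->
    (forall x, bracket_space h t x -> simple_space h t x -> x = 0) ->
    (forall x, bracket_space (- h) (- t) x -> simple_space (- h) (- t) x -> x = 0) ->
  decomposable h t.
Proof.
move=> rt Dt DNt x tx; have [Ht _ _] := rt.
have [b bP] := rg_fin X rt.
have ndt y : bracket_space h t y ->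
    (forall z, bracket_space (- h) (- t) z -> form y z = 0) -> y = 0.
  move=> ty yz; apply: Dt => //; apply: simple_space_of_orth => //.
  exact: bracket_space_wsp ty.
have ndNt z : bracket_space (- h) (- t) z ->
    (forall y, bracket_space h t y -> form y z = 0) -> z = 0.
  move=> tz yz; apply: DNt => //; apply: simple_space_of_orth; first exact: (rg_HRN X).
    exact: bracket_space_wsp tz.
  by rewrite !opprK => y ty; rewrite (rg_sym X); exact: yz.
have gb : (bracket_space h t : set g) `<=` lspan b.
  by move=> y /bracket_space_wsp /bP.
have [r [_ rAB _ _ rB]] :=
  dual_bases_exist (bracket_space_subspace h t)
    (bracket_space_subspace (- h) (- t)) gb ndt ndNt.
pose y := \sum_(p <- r) form x p.2 *: p.1.
have gy : bracket_space h t y.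
  rewrite /y big_seq; elim/big_ind: _ => [|u v|p /rAB[pA _]].
  - exact: bracket_space0.
  - exact: bracket_spaceD.
  - by case: (bracket_space_subspace h t) => _ _; exact.
exists y, (x - y); split=> //; last by rewrite addrC subrK.
apply: simple_space_of_orth => // [|z tz].
  by apply: (subspaceB (wsp_subspace _ _ t)) => //; exact: bracket_space_wsp gy.
rewrite bilBl (rB _ tz) bil_sumr /y bil_suml; apply/eqP; rewrite subr_eq0; apply/eqP.
transitivity (\sum_(p <- r) \sum_(q <- r) form x p.2 * (form q.1 z * form p.1 q.2)).
  rewrite big_seq [RHS]big_seq; apply: eq_bigr => p pr.
  rewrite bilZr mulrC -mulr_sumr; congr (_ * _).
  rewrite {1}(rB _ tz) bil_sumr; apply: eq_bigr => q _.
  by rewrite bilZr.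
apply: eq_bigr => p _; rewrite bilZl bil_sumr mulr_sumr; apply: eq_bigr => q _.
by rewrite bilZr.
Qed.

Lemma paired_of_decomposable t : root t -> decomposable (- h) (- t) -> paired h t.
Proof.
move=> [Ht _ _] dt x tx x0; apply: contrapT => n; apply: x0.
apply: (wsp_nd X Ht) => [|y ty]; first by case: tx.
have [u [v [tu tv ->]]] := dt _ ty; rewrite bilDr (simple_space_orth tx tu) add0r.
by apply: contrapT => xv; apply: n; exists v.
Qed.

(** Whichever of the two roots is higher, the definition of simple vectors for
    that root applies; roots of equal height differ by a weight of height 0, which
    is not a root. *)
Lemma simple_commute s t x y : HR s -> HR t -> 0 < ip s h -> 0 < ip t h ->
  s <> t -> simple_space h s x -> simple_space (- h) (- t) y -> [Lie x, y] = 0.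
Proof.
move=> Hs Ht s0 t0 st [sx sE] [ty tE].
have [->|/eqP x0] := eqVneq x 0; first by rewrite lie0l.
have [->|/eqP y0] := eqVneq y 0; first by rewrite lie0r.
have rs : root s by apply: (@wsp_ht _ _ _ _ _ h) sx x0 => //; rewrite gt_eqF.
have rt : root t.
  rewrite -(opprK t); apply: (root_opp X).
  apply: (@wsp_ht _ _ _ _ _ h) ty y0; first exact: (rg_HRN X).
  by rewrite ipNl oppr_eq0 gt_eqF.
case: (ltgtP (ip s h) (ip t h)) => [hst|hts|hst].
- by apply: (tE (- s)); rewrite ?opprK ?ipNl ?ipNr ?opprK//; exact: (root_opp X).
- by rewrite lieC (sE t)// oppr0.
- apply: (wsp_ht0 Y _ _ _ (wsp_lie sx ty)); first exact: (HRB X).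
    by apply/eqP => /eqP; rewrite subr_eq0 => /eqP.
  by rewrite ipDl ipNl hst subrr.
Qed.

(** A simple vector of weight [- s] is killed by raising along the real root
    [t], so that it has nonnegative weight for the corresponding sl2. *)
Lemma simple_real_neg s t : simple h s -> simple h t -> s <> t ->
  paired h s -> paired h t -> 0 < ip t t -> ip s t <= 0.
Proof.
move=> [[Hs _ _] s0 [x sx x0]] [rt t0 [y ty y0]] st ps pt tt0.
have [Ht _ _] := rt.
have [x' sx' xx'] := ps _ sx x0.
have [y' ty' yy'] := pt _ ty y0.
have x'0 : x' <> 0 by move=> e; apply: xx'; rewrite e bil0r.
have HNs := rg_HRN X Hs.
rewrite -[leLHS]opprK -ipNl -ipNr.
apply: (@real_root_lowest_le0 (- t) _ _ y' y (- s) x') => //.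
- exact: (root_opp X).
- by rewrite ipNl ipNr opprK.
- by case: ty'.
- by rewrite opprK; case: ty.
- by rewrite (rg_sym X).
- by case: sx'.
- by apply: simple_commute ty sx' => // /esym.
Qed.

Lemma imag_le0 s t : simple h s -> simple h t -> ip s s <= 0 -> ip t t <= 0 ->
  ip s t <= 0 /\ (ip s t = 0 -> forall x y, wsp s x -> wsp t y -> [Lie x, y] = 0).
Proof.
by move=> [rs s0 _] [rt t0 _] ss tt; apply: (hv_imag Y) => //; exact: mulr_gt0.
Qed.

(** As a sum over the letters, the terms are bounded below one at a time in
    [defect0_orth]. *)
Lemma defect_sum (l : seq g) :
  defect l = \sum_(t <- l) (ip t t - ip (\sum_(s <- l) s) t).
Proof.
rewrite /defect sumrB; congr (_ - _).
by rewrite ip_suml; apply: eq_bigr => t _; rewrite (ipC X).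
Qed.

(** The defect is minus the sum of [ip s t] over pairs of distinct positions. *)
Lemma defect_le0_pairs (l : seq g) :
    (forall s t, s \in l -> t \in l -> ip s t <= 0) ->
  0 <= defect l /\ (defect l = 0 -> pairwise (fun s t => ip s t == 0) l).
Proof.
elim: l => [|s l IH] lP; first by rewrite /defect !big_nil ip0l subrr.
have [|d0 dP] := IH _.
  by move=> u v ul vl; apply: lP; rewrite inE ?ul ?vl orbT.
have sl t : t \in l -> ip s t <= 0 by move=> tl; apply: lP; rewrite inE ?eqxx ?tl ?orbT.
have e : ip (\sum_(t <- [:: s]) t) (\sum_(t <- l) t) = \sum_(t <- l) ip s t.
  by rewrite big_seq1 (ipC X) ip_suml; apply: eq_bigr => t _; rewrite (ipC X).
have le : \sum_(t <- l) ip s t <= 0 by rewrite big_seq sumr_le0.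
rewrite -cat1s (defect_cat X) defect1 add0r e; split; first by lra.
move=> d; have s0 : \sum_(t <- l) ip s t = 0 by lra.
have {}d : defect l = 0 by lra.
rewrite /= (dP d) andbT; move/eqP: s0; rewrite -oppr_eq0 -sumrN big_seq psumr_eq0.
  move=> /allP al; apply/allP => t tl; have := al _ tl.
  by rewrite tl oppr_eq0.
by move=> t tl; rewrite oppr_ge0; exact: sl.
Qed.

(** For a letter [t] of positive norm, its term in [defect_sum] is positive; for
    one of nonpositive norm, it is minus the sum of the products of [t] with the
    other letters.  So all terms are nonnegative, letters of positive norm are
    excluded, and then all products of distinct letters vanish. *)
Lemma defect0_orth (l : seq g) : (forall t, t \in l -> simple h t) ->
    (forall t, t \in l -> paired h t) ->
    (forall t, t \in l -> 0 < ip t t -> ip (\sum_(s <- l) s) t <= 0) ->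
    defect l = 0 ->
  pairwise (fun s t => [&& ip s s <= 0, ip t t <= 0 & ip s t == 0]) l.
Proof.
move=> ls lp lr dl.
have img t : t \in l -> ip t t <= 0.
  move=> tl; rewrite leNgt; apply/negP => t0.
  have pos s : s \in l -> 0 <= ip s s - ip (\sum_(t <- l) t) s.
    move=> sl; have [s0|s0] := ltP 0 (ip s s); first by have := lr _ sl s0; lra.
    rewrite (perm_big _ (perm_to_rem sl)) big_cons ipDl opprD addrA subrr add0r.
    rewrite ip_suml oppr_ge0 big_seq sumr_le0// => u /mem_rem ul.
    have [u0|u0] := ltP 0 (ip u u).
      rewrite (ipC X); apply: simple_real_neg => //; [exact: ls|exact: ls| |exact: lp|exact: lp].
      by move=> su; move: u0; rewrite -su; lra.
    by case: (imag_le0 (ls _ ul) (ls _ sl)).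
  move/eqP: dl; rewrite defect_sum big_seq psumr_eq0//.
  move=> /allP /(_ _ tl); rewrite tl /= => /eqP.
  by have := lr _ tl t0; lra.
have [|_ /(_ dl) /(pairwiseP 0) pw] := @defect_le0_pairs l _.
  by move=> s t sl tl; case: (imag_le0 (ls _ sl) (ls _ tl)) => //; exact: img.
apply/(pairwiseP 0) => i j il jl ij.
by rewrite !img ?mem_nth//=; exact: pw.
Qed.

End Step.
End SimpleRoots.

(** * Simple vectors generate *)

Section Decomposition.
Context (R : realType) (g : lieAlgType R[i]) (form : {biscalar g}) (H HR : set g).
Local Notation "a %:C" := (real_complex R a).
Local Notation ip := (ip form).
Local Notation wsp := (wsp form H).
Local Notation root := (root form H HR).
Local Notation simple_space := (simple_space form H HR).
Local Notation simple := (simple form H HR).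
Local Notation letter := (letter form H HR).
Local Notation defect := (defect form).
Local Notation bracket_space := (bracket_space form H HR).
Local Notation decomposable := (decomposable form H HR).
Local Notation paired := (paired form H HR).
Hypothesis X : root_graded form H HR.
Context (eps : R) (eps0 : 0 < eps).
Implicit Types (s t h k x y z : g).

Definition gap_of h := forall t x, HR t -> 0 < ip t h -> wsp t x -> x <> 0 ->
  eps <= ip t h.

Lemma gap_ofN h : gap_of h -> gap_of (- h).
Proof.
move=> hP t x Ht t0 tx x0.
have rt : root t by apply: (@wsp_ht _ _ _ _ _ (- h)) tx x0 => //; rewrite gt_eqF.
have [HNt _ [y ty y0]] := root_opp X rt.
rewrite ipNr -ipNl; apply: hP ty y0 => //.
by rewrite ipNl -ipNr.
Qed.

Definition spanned h t := forall x, wsp t x ->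
  msum (letter h) (fun l => \sum_(s <- l) s = t) x.

Section Step.
Context (h : g) (Y : height_vector form H HR h) (gap : gap_of h).

Lemma simple_sum_gap (l : seq g) t : (forall s, s \in l -> simple h s) ->
  (1 < size l)%N -> t \in l -> ip t h + eps <= ip (\sum_(s <- l) s) h.
Proof.
move=> ls l1 tl; rewrite (perm_big _ (perm_to_rem tl)) big_cons ipDl lerD2l.
have := size_rem tl; case: (rem t l) (fun u => @mem_rem _ t l u) l1 => [|u r] ur.
  by case: (l) => [|? [|]].
move=> _ _; rewrite big_cons ipDl.
have ge : eps <= ip u h by apply: (simple_gap gap); apply: ls; apply: ur; exact: mem_head.
rewrite -[eps]addr0 lerD// ip_suml big_seq; apply: sumr_ge0 => v vr.
by have [] := ls v (ur _ _); rewrite ?inE ?vr ?orbT// => _ /ltW.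
Qed.

Lemma mon_letter_simple l x : mon (letter h) l x -> forall t, t \in l -> simple h t.
Proof.
move=> lx; have : all (fun t => `[< simple h t >]) l.
  by apply: mon_all lx => t y [st _]; exact/asboolP.
by move=> /allP lP t /lP /asboolP.
Qed.

(** The factors of a bracket have heights at least [eps] below that of [t], so
    that they are sums of monomials by induction. *)
Lemma bracket_space_spanned t x :
    (forall s, HR s -> 0 < ip s h -> ip s h + eps <= ip t h -> spanned h s) ->
  bracket_space h t x ->
  msum (letter h) (fun l => \sum_(s <- l) s = t /\ (1 < size l)%N) x.
Proof.
move=> IH; elim=> [|y z _ ty _ tz|s1 s2 y z H1 H2 p1 p2 st sy sz].
- exact: msum0.
- exact: msumD.
have [->|/eqP y0] := eqVneq y 0; first by rewrite lie0l; exact: msum0.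
have [->|/eqP z0] := eqVneq z 0; first by rewrite lie0r; exact: msum0.
have e1 := gap H1 p1 sy y0; have e2 := gap H2 p2 sz z0.
have nz l s : \sum_(u <- l) u = s -> 0 < ip s h -> (0 < size l)%N.
  by case: l => // <-; rewrite big_nil ip0l ltxx.
apply: (@msum_lie _ _ _ _ _ (fun l => \sum_(u <- l) u = s1) (fun l => \sum_(u <- l) u = s2)).
- move=> l l' l1 l2; rewrite big_cat /= l1 l2; split=> //.
  by rewrite size_cat; exact: leq_add (nz _ _ l1 p1) (nz _ _ l2 p2).
- by apply: (IH s1) => //; rewrite -st ipDl; lra.
- by apply: (IH s2) => //; rewrite -st ipDl; lra.
Qed.

Lemma letters_commute s t x y :
  [&& ip s s <= 0, ip t t <= 0 & ip s t == 0] -> letter h s x -> letter h t y ->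
  [Lie x, y] = 0.
Proof.
move=> /and3P[ss tt /eqP st] [ls [sx _]] [lt [ty _]].
by have [_ ] := imag_le0 Y ls lt ss tt; apply.
Qed.

(** A simple [x] is killed by the Casimir operator, so its expansion in monomials
    may be restricted to those of defect 0.  It is killed by lowering along any
    simple root occurring in them, which by sl2 theory makes its weight have
    nonpositive product with those of positive norm; the monomials vanish. *)
Lemma bracket_simple_disjoint t x : HR t ->
    (forall s, HR s -> 0 < ip s h -> ip s h + eps <= ip t h -> spanned h s) ->
    (forall s, simple h s -> ip s h + eps <= ip t h -> paired h s) ->
  bracket_space h t x -> simple_space h t x -> x = 0.
Proof.
move=> Ht IH IHp tx [tx' tE]; apply: contrapT => x0.
have [r [xE rP]] := msum_list (bracket_space_spanned IH tx).
have [B dB] := dual_system_exists X Y (ip t h).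
pose S z := \sum_(p <- B | ip p.1 h < ip t h) [Lie p.2.1, [Lie p.2.2, z]].
have linS : linear S.
  move=> a y z; rewrite /S scaler_sumr -big_split /=; apply: eq_bigr => p _.
  by rewrite !lieDr !lieZr.
pose SL := GRing.isLinear.Build R[i] g g *:%R S linS.
pose T : {linear g -> g} := HB.pack S SL.
apply: (x0); apply: (@eigen_expansion_eq0 _ _ T x _ r
  (fun p => (defect p.1)%:C) (fun p => p.2)) => //.
- rewrite /T /= /S big_seq_cond big1// => p /andP[pB pt].
  by have [rp p0 ep fp] := ds_mem dB pB; rewrite (tE p.1)// lie0r.
- move=> p /rP[pm [pt _]].
  have := casimir_mon X Y dB eps0 gap pm; rewrite pt => <-//.
move=> p pr /eqP; rewrite fmorph_eq0 => /eqP dp.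
have [pm [pt psz]] := rP p pr; have ls := mon_letter_simple pm.
have lt u : u \in p.1 -> ip u h + eps <= ip t h.
  by move=> up; rewrite -pt; exact: simple_sum_gap.
have lp u : u \in p.1 -> paired h u by move=> up; apply: IHp; [exact: ls|exact: lt].
apply: (mon_commute letters_commute pm _ psz).
apply: (defect0_orth X Y ls lp _ dp) => u up u0; rewrite pt.
have [ru uh [v uv v0]] := ls _ up; have [w uw vw] := lp _ up _ uv v0.
apply: (real_root_lowest_le0 X ru u0 (e := v) (f := w) _ _ vw Ht tx' x0).
- by case: uv.
- by case: uw.
- by apply: (tE u) => //; [by have := lt _ up; move: eps0; lra|case: uw].
Qed.

End Step.

Section Induction.
Context (h : g) (Y : height_vector form H HR h) (gap : gap_of h).

Lemma decomposable_spanned (c : R) :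
    (forall s, root s -> 0 < ip s h -> ip s h <= c -> decomposable h s) ->
  forall t, HR t -> 0 < ip t h -> ip t h <= c -> spanned h t.
Proof.
move=> dec.
suff sp b t : HR t -> 0 < ip t h -> ip t h <= c -> ip t h = b -> spanned h t.
  by move=> t Ht t0 tc; exact: sp tc erefl.
move: b t; apply: (height_ind eps0) => b IH t Ht t0 tc tb x tx.
have [->|/eqP x0] := eqVneq x 0; first exact: msum0.
have rt : root t by apply: (@wsp_ht _ _ _ _ _ h) tx x0 => //; rewrite gt_eqF.
have [y [z [ty tz ->]]] := dec _ rt t0 tc _ tx.
apply: msumD; last first.
  have [->|/eqP z0] := eqVneq z 0; first exact: msum0.
  apply: (@mon_msum _ _ _ _ _ [:: t]); last by rewrite big_seq1.
  by apply: mon1; split=> //; split=> //; exists z.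
apply: (@msum_sub _ _ _ _ (fun l => \sum_(s <- l) s = t /\ (1 < size l)%N)).
  by move=> l [].
apply: (bracket_space_spanned gap) ty => s Hs s0 st.
by apply: (IH (ip s h)) => //; move: eps0 s0 tb tc st; lra.
Qed.

End Induction.

Lemma spanned_paired_below h t : gap_of h ->
    (forall s, root s -> 0 < ip s h -> ip s h + eps <= ip t h ->
      decomposable h s /\ decomposable (- h) (- s)) ->
  (forall s, HR s -> 0 < ip s h -> ip s h + eps <= ip t h -> spanned h s) /\
  (forall s, simple h s -> ip s h + eps <= ip t h -> paired h s).
Proof.
move=> gap IH; split=> [s Hs s0 st|s [rs s0 _] st]; last first.
  by apply: (paired_of_decomposable X rs); case: (IH s).
apply: (decomposable_spanned gap (c := ip t h - eps)) => //; last by move: st; lra.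
by move=> u ru u0 ut; apply: (proj1 (IH u ru u0 _)); move: ut; lra.
Qed.

Section Main.
Context (h : g) (Y : height_vector form H HR h) (gap : gap_of h).

(** Positive and negative roots are treated in one induction, as the duality
    between the two bracket spaces is needed at each height. *)
Lemma decomposable_pair t : root t -> 0 < ip t h ->
  decomposable h t /\ decomposable (- h) (- t).
Proof.
suff sp b : forall t, root t -> 0 < ip t h -> ip t h = b ->
    decomposable h t /\ decomposable (- h) (- t).
  by move=> rt t0; exact: sp erefl.
move: b {t}; apply: (height_ind eps0) => b IH t rt t0 tb.
have IHt s : root s -> 0 < ip s h -> ip s h + eps <= ip t h ->
      decomposable h s /\ decomposable (- h) (- s).
  by move=> rs s0 st; apply: (IH (ip s h)) => //; [exact: ltW|rewrite -tb].
have IHNt s : root s -> 0 < ip s (- h) -> ip s (- h) + eps <= ip (- t) (- h) ->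
      decomposable (- h) s /\ decomposable (- - h) (- s).
  move=> rs s0 st; rewrite opprK -{1}(opprK s); apply/and_comm.
  apply: IHt; first exact: (root_opp X).
    by rewrite ipNl -ipNr.
  by move: st; rewrite !ipNl !ipNr opprK.
have YN := height_vectorN X Y; have gapN := gap_ofN gap.
have [sp pr] := spanned_paired_below gap IHt.
have [spN prN] := spanned_paired_below gapN IHNt.
have [Ht _ _] := rt; have HNt := rg_HRN X Ht.
have D := bracket_simple_disjoint Y gap Ht sp pr.
have DN := bracket_simple_disjoint YN gapN HNt spN prN.
split; first exact: (decomposable_of_disjoint X rt D DN).
apply: (decomposable_of_disjoint X (root_opp X rt)) => //.
by rewrite !opprK.
Qed.

Lemma spanned_pos t : HR t -> 0 < ip t h -> spanned h t.
Proof.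
move=> Ht t0; apply: (decomposable_spanned gap (c := ip t h)) => // s rs s0 _.
by case: (decomposable_pair rs s0).
Qed.

Lemma paired_pos t : root t -> 0 < ip t h -> paired h t.
Proof.
by move=> rt t0; apply: (paired_of_decomposable X rt); case: (decomposable_pair rt t0).
Qed.

Lemma bracket_simple0 t x : HR t -> bracket_space h t x -> simple_space h t x -> x = 0.
Proof.
move=> Ht; apply: (bracket_simple_disjoint Y gap Ht) => [s Hs s0 _|s [rs s0 _] _].
  exact: spanned_pos.
exact: paired_pos.
Qed.

End Main.
End Decomposition.

(** * Injectivity on the positive part *)

Lemma sum_by_class (V : zmodType) (I W : eqType) (r : seq I) (w : I -> W) (v : I -> V) :
  (forall t, \sum_(i <- r | w i == t) v i = 0) -> \sum_(i <- r) v i = 0.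
Proof.
have [n] := ubnP (size r); elim: n => // n IH in r *.
case: r => [|i r] sn r0; first by rewrite big_nil.
rewrite (bigID (fun j => w j == w i)) /= r0 add0r -big_filter.
apply: IH => [|t].
  rewrite ltnS in sn; apply: leq_trans sn; rewrite /= eqxx /= ltnS size_filter; exact: count_size.
rewrite big_filter_cond; have [->|ti] := eqVneq t (w i).
  by rewrite big1// => j /andP[/negP].
rewrite -[RHS](r0 t); apply: eq_bigl => j.
by case: eqVneq => //= ->; rewrite eq_sym (negPf ti).
Qed.

Section Injectivity.
Context (R : realType) (g : lieAlgType R[i]) (form : {biscalar g}) (H HR : set g).
Local Notation "a %:C" := (real_complex R a).
Local Notation ip := (ip form).
Local Notation wsp := (wsp form H).
Local Notation root := (root form H HR).
Local Notation simple_space := (simple_space form H HR).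
Local Notation simple := (simple form H HR).
Local Notation letter := (letter form H HR).
Local Notation defect := (defect form).
Local Notation bracket_space := (bracket_space form H HR).
Hypothesis X : root_graded form H HR.
Context (h : g) (Y : height_vector form H HR h).
Context (U : lieAlgType R[i]) (phi : {linear U -> g}) (phi_lie : lie_morphism phi).
Context (L M : g -> {linear g -> U}).
Implicit Types (s t k x y z : g) (u v : U).

Definition lifted_letter t u := simple h t /\ exists2 a, simple_space h t a & u = L t a.

(** The defining relations in terms of linear maps from spaces of simple vectors
    to [U], instead of bases; [M] takes simple vectors of negative weight.  The
    relation [lift_ML] only describes the action of the brackets [[M, L]] on
    the positive part: the elements of [U] over the same element of [H] may
    differ when simple roots have multiplicities. *)
Record lifting : Prop := Lifting {
  lift_L : forall t a, simple h t -> simple_space h t a -> phi (L t a) = a;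
  lift_M : forall t b, simple h t -> simple_space (- h) (- t) b -> phi (M t b) = b;
  lift_ML : forall s t r a b c, simple h s -> simple h t -> simple h r ->
    simple_space (- h) (- s) b -> simple_space h t a -> simple_space h r c ->
    [Lie [Lie M s b, L t a], L r c] = - (form b a * form s r) *: L r c;
  lift_nil : forall t, simple h t -> 0 < ip t t -> exists a b,
    [/\ simple_space h t a, simple_space (- h) (- t) b, form a b <> 0 &
      forall s c, simple h s -> simple_space h s c ->
        exists n, iter n (lie (L t a)) (L s c) = 0];
  lift_comm : forall s t a c, simple h s -> simple h t -> ip s s <= 0 -> ip t t <= 0 ->
    ip s t = 0 -> simple_space h s a -> simple_space h t c -> [Lie L s a, L t c] = 0
}.
Hypothesis lP : lifting.

Lemma simple_space_subspace t : subspace (simple_space h t).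
Proof.
split=> [|x y [tx xE] [ty yE]|a x [tx xE]].
- by split=> [|*]; rewrite ?lie0r//; exact: wsp0.
- by split=> [|s z rs s0 st sz]; [exact: wspD|rewrite lieDr (xE s)// (yE s)// addr0].
- by split=> [|s z rs s0 st sz]; [exact: wspZ|rewrite lieZr (xE s)// scaler0].
Qed.

Lemma lifted_letterZ t a u : lifted_letter t u -> lifted_letter t (a *: u).
Proof.
move=> [st [x tx ->]]; split=> //; exists (a *: x); last by rewrite linearZ.
by case: (simple_space_subspace t) => _ _; exact.
Qed.

Lemma mon_phi l u : mon lifted_letter l u -> mon (letter h) l (phi u).
Proof.
elim=> [t v [st [a ta ->]]|l1 l2 v w _ IH1 _ IH2].
  by apply: mon1; split=> //; rewrite (lift_L lP).
by rewrite phi_lie; exact: monB.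
Qed.

Lemma mon_lift l x : mon (letter h) l x -> exists2 u, mon lifted_letter l u & phi u = x.
Proof.
elim=> [t y [st ty]|l1 l2 y z _ [u lu uy] _ [v lv vz]].
  by exists (L t y); [apply: mon1; split=> //; exists y|exact: (lift_L lP)].
by exists [Lie u, v]; [exact: monB|rewrite phi_lie uy vz].
Qed.

Lemma msum_lift Q x : msum (letter h) Q x ->
  exists2 u, msum lifted_letter Q u & phi u = x.
Proof.
elim=> [|l y z /mon_lift[u lu uy] Ql _ [v lv vz]].
  by exists 0; [exact: msum0|rewrite linear0].
by exists (u + v); [exact: msumA lu Ql lv|rewrite linearD uy vz].
Qed.

Lemma lift_ML_mon s t a b l m : simple h s -> simple h t ->
    simple_space (- h) (- s) b -> simple_space h t a -> mon lifted_letter l m ->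
  [Lie [Lie M s b, L t a], m] = - (form b a * form s (\sum_(r <- l) r)) *: m.
Proof.
move=> ss st sb ta; elim=> [r v [sr [c rc ->]]|l1 l2 v w _ IH1 _ IH2].
  by rewrite big_seq1; exact: lift_ML.
rewrite lie_leibniz IH1 IH2 lieZl lieZr -scalerDl big_cat /= bilDr.
by congr (_ *: _); ring.
Qed.

Lemma lower_left s b l1 l2 (x y : U) : simple h s -> simple_space (- h) (- s) b ->
    mon lifted_letter l1 x -> mon lifted_letter l2 y ->
    ((1 < size l1)%N -> msum lifted_letter
       (fun l => \sum_(r <- l) r = \sum_(r <- l1) r - s) [Lie M s b, x]) ->
  msum lifted_letter
    (fun l => \sum_(r <- l) r = \sum_(r <- l1) r + \sum_(r <- l2) r - s)
    [Lie [Lie M s b, x], y].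
Proof.
move=> ss sb l1x l2y.
have [s1 /(_ isT) IH|s1 _] := ltnP 1 (size l1).
  apply: (@msum_lie _ _ _ _ _ (fun l => \sum_(r <- l) r = \sum_(r <- l1) r - s)
    (fun l => \sum_(r <- l) r = \sum_(r <- l2) r)) => //.
    by move=> l l' e e'; rewrite big_cat /= e e' addrAC.
  exact: mon_msum l2y _.
case: l1x s1 => [t u [st [a ta ->]] _|k k' u u' ku ku']; last first.
  by rewrite size_cat => /(leq_trans (leq_add (mon_size ku) (mon_size ku'))).
rewrite (lift_ML_mon ss st sb ta l2y) big_seq1.
have [ba0|ba0] := eqVneq (form b a) 0.
  by rewrite ba0 mul0r oppr0 scale0r; exact: msum0.
have -> : t = s.
  apply/eqP; rewrite -subr_eq0; apply: contraNT ba0 => ts.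
  have [[[Hs _ _] _ _] [[Ht _ _] _ _]] := (ss, st).
  rewrite (rg_sym X); apply/eqP; apply: (wsp_orthR X Ht (rg_HRN X Hs) ts).
    by case: ta.
  by case: sb.
apply: msum_scale; first by move=> *; exact: lifted_letterZ.
by apply: mon_msum l2y _; rewrite addrC addKr.
Qed.

(** Lowering a factor of a monomial either gives a shorter sum of monomials or,
    if the factor is a letter, an element acting on the other factor by a scalar,
    which is zero unless the letter has weight [s]. *)
Lemma lower_mon s b l m : simple h s -> simple_space (- h) (- s) b ->
    mon lifted_letter l m -> (1 < size l)%N ->
  msum lifted_letter (fun l' => \sum_(r <- l') r = \sum_(r <- l) r - s) [Lie M s b, m].
Proof.
move=> ss sb; elim=> // l1 l2 x y l1x IHx l2y IHy _.
rewrite lie_leibniz big_cat /=; apply: msumD.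
  exact: lower_left IHx.
rewrite lieC -[X in msum _ _ X]scaleN1r; apply: msum_scale; first by move=> *; exact: lifted_letterZ.
by rewrite (addrC (\sum_(r <- l1) r)); exact: lower_left IHy.
Qed.

Lemma nilpotent_msum e Q u :
    (forall t v, lifted_letter t v -> exists n, iter n (lie e) v = 0) ->
  msum lifted_letter Q u -> exists n, iter n (lie e) u = 0.
Proof.
move=> eL.
have monN l v : mon lifted_letter l v -> exists n, iter n (lie e) v = 0.
  elim=> [t w /eL//|l1 l2 w w' _ [n wn] _ [n' wn']].
  by exists (n + n')%N; exact: nilpotent_lie.
elim=> [|l v w /monN[n vn] _ _ [n' wn]]; first by exists 0%N.
exists (n + n')%N; rewrite iter_lieD (iter_lie_le _ vn) ?leq_addr//.
by rewrite (iter_lie_le _ wn) ?leq_addl// addr0.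
Qed.

Lemma mon_bracket_space (eps : R) l x : 0 < eps -> gap_of form H HR eps h ->
  mon (letter h) l x -> (1 < size l)%N -> bracket_space h (\sum_(t <- l) t) x.
Proof.
move=> e0 gap [t y _ //|l1 l2 y z l1y l2z _].
have [H1 e1 w1] := mon_letter_wsp X e0 gap l1y.
have [H2 e2 w2] := mon_letter_wsp X e0 gap l2z.
rewrite big_cat /=; apply: (bracket_spaceB H1 H2) w1 w2 => //; first exact: lt_le_trans e1.
exact: lt_le_trans e2.
Qed.

(** The inverse on the image is extended by a linear projection onto that image,
    which makes brackets of lifts bilinear on all of [g]. *)
Lemma inverse_exists Q :
    (forall u, msum lifted_letter Q u -> phi u = 0 -> u = 0) ->
  exists psi : {linear g -> U}, forall u, msum lifted_letter Q u -> psi (phi u) = u.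
Proof.
move=> inj.
have uZ a u : msum lifted_letter Q u -> msum lifted_letter Q (a *: u).
  by apply: msum_scale => *; exact: lifted_letterZ.
have uB u v : msum lifted_letter Q u -> msum lifted_letter Q v ->
    phi u = phi v -> u = v.
  move=> Qu Qv uv; apply/eqP; rewrite -subr_eq0; apply/eqP; apply: inj.
    by apply: msumD => //; rewrite -scaleN1r; exact: uZ.
  by rewrite linearB uv subrr.
pose A : set g := [set x | exists2 u, msum lifted_letter Q u & phi u = x].
have sA : subspace A.
  split=> [|x y [u Qu <-] [v Qv <-]|a x [u Qu <-]].
  - by exists 0; [exact: msum0|rewrite linear0].
  - by exists (u + v); [exact: msumD|rewrite linearD].
  - by exists (a *: u); [exact: uZ|rewrite linearZ].
have [p [pA pid]] := projection_exists sA.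
have /choice[q qP] : forall x, exists u, msum lifted_letter Q u /\ phi u = p x.
  by move=> x; have [u Qu ux] := pA x; exists u.
have linq : linear q.
  move=> a x y; have [Qx qx] := qP x; have [Qy qy] := qP y.
  have [Qxy qxy] := qP (a *: x + y); apply: uB => //.
    by apply: msumD => //; exact: uZ.
  by rewrite qxy !linearP qx qy.
pose qL := GRing.isLinear.Build R[i] g U *:%R q linq.
pose psi : {linear g -> U} := HB.pack q qL.
exists psi => u Qu; have [Qq qu] := qP (phi u); apply: uB => //.
by rewrite qu pid//; exists u.
Qed.

Section HomogeneousStep.
Context (eps : R) (eps0 : 0 < eps) (gap : gap_of form H HR eps h).
Context (t : g).
Let c := ip t h.
Hypothesis Ht : HR t.
Hypothesis below : forall u,
  msum lifted_letter (fun l => ip (\sum_(s <- l) s) h <= c - eps) u ->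
  phi u = 0 -> u = 0.

Let simple_of l m : mon lifted_letter l m -> forall s, s \in l -> simple h s.
Proof. by move=> /mon_phi /mon_letter_simple. Qed.

Let weight_of l m : mon lifted_letter l m ->
  [/\ HR (\sum_(s <- l) s), eps <= ip (\sum_(s <- l) s) h & wsp (\sum_(s <- l) s) (phi m)].
Proof. by move=> /mon_phi /(mon_letter_wsp X eps0 gap). Qed.

(** This is the identity of [casimir_lie] in which [psi] inverts [phi] on heights
    up to [c - eps], where [phi] is injective by assumption. *)
Lemma lifted_casimir : exists T : {linear g -> U}, forall l m,
  mon lifted_letter l m -> (1 < size l)%N -> \sum_(s <- l) s = t ->
  T (phi m) = (defect l)%:C *: m.
Proof.
have [psi psiK] := inverse_exists below.
have [B dB] := dual_system_exists X Y c.
pose T z := \sum_(p <- B | ip p.1 h < c) [Lie psi p.2.1, psi [Lie p.2.2, z]].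
have linT : linear T.
  move=> a y z; rewrite /T scaler_sumr -big_split /=; apply: eq_bigr => p _.
  by rewrite lieDr lieZr linearP lieDr lieZr.
pose TL := GRing.isLinear.Build R[i] g U *:%R T linT.
pose T' : {linear g -> U} := HB.pack T TL.
exists T' => _ _ [//|l1 l2 x y l1x l2y] _ lt.
have [H1 e1 w1] := weight_of l1x; have [H2 e2 w2] := weight_of l2y.
have ct : ip (\sum_(s <- l1) s) h + ip (\sum_(s <- l2) s) h = c.
  by rewrite -ipDl -big_cat lt.
have psi1 : psi (phi x) = x by apply: psiK; apply: mon_msum l1x _ => /=; move: e2 ct; lra.
have psi2 : psi (phi y) = y by apply: psiK; apply: mon_msum l2y _ => /=; move: e1 ct; lra.
rewrite /T' /= /T phi_lie -ct.
rewrite (casimir_lie X Y dB eps0 gap H1 H2 w1 w2 e1 e2) ?ct//; first last.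
  move=> s1 s2 x' y' Hs1 Hs2 wx wy p1 p2 s12.
  have [u Qu <-] := msum_lift (spanned_pos X eps0 Y gap Hs1 p1 wx).
  have [v Qv <-] := msum_lift (spanned_pos X eps0 Y gap Hs2 p2 wy).
  rewrite -phi_lie !psiK//.
  - by apply: msum_sub Qv => l ->; move: p1 s12; lra.
  - by apply: msum_sub Qu => l ->; move: p2 s12; lra.
  - apply: msum_lie Qu Qv => l l' e e'; rewrite big_cat ipDl /= e e'; move: s12; lra.
rewrite (casimir_mon X Y dB eps0 gap (mon_phi l1x)); last by move: eps0 e2 ct; lra.
rewrite (casimir_mon X Y dB eps0 gap (mon_phi l2y)); last by move: eps0 e1 ct; lra.
rewrite !linearZ /= psi1 psi2 lieZl lieZr -scalerDl scalerN -scalerBl.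
by rewrite -rmorphD -rmorphB /= (defect_cat X).
Qed.

(** Lowering [u] stays in the kernel and decreases the height, hence gives 0; so
    [u] is a lowest weight vector for the sl2 of the simple root [s], on which
    the raising operator is nilpotent by the Serre relations. *)
Lemma kernel_real_simple_le0 u s :
    msum lifted_letter (fun l => \sum_(r <- l) r = t /\ (1 < size l)%N) u ->
    phi u = 0 -> u <> 0 -> simple h s -> 0 < ip s s -> ip t s <= 0.
Proof.
move=> Qu u0 nu ss s0; have [[Hs _ _] sh _] := ss.
have [a [b [sa sb ab nil]]] := lift_nil lP ss s0.
have Mu : [Lie M s b, u] = 0.
  apply: below; last by rewrite phi_lie u0 lie0r.
  elim: Qu {u0 nu} => [|l m v lm [lt l1] _ IH]; first by rewrite lie0r; exact: msum0.
  rewrite lieDr; apply: msumD => //.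
  apply: msum_sub (lower_mon ss sb lm l1) => l' ->.
  by rewrite lt ipDl ipNl lerD2l lerN2; apply: (simple_gap gap ss).
have MLu : [Lie [Lie M s b, L s a], u] = - (form b a * form s t) *: u.
  elim: Qu {u0 nu Mu} => [|l m v lm [lt l1] _ IH]; first by rewrite lie0r scaler0.
  by rewrite lieDr IH scalerDr (lift_ML_mon ss ss sb sa lm) lt.
have ML := lift_ML lP ss ss ss sb sa sa.
have [n un] : exists n, iter n (lie (L s a)) u = 0.
  by apply: nilpotent_msum Qu => r v [sr [d rd ->]]; exact: nil.
have ab' : form b a != 0 by apply/eqP; rewrite (rg_sym X).
have ssC : (ip s s)%:C != 0 by rewrite fmorph_eq0 gt_eqF.
rewrite (rg_real X Hs Hs) in ML; rewrite (rg_real X Hs Ht) in MLu.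
(* The factor that makes [L s a] and [k *: M s b] part of an sl2-triple. *)
pose k := 2 / (form b a * (ip s s)%:C).
have swap (z : U) : [Lie [Lie L s a, k *: M s b], z] = - k *: [Lie [Lie M s b, L s a], z].
  by rewrite lieZr lieZl (lieC (L s a)) lieNl scalerN scaleNr.
have [m [mE _]] : exists m : nat, (2 * ip s t / ip s s)%:C = - m%:R /\
     iter m.+1 (lie (L s a)) u = 0.
  apply: (@sl2_lowest _ U (L s a) (k *: M s b) u _ _ _ _ n nu un).
  - rewrite swap ML scalerA; congr (_ *: _).
    by rewrite /k; field; rewrite ab' ssC.
  - rewrite swap MLu scalerA; congr (_ *: _).
    rewrite /k !rmorphM fmorphV rmorph_nat /=.
    by field; rewrite ab' ssC.
  - by rewrite lieZl Mu scaler0.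
have {mE} : 2 * ip s t / ip s s = - m%:R.
  by apply: (fmorph_inj (real_complex R)); rewrite rmorphN rmorph_nat; exact: mE.
move=> /(congr1 (fun q : R => q * ip s s)); rewrite divfK ?gt_eqF// mulNr (ipC X t).
have : 0 <= m%:R * ip s s by rewrite mulr_ge0// ltW.
lra.
Qed.

(** The composite of the lifted Casimir operator with [phi] kills [u] and acts on
    monomials by their defect; those of defect 0 vanish. *)
Lemma kernel_homogeneous_long u :
    msum lifted_letter (fun l => \sum_(r <- l) r = t /\ (1 < size l)%N) u ->
  phi u = 0 -> u = 0.
Proof.
move=> Qu u0; apply: contrapT => nu.
have [r [uE rP]] := msum_list Qu.
have [T TP] := lifted_casimir.
pose S : {linear U -> U} := T \o phi.
apply: (nu); apply: (@eigen_expansion_eq0 _ _ S u _ r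
  (fun p => (defect p.1)%:C) (fun p => p.2)) => //.
- by rewrite /S /= u0 linear0.
- by move=> p /rP[pm [pt p1]]; rewrite /S /= (TP _ _ pm).
move=> p /rP[pm [pt p1]] /eqP; rewrite fmorph_eq0 => /eqP dp.
have ls := simple_of pm.
have comm s s' (y z : U) : [&& ip s s <= 0, ip s' s' <= 0 & ip s s' == 0] ->
    lifted_letter s y -> lifted_letter s' z -> [Lie y, z] = 0.
  move=> /and3P[ss ss' /eqP o] [sy [a sa ->]] [sz [b sb ->]].
  exact: (lift_comm lP).
apply: (mon_commute comm pm _ p1).
apply: (defect0_orth X Y ls _ _ dp) => s /ls ss.
  by apply: (paired_pos X eps0 Y gap); case: ss.
by move=> s0; rewrite pt; exact: kernel_real_simple_le0 Qu u0 nu ss s0.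
Qed.

(** Letters and longer monomials do not interfere, since a simple vector that is
    a sum of brackets is 0 and letters are determined by their images. *)
Lemma kernel_homogeneous u :
  msum lifted_letter (fun l => \sum_(r <- l) r = t) u -> phi u = 0 -> u = 0.
Proof.
move=> Qu u0.
have [u1 [u2 [uE [a [ta aE pa]] Q2]]] : exists u1 u2, [/\ u = u1 + u2,
    exists a, [/\ simple_space h t a, u1 = L t a & phi u1 = a] &
    msum lifted_letter (fun l => \sum_(r <- l) r = t /\ (1 < size l)%N) u2].
  elim: Qu {u0} => [|l m v lm lt _ [u1 [u2 [-> [a [ta -> pa]] Q2]]]].
    exists 0, 0; split; rewrite ?addr0//; last exact: msum0.
    by exists 0; rewrite !linear0; split=> //; case: (simple_space_subspace t).
  have [l1|l1] := ltnP 1 (size l).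
    exists (L t a), (m + u2); split; first by rewrite addrCA.
      by exists a.
    by apply: msumD => //; apply: mon_msum lm _.
  case: lm lt l1 => [s x [ss [b sb ->]]|k k' y y' ky ky' _]; last first.
    by rewrite size_cat => /(leq_trans (leq_add (mon_size ky) (mon_size ky'))).
  rewrite big_seq1 => st _; rewrite {}st in ss sb *.
  exists (L t (b + a)), u2; split=> //; first by rewrite linearD addrA.
  exists (b + a); split=> //; first by case: (simple_space_subspace t) => _ + _; exact.
  by rewrite !linearD /= pa (lift_L lP).
have g2 : bracket_space h t (phi u2).
  elim: Q2 => [|l m v lm [lt l1] _ IH]; first by rewrite linear0; exact: bracket_space0.
  rewrite linearD; apply: bracket_spaceD => //; rewrite -lt.
  exact: mon_bracket_space eps0 gap (mon_phi lm) l1.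
have e12 : phi u1 = - phi u2.
  by apply/eqP; rewrite -addr_eq0 -linearD /= -uE u0.
have a0 : a = 0.
  apply: (bracket_simple0 X eps0 Y gap Ht) => //; rewrite -pa e12.
  exact: (subspaceN (bracket_space_subspace _ _ _ h t) g2).
rewrite uE aE a0 linear0 add0r; apply: kernel_homogeneous_long => //.
by apply/eqP; rewrite -oppr_eq0 -e12 pa a0.
Qed.

End HomogeneousStep.

(** This is the analogue of the Gabber-Kac theorem.  The induction is on the
    largest height of a monomial, after separating weights by [wsp_indep]. *)
Theorem phi_injective_pos u : msum lifted_letter (fun=> True) u -> phi u = 0 -> u = 0.
Proof.
have [eps eps0 gap] := height_gap Y.
suff key (b : R) v : msum lifted_letter (fun l => ip (\sum_(s <- l) s) h <= b) v ->
    phi v = 0 -> v = 0.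
  move=> Qu; suff [b Qb] : exists b,
      msum lifted_letter (fun l => ip (\sum_(s <- l) s) h <= b) u by exact: key Qb.
  elim: Qu => [|l m v lm _ _ [b Qb]]; first by exists 0; exact: msum0.
  exists (Num.max (ip (\sum_(s <- l) s) h) b); apply: msumA lm _ _.
    by rewrite le_max lexx.
  by apply: msum_sub Qb => l' lb; rewrite le_max lb orbT.
move: b v; apply: (height_ind eps0) => b IH v Qv v0.
have below u' (c : R) : c <= b ->
    msum lifted_letter (fun l => ip (\sum_(s <- l) s) h <= c - eps) u' ->
    phi u' = 0 -> u' = 0.
  move=> cb Qu'; have [c0|c0] := leP 0 (c - eps).
    by apply: (IH (c - eps)) => //; lra.
  case: Qu' => // l m w /mon_phi/(mon_letter_wsp X eps0 gap)[_ el _] lc _.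
  by exfalso; move: el lc; lra.
have [r [vE rP]] := msum_list Qv.
rewrite vE; apply: (@sum_by_class _ _ _ _ (fun p => \sum_(s <- p.1) s)) => t.
rewrite -big_filter.
case E : [seq p <- r | \sum_(s <- p.1) s == t] => [|p0 r']; first by rewrite big_nil.
have pP p : p \in p0 :: r' -> [/\ mon lifted_letter p.1 p.2,
    ip (\sum_(s <- p.1) s) h <= b & \sum_(s <- p.1) s = t].
  by rewrite -E mem_filter => /andP[/eqP pt /rP[]].
have [pm pb pt] := pP p0 (mem_head _ _).
have Ht : HR t by rewrite -pt; have [] := mon_letter_wsp X eps0 gap (mon_phi pm).
apply: (kernel_homogeneous eps0 gap Ht).
- by move=> u' Qu'; apply: below Qu'; rewrite -pt.
- rewrite big_seq; elim/big_ind: _ => [|x y|p /pP[pm' _ pt']].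
  + exact: msum0.
  + exact: msumD.
  + exact: mon_msum pm' pt'.
rewrite -E big_filter linear_sum /=.
apply: (wsp_indep X (w := fun p => \sum_(s <- p.1) s)) => //.
  by move=> p /rP[/mon_phi/(mon_letter_wsp X eps0 gap)[]].
by rewrite -linear_sum -vE.
Qed.

End Injectivity.

(** * Presented algebras and systems of simple vectors *)

Section Presented.
Local Open Scope quotient_scope.
Context (K : fieldType) (X : Type) (rel : lie_term K X -> lie_term K X -> Prop).

Lemma presented_ind (P : presented rel -> Prop) :
    P 0 -> (forall u v, P u -> P v -> P (u + v)) -> (forall a u, P u -> P (a *: u)) ->
    (forall u v, P u -> P v -> P [Lie u, v]) ->
    (forall x, P (\pi_(presented rel) (LGen x))) -> forall u, P u.
Proof.
move=> P0 PD PZ PB Pg; elim/quotW; elim=> [x||s IHs t IHt|a s IHs|s IHs t IHt].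
- exact: Pg.
- exact: P0.
- by rewrite -pr_addE; exact: PD.
- by rewrite -pr_scaleE; exact: PZ.
- by rewrite -pr_lieE; exact: PB.
Qed.

Context (L : lieAlgType K) (gen : X -> L).

Fixpoint lie_eval (t : lie_term K X) : L :=
  match t with
  | LGen x => gen x
  | LZero => 0
  | LAdd s t => lie_eval s + lie_eval t
  | LScale a s => a *: lie_eval s
  | LBr s t => [Lie lie_eval s, lie_eval t]
  end.

Hypothesis gen_rel : forall s t, rel s t -> lie_eval s = lie_eval t.

Lemma lie_eval_cong s t : lie_cong rel s t -> lie_eval s = lie_eval t.
Proof.
elim=> //= *; try congruence.
- exact: addrA.
- exact: addrC.
- exact: add0r.
- by rewrite scaleN1r addNr.
- exact: scalerA.
- exact: scale1r.
- exact: scalerDr.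
- exact: scalerDl.
- exact: lieDl.
- exact: lieDr.
- exact: lieZl.
- exact: lieZr.
- exact: liexx.
- exact: lie_jacobi.
Qed.

Let ev (u : presented rel) : L := lie_eval (repr u).

Let evE t : ev (\pi_(presented rel) t) = lie_eval t.
Proof. exact/lie_eval_cong/presented_repr. Qed.

Lemma presented_morphism : exists phi : {linear presented rel -> L},
  lie_morphism phi /\ forall x, phi (\pi_(presented rel) (LGen x)) = gen x.
Proof.
have evL : linear ev.
  move=> a; elim/quotW=> s; elim/quotW=> t.
  have -> : a *: \pi_(presented rel) s + \pi_(presented rel) t =
      \pi_(presented rel) (LAdd (LScale a s) t).
    by rewrite -[LHS]/(pr_add (pr_scale a _) _) pr_scaleE pr_addE.
  by rewrite !evE.
pose evLB := GRing.isLinear.Build K (presented rel) L *:%R ev evL.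
pose phi : {linear presented rel -> L} := HB.pack ev evLB.
exists phi; split=> [|x]; last exact: evE.
elim/quotW=> s; elim/quotW=> t; rewrite -[[Lie _, _]]/(pr_lie _ _) pr_lieE.
by rewrite /phi /= !evE.
Qed.

End Presented.

(** [I] consists of the codes of the elements of [J], as a subtype of [nat]. *)
Lemma countable_enumeration (T : choiceType) (J : set T) : countable J ->
  exists (I : countType) (v : I -> T), injective v /\ forall x, J x <-> exists i, v i = x.
Proof.
case/countable_injP => f fJ.
pose P n := `[< exists2 x, J x & f x = n >].
pose I : countType := {n : nat | P n}.
have /choice[v vP] : forall i : I, exists x, J x /\ f x = val i.
  by move=> [n /= /asboolP[x Jx fx]]; exists x.
exists I, v; split=> [i j ij|x].
  by apply: val_inj; have [_ <-] := vP i; have [_ <-] := vP j; rewrite ij.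
split=> [Jx|[i <-]]; last by case: (vP i).
have Pn : P (f x) by apply/asboolP; exists x.
exists (exist _ (f x) Pn : I); have [Jv /= fv] := vP (exist _ (f x) Pn : I).
by apply: fJ => //; rewrite inE.
Qed.

Section SimpleSystem.
Context (R : realType) (g : lieAlgType R[i]) (form : {biscalar g}) (H HR : set g).
Local Notation "a %:C" := (real_complex R a).
Local Notation ip := (ip form).
Local Notation wsp := (wsp form H).
Local Notation root := (root form H HR).
Local Notation simple_space := (simple_space form H HR).
Local Notation simple := (simple form H HR).
Hypothesis X : root_graded form H HR.
Implicit Types (s t k h x y z : g).

(** Dual bases of the simple vectors of weights [t] and [- t], [idx t] listing
    the indices of weight [t]; [f] is scaled so that [[e i, f i]] is the coroot if
    the root has positive norm.  The conditions are symmetric under exchanging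
    [h], [wt], [e], [f] with [- h], [- wt], [f], [e]; thus statements about the
    [e i] also give those about the [f i]. *)
Record simple_system (h : g) (I : countType) (wt e f : I -> g) (idx : g -> seq I)
    (sg : I -> R) : Prop := SimpleSystem {
  ss_idx : forall t, simple h t -> forall i, i \in idx t <-> wt i = t;
  ss_uniq : forall t, simple h t -> uniq (idx t);
  ss_simple : forall i, simple h (wt i);
  ss_e : forall i, simple_space h (wt i) (e i);
  ss_f : forall i, simple_space (- h) (- wt i) (f i);
  ss_form : forall i j, form (e i) (f j) = if i == j then (sg i)%:C else 0;
  ss_sg : forall i, sg i = if 0 < ip (wt i) (wt i) then 2 / ip (wt i) (wt i) else 1;
  ss_exp_e : forall t x, simple h t -> simple_space h t x ->
    x = \sum_(i <- idx t) ((sg i)%:C^-1 * form x (f i)) *: e i;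
  ss_exp_f : forall t y, simple h t -> simple_space (- h) (- t) y ->
    y = \sum_(i <- idx t) ((sg i)%:C^-1 * form (e i) y) *: f i
}.

Section Existence.
Context (h : g) (Y : height_vector form H HR h).

Lemma simple_opp t : simple h t -> simple (- h) (- t).
Proof.
have [eps eps0 gap] := height_gap Y.
move=> [rt t0 [x tx x0]]; split; first exact: (root_opp X).
  by rewrite ipNl ipNr opprK.
have [y ty xy] := paired_pos X eps0 Y gap rt t0 tx x0.
by exists y => // y0; apply: xy; rewrite y0 bil0r.
Qed.

Lemma simple_dual_bases t : simple h t ->
  exists d, dual_bases form (simple_space h t) (simple_space (- h) (- t)) d.
Proof.
have [eps eps0 gap] := height_gap Y.
move=> [rt t0 _]; have [b bP] := rg_fin X rt.
have YN := height_vectorN X Y.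
have gapN := gap_ofN X gap.
apply: (dual_bases_exist (s := b)).
- exact: simple_space_subspace.
- exact: simple_space_subspace.
- by move=> x [/bP].
- move=> x tx xy; apply: contrapT => x0.
  by have [y ty] := paired_pos X eps0 Y gap rt t0 tx x0; rewrite xy.
- move=> y ty xy; apply: contrapT => y0.
  have t0' : 0 < ip (- t) (- h) by rewrite ipNl ipNr opprK.
  have [x] := paired_pos X eps0 YN gapN (root_opp X rt) t0' ty y0.
  by rewrite !opprK => tx; rewrite (rg_sym X) xy.
Qed.

Lemma simple_space_weight s t x : HR s -> HR t ->
  simple_space h s x -> simple_space h t x -> x <> 0 -> s = t.
Proof.
move=> Hs Ht [sx _] [tx _] x0; apply/eqP; rewrite -subr_eq0; apply/eqP.
apply: (rg_Hnd X) => [|k Hk]; first by apply: (rg_HRH X); exact: (HRB X).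
apply/eqP; rewrite bilBl subr_eq0; apply/eqP.
have := sx k Hk; rewrite (tx k Hk) => /eqP; rewrite -subr_eq0 -scalerBl scaler_eq0.
by rewrite subr_eq0 => /orP[/eqP->//|/eqP].
Qed.

(** The index set is countable as there are finitely many roots of bounded
    height, each of finite multiplicity. *)
Lemma simple_system_exists : exists (I : countType) (wt e f : I -> g) idx sg,
  simple_system h wt e f idx sg.
Proof.
have /choice[d dP] : forall t, exists d, simple h t ->
    dual_bases form (simple_space h t) (simple_space (- h) (- t)) d.
  move=> t; have [/simple_dual_bases[d dP]|nt] := pselect (simple h t).
    by exists d.
  by exists [::].
pose J : set (g * g) := [set p | exists2 t, simple h t & p \in d t].
have cJ : countable J.
  have /choice[r rP] := fun n : nat => hv_fin Y n%:R.
  pose F (n : nat) : set (g * g) := [set` flatten [seq d t | t <- r n]].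
  apply: (@sub_countable _ _ _ (\bigcup_(n in [set: nat]) F n)); last first.
    by apply: bigcup_countable => // n _; apply: finite_set_countable; exact: finite_seq.
  apply: subset_card_le => p [t st pt]; have [rt t0 _] := st.
  exists (Num.bound (ip t h)) => //; apply/flattenP; exists (d t) => //.
  apply: map_f; apply: rP => //; apply: le_lt_trans (archi_boundP _); last exact: ltW.
  by rewrite gtr0_norm.
have [I [v [vI vJ]]] := countable_enumeration cJ.
have /choice[wt wtP] : forall i, exists t, simple h t /\ v i \in d t.
  move=> i; have /vJ[t st it] : (exists j, v j = v i) by exists i.
  by exists t.
have /choice[o oP] : forall p, exists o : option I, forall i, o = Some i <-> v i = p.
  move=> p; have [[i ip]|n] := pselect (exists i, v i = p).
    by exists (Some i) => j; split=> [[<-]//|]; rewrite -ip => /vI ->.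
  by exists None => j; split=> // jp; case: n; exists j.
have dmem t p : simple h t -> p \in d t ->
    simple_space h t p.1 /\ simple_space (- h) (- t) p.2.
  by move=> /dP[_ + _ _ _]; exact.
have wtE t i : simple h t -> v i \in d t -> wt i = t.
  move=> st it; have [si ii] := wtP i.
  have [[[Ht _ _] _ _] [[Hi _ _] _ _]] := (st, si).
  have [e1 _] := dmem _ _ st it; have [e2 _] := dmem _ _ si ii.
  apply: simple_space_weight e2 e1 _ => // v0.
  have [_ _ dd _ _] := dP _ st; have := dd _ _ it it.
  by rewrite v0 bil0l eqxx => /eqP; rewrite eq_sym oner_eq0.
pose sg i := if 0 < ip (wt i) (wt i) then 2 / ip (wt i) (wt i) else 1.
have sg0 i : (sg i)%:C != 0.
  by rewrite fmorph_eq0 /sg; case: ifP => [i0|]; rewrite ?oner_eq0// gt_eqF// divr_gt0.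
pose idx t := pmap o (d t).
have idxP t : simple h t -> map v (idx t) = d t.
  move=> st; rewrite /idx; have : forall p, p \in d t -> exists i, v i = p.
    by move=> p pt; apply/vJ; exists t.
  elim: (d t) => // p l IH lP /=.
  have [i ip] := lP p (mem_head _ _); have /oP -> := ip => /=; rewrite ip IH//.
  by move=> q ql; apply: lP; rewrite inE ql orbT.
exists I, wt, (fun i => (v i).1), (fun i => (sg i)%:C *: (v i).2), idx, sg.
have memi t i : simple h t -> (i \in idx t) = (v i \in d t).
  by move=> st; rewrite -(idxP _ st) mem_map.
split=> //.
- move=> t st i; rewrite memi//; split=> [/wtE->//|<-].
  by case: (wtP i).
- move=> t st; have [ud _ _ _ _] := dP _ st.
  by rewrite -(map_inj_uniq vI) idxP.
- by move=> i; case: (wtP i).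
- by move=> i; have [si /(dmem _ _ si)[]] := wtP i.
- move=> i; have [si /(dmem _ _ si)[_ ei]] := wtP i.
  by case: (simple_space_subspace form H HR (- h) (- wt i)) => _ _; exact.
- move=> i j; rewrite bilZr.
  have [si ii] := wtP i; have [sj jj] := wtP j.
  have [ij|ij] := eqVneq (wt i) (wt j).
    have [_ _ dd _ _] := dP _ si.
    rewrite dd//; last by rewrite ij.
    rewrite (inj_eq vI); case: eqP => [->|]; first by rewrite mulr1.
    by rewrite mulr0.
  have -> : form (v i).1 (v j).2 = 0.
    have [[wi _] _] := dmem _ _ si ii; have [_ [wj _]] := dmem _ _ sj jj.
    have [[[Hi _ _] _ _] [[Hj _ _] _ _]] := (si, sj).
    by apply: (wsp_orthR X Hi (rg_HRN X Hj) _ wi wj); rewrite subr_eq0.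
  by rewrite mulr0; case: eqP => // e; rewrite e eqxx in ij.
- move=> t x st tx; have [_ _ _ dx _] := dP _ st.
  rewrite {1}(dx _ tx) -(idxP _ st) big_map; apply: eq_bigr => i _.
  by rewrite bilZr mulKf.
- move=> t y st ty; have [_ _ _ _ dy] := dP _ st.
  rewrite {1}(dy _ ty) -(idxP _ st) big_map; apply: eq_bigr => i _.
  by rewrite scalerA mulrAC mulVf// mul1r.
Qed.

End Existence.
End SimpleSystem.

(** * Relations between simple vectors *)

Section Relations.
Context (R : realType) (g : lieAlgType R[i]) (form : {biscalar g}) (H HR : set g).
Local Notation "a %:C" := (real_complex R a).
Local Notation ip := (ip form).
Local Notation wsp := (wsp form H).
Local Notation root := (root form H HR).
Local Notation simple_space := (simple_space form H HR).
Local Notation simple := (simple form H HR).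
Hypothesis X : root_graded form H HR.
Implicit Types (s t x y z : g).

Section System.
Context (h : g) (Y : height_vector form H HR h).
Context (I : countType) (wt e f : I -> g) (idx : g -> seq I) (sg : I -> R).
Hypothesis S : simple_system form H HR h wt e f idx sg.

Definition cartan (i j : I) : R := sg i * ip (wt i) (wt j).

Lemma simple_system_opp :
  simple_system form H HR (- h) (fun i => - wt i) f e (fun t => idx (- t)) sg.
Proof.
have YN := height_vectorN X Y.
have sN t : simple (- h) t -> simple h (- t) by move/(simple_opp X YN); rewrite opprK.
case: S => S1 S2 S3 S4 S5 S6 S7 S8 S9; split.
- move=> t /sN st i; rewrite (S1 _ st); split=> [->|<-]; by rewrite opprK.
- by move=> t /sN /S2.
- by move=> i; exact: (simple_opp X Y).
- exact: S5.
- by move=> i; rewrite !opprK.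
- by move=> i j; rewrite (rg_sym X) S6 eq_sym; case: eqP => // ->.
- by move=> i; rewrite ipNl ipNr opprK.
- move=> t x /sN st tx; rewrite {1}(S9 (- t) x st) ?opprK//.
  by apply: eq_bigr => i _; rewrite (rg_sym X).
- move=> t x /sN st tx; rewrite !opprK in tx; rewrite {1}(S8 (- t) x st)// ?opprK//.
  by apply: eq_bigr => i _; rewrite (rg_sym X).
Qed.

Let Hwt i : HR (wt i). Proof. by case: (ss_simple S i) => -[]. Qed.
Let rwt i : root (wt i). Proof. by case: (ss_simple S i). Qed.
Let wte i : wsp (wt i) (e i). Proof. by case: (ss_e S i). Qed.
Let wtf i : wsp (- wt i) (f i). Proof. by case: (ss_f S i). Qed.

Lemma ss_sg_gt0 i : 0 < sg i.
Proof. by rewrite (ss_sg S); case: ifP => // i0; rewrite divr_gt0. Qed.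

Lemma ss_sgC i : (sg i)%:C != 0.
Proof. by rewrite fmorph_eq0 gt_eqF// ss_sg_gt0. Qed.

Lemma ss_form_neq0 i : form (e i) (f i) <> 0.
Proof. by rewrite (ss_form S) eqxx; apply/eqP; exact: ss_sgC. Qed.

Lemma ss_e_neq0 i : e i <> 0.
Proof. by move=> e0; apply: (@ss_form_neq0 i); rewrite e0 bil0l. Qed.

Lemma ss_ef i j : [Lie e i, f j] = if i == j then (sg i)%:C *: wt i else 0.
Proof.
have [ij|/eqP ij] := eqVneq (wt i) (wt j).
  rewrite (wsp_lie0 X (Hwt i) (wte i)); last by rewrite ij.
  by rewrite (ss_form S); case: eqP => // _; rewrite scale0r.
rewrite (simple_commute X Y (Hwt i) (Hwt j) _ _ ij (ss_e S i) (ss_f S j)).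
- by case: eqP => // e0; case: ij; rewrite e0.
- by case: (ss_simple S i).
- by case: (ss_simple S j).
Qed.

Lemma ss_he i k : [Lie (sg i)%:C *: wt i, e k] = (cartan i k)%:C *: e k.
Proof.
rewrite lieZl (wte k)//; last exact: (rg_HRH X).
by rewrite (rg_real X)// scalerA -rmorphM /= /cartan (ipC X).
Qed.

Lemma cartan_diag i : cartan i i = if 0 < ip (wt i) (wt i) then 2 else ip (wt i) (wt i).
Proof.
rewrite /cartan (ss_sg S); case: ifP => i0; last by rewrite mul1r.
by rewrite divfK// gt_eqF.
Qed.

Lemma cartan_real i : 0 < cartan i i -> 0 < ip (wt i) (wt i).
Proof. by rewrite cartan_diag; case: ifP => // ->. Qed.

(** [e j] is killed by [f i], so it generates a finite-dimensional representation
    of the sl2 of [i], with lowest weight [cartan i j]. *)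
Lemma ss_serre i j : 0 < ip (wt i) (wt i) -> i != j ->
  exists m : nat, cartan i j = - m%:R /\ iter m.+1 (lie (e i)) (e j) = 0.
Proof.
move=> i0 ij.
have fe : [Lie f i, e j] = 0 by rewrite lieC ss_ef eq_sym (negPf ij) oppr0.
have [m [mE me]] := real_root_lowest X (rwt i) i0 (wte i) (wtf i)
  (@ss_form_neq0 i) (Hwt j) (wte j) (@ss_e_neq0 j) fe.
by exists m; split=> //; rewrite -mE /cartan (ss_sg S) i0 (ipC X) mulrAC.
Qed.

Lemma cartan_sym i j : (sg i)^-1 * cartan i j = (sg j)^-1 * cartan j i.
Proof.
rewrite /cartan !mulrA !mulVf ?mul1r; first exact: (ipC X).
  by rewrite gt_eqF// ss_sg_gt0.
by rewrite gt_eqF// ss_sg_gt0.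
Qed.

Lemma cartan_eq0 i j : cartan i j = 0 -> ip (wt i) (wt j) = 0.
Proof. by move/eqP; rewrite mulf_eq0 gt_eqF ?ss_sg_gt0// => /eqP. Qed.

Lemma cartan_eq0C i j : cartan i j = 0 -> cartan j i = 0.
Proof. by move/cartan_eq0; rewrite /cartan (ipC X) => ->; rewrite mulr0. Qed.

(** If a root has positive norm, this is a Serre relation with exponent 1;
    otherwise both roots have nonpositive norm and are orthogonal. *)
Lemma ss_ee i j : cartan i j = 0 -> [Lie e i, e j] = 0.
Proof.
have [<-|ij] := eqVneq i j; first by rewrite liexx.
move=> cij; have [i0|i0] := ltP 0 (ip (wt i) (wt i)).
  have [m [mE]] := ss_serre i0 ij.
  by move/eqP: mE; rewrite cij eq_sym oppr_eq0 pnatr_eq0 => /eqP ->.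
have [j0|j0] := ltP 0 (ip (wt j) (wt j)).
  have ji : j != i by rewrite eq_sym.
  have [m [mE]] := ss_serre j0 ji; move/eqP: mE.
  rewrite (cartan_eq0C cij) eq_sym oppr_eq0 pnatr_eq0 => /eqP -> /= ji0.
  by rewrite lieC ji0 oppr0.
have [_ comm] := imag_le0 Y (ss_simple S i) (ss_simple S j) i0 j0.
by apply: comm => //; exact: cartan_eq0.
Qed.

Lemma cartan_generalized : generalized_cartan cartan.
Proof.
split=> [|i j ij|i ii].
- exists (fun i => (sg i)^-1); split=> [i|i j]; last exact: cartan_sym.
  by rewrite invr_gt0 ss_sg_gt0.
- suff le0 : ip (wt i) (wt j) <= 0 by rewrite /cartan mulr_ge0_le0// ltW// ss_sg_gt0.
  have real_le0 k l : 0 < ip (wt k) (wt k) -> k != l -> ip (wt k) (wt l) <= 0.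
    move=> k0 kl; have [m [mE _]] := ss_serre k0 kl.
    by rewrite -(pmulr_rle0 _ (ss_sg_gt0 k)) -/(cartan k l) mE oppr_le0.
  have [i0|i0] := ltP 0 (ip (wt i) (wt i)); first exact: real_le0.
  have [j0|j0] := ltP 0 (ip (wt j) (wt j)).
    by rewrite (ipC X) real_le0// eq_sym.
  by case: (imag_le0 Y (ss_simple S i) (ss_simple S j) i0 j0).
- have i0 := cartan_real ii; split=> [|j]; first by rewrite cartan_diag i0.
  have [<-|/(ss_serre i0)[m [-> _]]] := eqVneq i j; first by rewrite cartan_diag i0.
  by rewrite rpredN rpred_nat.
Qed.

Section Lifting.
Context (U : lieAlgType R[i]) (phi : {linear U -> g}) (phi_lie : lie_morphism phi).
Context (E F G : I -> U).

(** The part of the defining relations that concerns the positive half, stated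
    so that it also covers the negative half after exchanging [E] with [F] and
    [G] with [- G]. *)
Record bkm_relations : Prop := BkmRelations {
  br_e : forall i, phi (E i) = e i;
  br_f : forall i, phi (F i) = f i;
  br_fe : forall i j, [Lie F i, E j] = if i == j then - G i else 0;
  br_ge : forall i k, [Lie G i, E k] = (cartan i k)%:C *: E k;
  br_serre : forall i j (n : nat), 0 < cartan i i -> i != j ->
    n%:R = 1 - cartan i j -> iter n (lie (E i)) (E j) = 0;
  br_ee : forall i j, cartan i j = 0 -> [Lie E i, E j] = 0
}.
Hypothesis rP : bkm_relations.

Lemma lift_space (r : g -> seq I) (c : g -> I -> g -> R[i]) (E' : I -> U) :
    (forall t i, linear_for *%R (c t i)) ->
  exists L : g -> {linear g -> U}, forall t a,
    L t a = \sum_(i <- r t) c t i a *: E' i.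
Proof.
move=> cL; have /choice[L LP] : forall t, exists L : {linear g -> U}, forall a,
    L a = \sum_(i <- r t) c t i a *: E' i.
  move=> t; pose L a := \sum_(i <- r t) c t i a *: E' i.
  have linL : linear L.
    move=> b x y; rewrite /L scaler_sumr -big_split /=; apply: eq_bigr => i _.
    by rewrite cL scalerDl scalerA.
  pose LB := GRing.isLinear.Build R[i] g U *:%R L linL.
  by exists (HB.pack L LB : {linear g -> U}).
by exists L.
Qed.

(** [L t] sends the basis vectors [e i] of weight [t] to [E i], and [M t] sends the
    [f i] to [F i]. *)
Lemma lifting_exists : exists L M,
  lifting form H HR h phi L M /\ forall i, L (wt i) (e i) = E i.
Proof.
have [L LE] := @lift_space idx (fun t i a => (sg i)%:C^-1 * form a (f i)) E
  (ltac:(by move=> t i b x y; rewrite bilDl bilZl mulrDr mulrCA)).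
have [M ME] := @lift_space idx (fun t i b => (sg i)%:C^-1 * form (e i) b) F
  (ltac:(by move=> t i b x y; rewrite bilDr bilZr mulrDr mulrCA)).
have Li i : L (wt i) (e i) = E i.
  have si := ss_simple S i; have ii : i \in idx (wt i) by apply/(ss_idx S si).
  rewrite LE (bigD1_seq i) ?(ss_uniq S si)//= big1 ?addr0.
    by rewrite (ss_form S) eqxx mulVf ?scale1r// ss_sgC.
  by move=> j ji; rewrite (ss_form S) eq_sym (negPf ji) mulr0 scale0r.
exists L, M; split=> //; split.
- move=> t a st ta; rewrite LE linear_sum {2}(ss_exp_e S st ta).
  by apply: eq_bigr => i _; rewrite linearZ /= (br_e rP).
- move=> t b st tb; rewrite ME linear_sum {2}(ss_exp_f S st tb).
  by apply: eq_bigr => i _; rewrite linearZ /= (br_f rP).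
- move=> s t r a b c ss st sr sb ta rc.
  suff one k : k \in idx r -> [Lie [Lie M s b, L t a], E k] =
      - (form b a * form s r) *: E k.
    rewrite (LE r c) lie_sumr scaler_sumr !big_seq; apply: eq_bigr => k /one kE.
    by rewrite lieZr kE !scalerA mulrC.
  move=> /(ss_idx S sr) kr.
  have FE i j : i \in idx s -> [Lie [Lie F i, E j], E k] =
      if i == j then - ((sg i)%:C * form s r) *: E k else 0.
    move=> /(ss_idx S ss) is_.
    rewrite (br_fe rP); case: eqP => _; last by rewrite lie0l.
    rewrite lieNl (br_ge rP) scaleNr /cartan is_ kr rmorphM /=.
    by rewrite (rg_real X)//; [case: ss => -[]|case: sr => -[]].
  have dE j : j \in idx t -> \sum_(i <- idx s) (if i == j then form (e i) b else 0) =
      form (e j) b.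
    move=> /(ss_idx S st) jt; have [js|js] := boolP (j \in idx s).
      rewrite (bigD1_seq j) ?(ss_uniq S ss)//= eqxx big1 ?addr0// => i ij.
      by rewrite (negPf ij).
    rewrite big_seq big1 => [|i iS]; last first.
      by case: eqP => // e0; rewrite -e0 iS in js.
    have ts : t != s by apply: contraNneq js => ts; apply/(ss_idx S ss); rewrite jt.
    have [[[Hs _ _] _ _] [[Ht _ _] _ _]] := (ss, st).
    have [sb' _] := sb; have := wte j; rewrite jt => tj.
    by rewrite (wsp_orthR X Ht (rg_HRN X Hs) _ tj sb')// subr_eq0.
  have fba : form b a = \sum_(j <- idx t) (sg j)%:C^-1 * form a (f j) * form (e j) b.
    rewrite (rg_sym X) {1}(ss_exp_e S st ta) bil_suml; apply: eq_bigr => j _.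
    by rewrite bilZl.
  rewrite ME LE lie_suml [X in [Lie X, _]](_ : _ = \sum_(i <- idx s) \sum_(j <- idx t)
     (((sg i)%:C^-1 * form (e i) b) * ((sg j)%:C^-1 * form a (f j))) *: [Lie F i, E j]);
    last first.
    apply: eq_bigr => i _; rewrite lieZl lie_sumr scaler_sumr; apply: eq_bigr => j _.
    by rewrite lieZr scalerA.
  rewrite lie_suml; under eq_bigr do rewrite lie_suml.
  rewrite exchange_big /= fba mulr_suml -sumrN scaler_suml !big_seq.
  apply: eq_bigr => j jt; rewrite -(dE j jt) mulr_sumr mulr_suml -sumrN scaler_suml.
  rewrite !big_seq; apply: eq_bigr => i iS; rewrite lieZl FE//.
  case: eqP => [<-|_]; last by rewrite scaler0 mulr0 mul0r oppr0 scale0r.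
  rewrite scalerA; congr (_ *: _).
  by field; rewrite ss_sgC.
- move=> t st t0.
  have [rt th [x tx x0]] := st.
  have [i it] : exists i, wt i = t.
    case E0 : (idx t) => [|i l]; last first.
      by exists i; apply/(ss_idx S st); rewrite E0 mem_head.
    by case: x0; rewrite (ss_exp_e S st tx) E0 big_nil.
  exists (e i), (f i); rewrite -it; split; [exact: (ss_e S)|exact: (ss_f S)| |].
    exact: ss_form_neq0.
  move=> s c ss sc; rewrite Li LE.
  have ii : 0 < cartan i i by rewrite cartan_diag it t0.
  have i0 := cartan_real ii.
  elim: (idx s) => [|j l [n IH]]; first by exists 0%N; rewrite big_nil.
  have [m mE] : exists m, iter m (lie (E i)) (E j) = 0.
    have [<-|ij] := eqVneq i j; first by exists 1%N; rewrite /= liexx.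
    have [m [mE _]] := ss_serre i0 ij; exists m.+1.
    by apply: (br_serre rP) => //; rewrite mE opprK -natr1 addrC.
  exists (m + n)%N; rewrite big_cons iter_lieD iter_lieZ (iter_lie_le _ mE) ?leq_addr//.
  by rewrite scaler0 add0r (iter_lie_le _ IH)// leq_addl.
- move=> s t a c ss st s0 t0 st0 sa tc.
  rewrite !LE lie_suml big_seq big1// => i /(ss_idx S ss) is_.
  rewrite lie_sumr big_seq big1// => j /(ss_idx S st) jt.
  rewrite lieZl lieZr (br_ee rP) ?scaler0//.
  by rewrite /cartan is_ jt st0 mulr0.
Qed.

Inductive generated : U -> Prop :=
| gen0 : generated 0
| genE i : generated (E i)
| genD u v of generated u & generated v : generated (u + v)
| genZ a u of generated u : generated (a *: u)
| genB u v of generated u & generated v : generated [Lie u, v].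

(** Elements generated by the [E i] are sums of monomials in lifted letters. *)
Lemma generated_inj u : generated u -> phi u = 0 -> u = 0.
Proof.
have [L [M [lP Li]]] := lifting_exists.
move=> gu; apply: (phi_injective_pos X Y phi_lie lP).
elim: gu => [|i|v w _ IHv _ IHw|a v _ IHv|v w _ IHv _ IHw].
- exact: msum0.
- apply: (@mon_msum _ _ _ _ _ [:: wt i]) => //; apply: mon1; split.
    exact: (ss_simple S).
  by exists (e i); [exact: (ss_e S)|].
- exact: msumD.
- by apply: msum_scale => // t x; exact: lifted_letterZ.
- exact: msum_lie IHv IHw.
Qed.

Lemma generated_weights u : generated u -> exists r : seq (g * g),
  phi u = \sum_(p <- r) p.2 /\
  forall p, p \in r -> [/\ HR p.1, 0 < ip p.1 h & wsp p.1 p.2].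
Proof.
elim=> [|i|v w _ [r [vE rv]] _ [r' [wE rw]]|a v _ [r [vE rv]]|v w _ [r [vE rv]] _ [r' [wE rw]]].
- by exists [::]; rewrite big_nil linear0.
- exists [:: (wt i, e i)]; rewrite big_seq1 (br_e rP); split=> // p.
  by rewrite inE => /eqP -> /=; split=> //; case: (ss_simple S i).
- exists (r ++ r'); rewrite big_cat linearD vE wE; split=> // p.
  by rewrite mem_cat => /orP[/rv|/rw].
- exists [seq (p.1, a *: p.2) | p <- r]; rewrite big_map linearZ /= vE scaler_sumr.
  by split=> // _ /mapP[p /rv[? ? ?] ->]; split=> //=; exact: wspZ.
- exists [seq (p.1 + q.1, [Lie p.2, q.2]) | p <- r, q <- r'].
  rewrite big_allpairs_dep phi_lie vE wE lie_suml; split.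
    by apply: eq_bigr => p _; rewrite lie_sumr.
  move=> _ /allpairsP[[p q] [/rv[? ? ?] /rw[? ? ?] ->]] /=; split.
  + exact: (rg_HRD X).
  + by rewrite ipDl addr_gt0.
  + exact: wsp_lie.
Qed.

End Lifting.
End System.
End Relations.

(** * Triangular decomposition and the kernel *)

Section Universal.
Local Open Scope quotient_scope.
Context (R : realType) (g : lieAlgType R[i]) (form : {biscalar g}) (H HR : set g).
Local Notation "a %:C" := (real_complex R a).
Local Notation ip := (ip form).
Local Notation wsp := (wsp form H).
Local Notation root := (root form H HR).
Local Notation simple_space := (simple_space form H HR).
Local Notation simple := (simple form H HR).
Hypothesis X : root_graded form H HR.

Section Triangular.
Context (I : countType) (U : lieAlgType R[i]) (phi : {linear U -> g}).

(** Elements acting diagonally on the generators: a description of the Cartan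
    part of [U] that is symmetric in [E] and [F]. *)
Definition torus (E F G : I -> U) (x : U) : Prop :=
  [/\ exists c : I -> R[i], forall k, [Lie x, E k] = c k *: E k,
      exists c : I -> R[i], forall k, [Lie x, F k] = c k *: F k,
      forall k, [Lie x, G k] = 0 & H (phi x)].

Context (E F G : I -> U).

Lemma torus_opp x : torus E F G x -> torus F E (fun i => - G i) x.
Proof. by case=> ? ? xG ?; split=> // i; rewrite lieNr xG oppr0. Qed.

Lemma torus_subspace : subspace (torus E F G).
Proof.
have [H0 HD HZ] := H_subspace X.
split.
- split; last by rewrite linear0.
  + by exists (fun=> 0) => k; rewrite lie0l scale0r.
  + by exists (fun=> 0) => k; rewrite lie0l scale0r.
  + by move=> k; rewrite lie0l.
- move=> x y [[c xc] [d xd] x0 Hx] [[c' yc] [d' yd] y0 Hy]; split.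
  + by exists (fun k => c k + c' k) => k; rewrite lieDl xc yc scalerDl.
  + by exists (fun k => d k + d' k) => k; rewrite lieDl xd yd scalerDl.
  + by move=> k; rewrite lieDl x0 y0 addr0.
  + by rewrite linearD; exact: HD.
- move=> a x [[c xc] [d xd] x0 Hx]; split.
  + by exists (fun k => a * c k) => k; rewrite lieZl xc scalerA.
  + by exists (fun k => a * d k) => k; rewrite lieZl xd scalerA.
  + by move=> k; rewrite lieZl x0 scaler0.
  + by rewrite linearZ; exact: HZ.
Qed.

Lemma torus_generated x u : torus E F G x -> generated E u -> generated E [Lie x, u].
Proof.
case=> -[c xc] _ _ _; elim=> [|i|v w _ IHv _ IHw|a v _ IHv|v w gv IHv gw IHw].
- by rewrite lie0r; exact: gen0.
- by rewrite xc; apply: genZ; exact: genE.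
- by rewrite lieDr; exact: genD.
- by rewrite lieZr; exact: genZ.
- by rewrite lie_leibniz; apply: genD; exact: genB.
Qed.

End Triangular.

(** A bracket with [F i] acts as a derivation that sends the generators [E j] into
    the torus. *)
Lemma lower_generated (I : countType) (U : lieAlgType R[i]) (phi : {linear U -> g})
    (E F G : I -> U) :
  (forall i j, [Lie F i, E j] = if i == j then - G i else 0) ->
  (forall i, torus phi E F G (G i)) ->
  forall i u, generated E u -> exists x v,
    [/\ torus phi E F G x, generated E v & [Lie F i, u] = x + v].
Proof.
move=> FE tG i u; have [t0 tD tZ] := torus_subspace phi E F G.
elim=> [|j|v w _ [x [v' [tx gv vE]]] _ [y [w' [ty gw wE]]]|a v _ [x [v' [tx gv vE]]]
  |v w gv [x [v' [tx gv' vE]]] gw [y [w' [ty gw' wE]]]].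
- by exists 0, 0; split=> //; [exact: gen0|rewrite lie0r addr0].
- exists [Lie F i, E j], 0; split; rewrite ?addr0//; last exact: gen0.
  rewrite FE; case: eqP => // _.
  by apply: (subspaceN (torus_subspace phi E F G)); exact: tG.
- exists (x + y), (v' + w'); split; [exact: tD|exact: genD|].
  by rewrite lieDr vE wE addrACA.
- by exists (a *: x), (a *: v'); split; [exact: tZ|exact: genZ|rewrite lieZr vE scalerDr].
- exists 0, [Lie F i, [Lie v, w]]; split=> //; last by rewrite add0r.
  rewrite lie_leibniz vE wE lieDl lieDr (lieC v y); apply: genD; apply: genD.
  + exact: torus_generated tx gw.
  + exact: genB.
  + by rewrite -scaleN1r; apply: genZ; exact: torus_generated ty gv.
  + exact: genB.
Qed.

Section Kernel.
Context (h : g) (Y : height_vector form H HR h).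
Context (I : countType) (wt e f : I -> g) (idx : g -> seq I) (sg : I -> R).
Hypothesis S : simple_system form H HR h wt e f idx sg.
Local Notation A := (cartan form wt sg).
Local Notation U := (universal_bkm A).
Let YN := height_vectorN X Y.
Let SN := simple_system_opp X Y S.

Definition uni_e i : U := \pi_(presented (bkm_rel A)) (bkm_e R i).
Definition uni_f i : U := \pi_(presented (bkm_rel A)) (bkm_f R i).
Definition uni_h i : U := \pi_(presented (bkm_rel A)) (bkm_h R i).

Let relU s t : bkm_rel A s t ->
  \pi_(presented (bkm_rel A)) s = \pi_(presented (bkm_rel A)) t.
Proof. by move=> st; apply: presentedP; exact: lc_rel. Qed.

Let pi_lie s t : [Lie \pi_(presented (bkm_rel A)) s, \pi_(presented (bkm_rel A)) t] =
  \pi_(presented (bkm_rel A)) (LBr s t) :> U.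
Proof. exact: pr_lieE. Qed.

Let pi_scale a s : a *: (\pi_(presented (bkm_rel A)) s : U) =
  \pi_(presented (bkm_rel A)) (LScale a s) :> U.
Proof. exact: pr_scaleE. Qed.

Let pi_iter n s t :
  iter n (lie (\pi_(presented (bkm_rel A)) s : U)) (\pi_(presented (bkm_rel A)) t : U) =
  \pi_(presented (bkm_rel A)) (iter n (LBr s) t).
Proof. by elim: n => //= n ->; rewrite pi_lie. Qed.

Lemma cartan_opp i j : cartan form (fun i => - wt i) sg i j = A i j.
Proof. by rewrite /cartan ipNl ipNr opprK. Qed.

Lemma uni_hh i k : [Lie uni_h i, uni_h k] = 0.
Proof. by rewrite pi_lie; apply: relU; exact: bkm_hh. Qed.
Lemma uni_he i k : [Lie uni_h i, uni_e k] = (A i k)%:C *: uni_e k.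
Proof. by rewrite pi_lie pi_scale; apply: relU; exact: bkm_he. Qed.
Lemma uni_hf i k : [Lie uni_h i, uni_f k] = - (A i k)%:C *: uni_f k.
Proof. by rewrite pi_lie pi_scale; apply: relU; exact: bkm_hf. Qed.
Lemma uni_ef i j : [Lie uni_e i, uni_f j] = if i == j then uni_h i else 0.
Proof.
rewrite pi_lie (relU (bkm_ef A i j)).
by case: eqP.
Qed.

Lemma uni_generators (P : U -> Prop) :
    P 0 -> (forall u v, P u -> P v -> P (u + v)) -> (forall a u, P u -> P (a *: u)) ->
    (forall u v, P u -> P v -> P [Lie u, v]) ->
    (forall i, P (uni_e i)) -> (forall i, P (uni_f i)) -> (forall i, P (uni_h i)) ->
  forall u, P u.
Proof. by move=> P0 PD PZ PB Pe Pf Ph; apply: presented_ind => // -[]. Qed.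

Lemma uni_morphism : exists phi : {linear U -> g},
  [/\ lie_morphism phi,
      bkm_relations form wt e f sg phi uni_e uni_f uni_h,
      bkm_relations form (fun i => - wt i) f e sg phi uni_f uni_e (fun i => - uni_h i)
    & forall i, phi (uni_h i) = (sg i)%:C *: wt i].
Proof.
pose gen (x : bkm_gen I) : g :=
  match x with GenE i => e i | GenF i => f i | GenH i => (sg i)%:C *: wt i end.
have ev_iter n s t : lie_eval gen (iter n (LBr s) t) =
    iter n (lie (lie_eval gen s)) (lie_eval gen t).
  by elim: n => //= n ->.
have Hwt i : HR (wt i) by case: (ss_simple S i) => -[].
have serre_exp (n m : nat) (a : R) : n%:R = 1 - a -> a = - m%:R -> n = m.+1.
  by move=> + aE; rewrite aE opprK addrC natr1 => /eqP; rewrite eqr_nat => /eqP.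
have [phi [phi_lie phiE]] : exists phi : {linear U -> g}, lie_morphism phi /\
    forall x, phi (\pi_(presented (bkm_rel A)) (LGen x)) = gen x.
  apply: presented_morphism => s t; case=> [i k|i k|i k|i j|i j n|i j n|i j|i j] /=.
  - rewrite lieZl lieZr; have /(rg_H X) -> := rg_HRH X (Hwt k).
      by rewrite bil0l scale0r !scaler0.
    exact: (rg_HRH X).
  - exact: (ss_he X S).
  - have := ss_he X SN i k; rewrite cartan_opp scalerN lieNl => /eqP.
    by rewrite eqr_oppLR scaleNr => /eqP.
  - by rewrite (ss_ef X Y S); case: eqP.
  - move=> ii ij nE; rewrite ev_iter /=; have i0 := cartan_real S ii.
    by have [m [mE]] := ss_serre X Y S i0 ij; rewrite (serre_exp _ _ _ nE mE).
  - move=> ii ij nE; rewrite ev_iter /=.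
    have i0 : 0 < ip (- wt i) (- wt i) by rewrite ipNl ipNr opprK; exact: (cartan_real S ii).
    by have [m [mE]] := ss_serre X YN SN i0 ij; rewrite cartan_opp in mE;
      rewrite (serre_exp _ _ _ nE mE).
  - exact: (ss_ee X Y S).
  - by rewrite -cartan_opp; exact: (ss_ee X YN SN).
exists phi; split=> //; last by move=> i; exact: phiE.
  split.
  - by move=> i; exact: phiE.
  - by move=> i; exact: phiE.
  - by move=> i j; rewrite lieC uni_ef eq_sym; case: eqP => [->//|_]; rewrite oppr0.
  - exact: uni_he.
  - by move=> i j n ii ij nE; rewrite pi_iter; apply: relU; exact: bkm_serre_e.
  - by move=> i j ij; rewrite pi_lie; apply: relU; exact: bkm_ee.
split.
- by move=> i; exact: phiE.
- by move=> i; exact: phiE.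
- by move=> i j; rewrite uni_ef opprK.
- by move=> i k; rewrite cartan_opp lieNl uni_hf scaleNr opprK.
- move=> i j n; rewrite !cartan_opp => ii ij nE.
  by rewrite pi_iter; apply: relU; exact: bkm_serre_f.
- by move=> i j; rewrite cartan_opp => ij; rewrite pi_lie; apply: relU; exact: bkm_ff.
Qed.

Context (phi : {linear U -> g}) (phi_lie : lie_morphism phi).
Hypothesis rE : bkm_relations form wt e f sg phi uni_e uni_f uni_h.
Hypothesis rF : bkm_relations form (fun i => - wt i) f e sg phi uni_f uni_e
  (fun i => - uni_h i).
Hypothesis phi_h : forall i, phi (uni_h i) = (sg i)%:C *: wt i.

Local Notation tor := (torus phi uni_e uni_f uni_h).

Let tor_h i : tor (uni_h i).
Proof.
split.
- by exists (fun k => (A i k)%:C) => k; exact: uni_he.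
- by exists (fun k => - (A i k)%:C) => k; exact: uni_hf.
- exact: uni_hh.
- rewrite phi_h; have [_ _ HZ] := wsp_subspace form H 0.
  apply/(rg_H X)/HZ/(rg_H X)/(rg_HRH X).
  by case: (ss_simple S i) => -[].
Qed.

Let tor_swap x : torus phi uni_f uni_e (fun i => - uni_h i) x -> tor x.
Proof. by case=> ? ? xG ?; split=> // i; apply: oppr_inj; rewrite -lieNr xG oppr0. Qed.

Let tor_hN i : torus phi uni_f uni_e (fun i => - uni_h i) (- uni_h i).
Proof.
by apply: (subspaceN (torus_subspace _ _ _ _)); apply: torus_opp; exact: tor_h.
Qed.

(** The sum of the three parts is stable under the action of all generators and
    contains them; the elements that stabilize it form a subalgebra. *)
Lemma triangular_decomposition u : exists a b c,
  [/\ generated uni_f a, tor b, generated uni_e c & u = a + b + c].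
Proof.
have [t0 tD tZ] := torus_subspace phi uni_e uni_f uni_h.
pose T u := exists a b c,
  [/\ generated uni_f a, tor b, generated uni_e c & u = a + b + c].
have TD u1 u2 : T u1 -> T u2 -> T (u1 + u2).
  move=> [a [b [c [fa tb ec ->]]]] [a' [b' [c' [fa' tb' ec' ->]]]].
  exists (a + a'), (b + b'), (c + c'); split; [exact: genD|exact: tD|exact: genD|].
  by rewrite addrACA; congr (_ + _); rewrite addrACA.
have TZ k u1 : T u1 -> T (k *: u1).
  move=> [a [b [c [fa tb ec ->]]]].
  by exists (k *: a), (k *: b), (k *: c); rewrite !scalerDr; split;
    [exact: genZ|exact: tZ|exact: genZ|].
have Ta a : generated uni_f a -> T a.
  by exists a, 0, 0; rewrite !addr0; split=> //; exact: gen0.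
have Tb b : tor b -> T b.
  by exists 0, b, 0; rewrite addr0 add0r; split=> //; exact: gen0.
have Tc c : generated uni_e c -> T c.
  by exists 0, 0, c; rewrite !add0r; split=> //; exact: gen0.
have tor_f b a : tor b -> generated uni_f a -> generated uni_f [Lie b, a].
  by move=> /torus_opp tb; exact: torus_generated tb.
suff [] : T u /\ forall w, T w -> T [Lie u, w] by [].
move: u; apply: uni_generators => [|u v [Tu uT] [Tv vT]|k u [Tu uT]|u v [Tu uT] [Tv vT]
    |i|i|i].
- by split=> [|w _]; rewrite ?lie0l; exact: Tb t0.
- by split=> [|w Tw]; [exact: TD|rewrite lieDl; apply: (TD); [exact: uT|exact: vT]].
- by split=> [|w Tw]; [exact: TZ|rewrite lieZl; apply: TZ; exact: uT].
- split=> [|w Tw]; first exact: uT.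
  rewrite lie_leibnizl -[X in _ + X]scaleN1r; apply: (TD); first exact/uT/vT.
  exact/TZ/vT/uT.
- split=> [|_ [a [b [c [fa tb ec ->]]]]]; first by apply: Tc; exact: genE.
  rewrite !lieDr; apply: (TD); [apply: (TD)|apply/Tc/genB => //; exact: genE].
    have [x [v [tx gv ->]]] := lower_generated (br_fe rF) tor_hN i fa.
    by apply: (TD); [exact/Tb/tor_swap|exact: Ta].
  have [[cc bc] _ _ _] := tb.
  by rewrite lieC bc -scaleNr; apply/Tc/genZ/genE.
- split=> [|_ [a [b [c [fa tb ec ->]]]]]; first by apply: Ta; exact: genE.
  rewrite !lieDr; apply: (TD); [apply: (TD); first by apply/Ta/genB => //; exact: genE|].
    have [_ [cc bc] _ _] := tb.
    by rewrite lieC bc -scaleNr; apply/Ta/genZ/genE.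
  have [x [v [tx gv ->]]] := lower_generated (br_fe rE) tor_h i ec.
  by apply: (TD); [exact: Tb|exact: Tc].
- split=> [|_ [a [b [c [fa tb ec ->]]]]]; first exact/Tb/tor_h.
  rewrite !lieDr; apply: (TD); [apply: (TD)|].
  + by apply/Ta/tor_f => //; exact: tor_h.
  + by have [_ _ b0 _] := tb; rewrite lieC b0 oppr0; exact: Tb t0.
  + by apply/Tc; exact: torus_generated (tor_h i) ec.
Qed.

Lemma generated_orth c s y : generated uni_e c -> HR s -> wsp s y -> 0 <= ip s h ->
  form (phi c) y = 0.
Proof.
move=> ec Hs sy s0; have [r [-> rP]] := generated_weights X S phi_lie rE ec.
rewrite bil_suml big_seq big1// => p /rP[Hp p0 pp].
apply: (wsp_orthR X Hp Hs _ pp sy); apply/eqP => e0.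
by have : ip (p.1 + s) h = 0 by [rewrite e0 ip0l]; rewrite ipDl; lra.
Qed.

Lemma generated_orth_opp a s y : generated uni_f a -> HR s -> wsp s y -> ip s h <= 0 ->
  form (phi a) y = 0.
Proof.
move=> fa Hs sy s0; have [r [-> rP]] := generated_weights X SN phi_lie rF fa.
rewrite bil_suml big_seq big1// => p /rP[Hp p0 pp].
apply: (wsp_orthR X Hp Hs _ pp sy); apply/eqP => e0.
have : ip (p.1 + s) h = 0 by rewrite e0 ip0l.
by move: p0; rewrite ipDl ipNr; lra.
Qed.

(** The three parts of [u] have images of negative, zero and positive heights, so
    each part is in the kernel.  The outer two vanish by injectivity; the middle
    one acts on each generator by a scalar, which is 0 since generators have
    nonzero images. *)
Lemma kernel_central u : phi u = 0 -> forall w, [Lie u, w] = 0.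
Proof.
move=> u0; have [a [b [c [fa tb ec uE]]]] := triangular_decomposition u.
have sum0 : phi a + phi b + phi c = 0 by rewrite -!linearD -uE.
have [_ _ _ /(rg_H X) Hb] := tb.
have Hbo s y : HR s -> ip s h != 0 -> wsp s y -> form (phi b) y = 0.
  move=> Hs s0 sy; apply: (wsp_orthR X (rg_HR0 X) Hs _ Hb sy).
  by rewrite add0r; apply: contra_neq s0 => ->; rewrite ip0l.
have c0 : phi c = 0.
  apply: (rg_nd X) => y; have [r [-> rP]] := rg_dec X y.
  rewrite bil_sumr big_seq big1// => p /rP[Hp pp].
  have [p0|p0] := leP 0 (ip p.1 h); first exact: generated_orth pp p0.
  have := congr1 (fun z => form z p.2) sum0; rewrite !bilDl bil0l.
  rewrite (generated_orth_opp fa Hp pp (ltW p0)) (Hbo _ _ Hp _ pp) ?lt_eqF//.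
  by rewrite !add0r.
have a0 : phi a = 0.
  apply: (rg_nd X) => y; have [r [-> rP]] := rg_dec X y.
  rewrite bil_sumr big_seq big1// => p /rP[Hp pp].
  have [p0|p0] := leP (ip p.1 h) 0; first exact: generated_orth_opp pp p0.
  have := congr1 (fun z => form z p.2) sum0; rewrite !bilDl bil0l c0 bil0l addr0.
  by rewrite (Hbo _ _ Hp _ pp) ?gt_eqF// addr0.
have b0 : phi b = 0 by move: sum0; rewrite a0 c0 add0r addr0.
rewrite uE (generated_inj X YN SN phi_lie rF fa a0) (generated_inj X Y S phi_lie rE ec c0).
rewrite addr0 add0r; have [[d dE] [d' dF] bh _] := tb.
have dk0 k : d k = 0.
  have := congr1 phi (dE k); rewrite phi_lie b0 lie0l linearZ /= (br_e rE) => /esym/eqP.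
  by rewrite scaler_eq0 => /orP[/eqP//|/eqP]; move/(ss_e_neq0 S).
have dk'0 k : d' k = 0.
  have := congr1 phi (dF k); rewrite phi_lie b0 lie0l linearZ /= (br_f rE) => /esym/eqP.
  by rewrite scaler_eq0 => /orP[/eqP//|/eqP]; move/(ss_e_neq0 SN).
apply: uni_generators => [|v w bv bw|k v bv|v w bv bw|i|i|i].
- by rewrite lie0r.
- by rewrite lieDr bv bw addr0.
- by rewrite lieZr bv scaler0.
- by rewrite lie_leibniz bv bw lie0l lie0r addr0.
- by rewrite dE dk0 scale0r.
- by rewrite dF dk'0 scale0r.
- exact: bh.
Qed.

End Kernel.
End Universal.

(** * The extension *)

Section Quotients.
Local Open Scope quotient_scope.
Context (K : fieldType) (L : lieAlgType K) (C : lie_ideal L).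

Lemma quotient_projection : exists p : {linear L -> lie_quot C},
  [/\ lie_morphism p, (forall v, exists x, p x = v) & forall x, p x = 0 <-> C x].
Proof.
pose q (x : L) : lie_quot C := \pi_(lie_quot C) x.
have ql : linear q.
  move=> a x y; rewrite /q.
  rewrite -[a *: \pi_(lie_quot C) x]/(lq_scale a _) lq_scaleE.
  by rewrite -[X in _ = X]/(lq_add _ _) lq_addE.
pose qL := GRing.isLinear.Build K L (lie_quot C) *:%R q ql.
pose p : {linear L -> lie_quot C} := HB.pack q qL.
exists p; split=> [x y|v|x].
- by rewrite -[RHS]/(lq_lie (\pi_(lie_quot C) x) (\pi_(lie_quot C) y)) lq_lieE.
- by exists (repr v); exact: reprK.
- rewrite -[0]/(\pi_(lie_quot C) (0 : L) : lie_quot C).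
  split=> [/eqmodP/asboolP|Cx]; first by rewrite subr0.
  by apply: lie_quotP; rewrite subr0.
Qed.

Lemma quotient_embedding (M : lieAlgType K) (phi : {linear L -> M}) :
    lie_morphism phi -> (forall x, phi x = 0 <-> C x) ->
  exists f : {linear lie_quot C -> M},
    [/\ lie_morphism f, injective f & forall x, (exists u, f u = x) <-> exists u, phi u = x].
Proof.
move=> phi_lie phi0; pose q (u : lie_quot C) : M := phi (repr u).
have qE x : q (\pi_(lie_quot C) x) = phi x.
  apply/eqP; rewrite -subr_eq0 -linearB; apply/eqP/phi0; exact: lie_quot_repr.
have ql : linear q.
  move=> a; elim/quotW=> x; elim/quotW=> y.
  rewrite -[a *: \pi_(lie_quot C) x]/(lq_scale a _) lq_scaleE.
  by rewrite -[X in q X]/(lq_add _ _) lq_addE !qE linearP.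
pose qL := GRing.isLinear.Build K (lie_quot C) M *:%R q ql.
pose f : {linear lie_quot C -> M} := HB.pack q qL.
exists f; split=> [||x].
- elim/quotW=> x; elim/quotW=> y.
  rewrite -[[Lie _, _]]/(lq_lie (\pi_(lie_quot C) x) (\pi_(lie_quot C) y)) lq_lieE.
  by rewrite /f /= !qE phi_lie.
- elim/quotW=> x; elim/quotW=> y; rewrite /f /= !qE => xy; apply: lie_quotP.
  by apply/phi0; rewrite linearB xy subrr.
- split=> [[u <-]|[u <-]]; first by exists (repr u).
  by exists (\pi_(lie_quot C) u); exact: qE.
Qed.

End Quotients.

Section Assembly.
Context (R : realType) (g : lieAlgType R[i]) (form : {biscalar g}) (H HR : set g).
Local Notation "a %:C" := (real_complex R a).
Local Notation ip := (ip form).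
Local Notation wsp := (wsp form H).
Local Notation root := (root form H HR).
Hypothesis X : root_graded form H HR.
Context (h : g) (Y : height_vector form H HR h).

Let sH : subspace H. Proof. exact: (H_subspace X). Qed.

Lemma H_commute x y : H x -> H y -> [Lie x, y] = 0.
Proof. by move=> Hx /(rg_H X) /(_ x Hx) ->; rewrite bil0l scale0r. Qed.

Lemma weight_trichotomy s x : HR s -> wsp s x -> ip s h = 0 -> H x /\ (s = 0 \/ x = 0).
Proof.
move=> Hs sx s0; have [e|e] := eqVneq s 0.
  by split; [apply/(rg_H X); rewrite -e|left].
rewrite (wsp_ht0 Y Hs e s0 sx); split; last by right.
by case: sH.
Qed.

Section Subalgebra.
Context (N : set g) (sN : subspace N) (NB : forall x y, N x -> N y -> N [Lie x, y]).
Hypothesis rN : forall s x, HR s -> ip s h != 0 -> wsp s x -> N x.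

Let N0 : N 0. Proof. by case: sN. Qed.
Let ND x y : N x -> N y -> N (x + y). Proof. by case: sN => _ + _; exact. Qed.
Let N_sum (I : eqType) (r : seq I) F : (forall i, i \in r -> N (F i)) ->
  N (\sum_(i <- r) F i).
Proof. by move=> rF; rewrite big_seq; elim/big_ind: _ => //; exact: ND. Qed.

(** Off [H], weight vectors belong to [N]; and [H] is commutative. *)
Lemma derived_sub x y : N [Lie x, y].
Proof.
have [r [-> rP]] := rg_dec X x; have [r' [-> rP']] := rg_dec X y.
rewrite lie_suml; apply: N_sum => p /rP[Hp pp]; rewrite lie_sumr.
apply: N_sum => q /rP'[Hq qq].
have [t0|t0] := eqVneq (ip (p.1 + q.1) h) 0; last first.
  by apply: rN (wsp_lie pp qq); first exact: (rg_HRD X).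
have [p0|p0] := eqVneq (ip p.1 h) 0.
  have q0 : ip q.1 h = 0 by move: t0; rewrite ipDl p0 add0r.
  have [Hp2 _] := weight_trichotomy Hp pp p0.
  by have [Hq2 _] := weight_trichotomy Hq qq q0; rewrite H_commute.
apply: NB; first exact: rN pp.
apply: rN qq => //; apply: contraNneq p0 => q0.
by move: t0; rewrite ipDl q0 addr0 => ->.
Qed.

Lemma sum_NH x : sum_space N H x.
Proof.
have [r [-> rP]] := rg_dec X x.
have [s0 sD _] := subspace_sum sN sH; rewrite big_seq.
elim/big_ind: _ => [||p /rP[Hp pp]]; [exact: s0|exact: sD|].
have [p0|p0] := eqVneq (ip p.1 h) 0.
  by exists 0 => //; rewrite subr0; case: (weight_trichotomy Hp pp p0).
by exists p.2; [exact: rN pp|rewrite subrr; case: sH].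
Qed.

Definition center : set g := [set x | H x /\ forall y, [Lie x, y] = 0].

Lemma center_subspace : subspace center.
Proof.
have [H0 HD HZ] := sH; split=> [|x y [Hx x0] [Hy y0]|a x [Hx x0]].
- by split=> // y; rewrite lie0l.
- by split=> [|z]; [exact: HD|rewrite lieDl x0 y0 addr0].
- by split=> [|z]; [exact: HZ|rewrite lieZl x0 scaler0].
Qed.

(** For [y] of nonzero weight [s] and [k] in [H], [form s k * form x y] is minus the
    product of [[x, y]] with [k], which is 0.  So [x] is orthogonal to root spaces
    and hence commutes with [H]. *)
Lemma centralizing_center x : (forall y, N y -> [Lie x, y] = 0) -> center x.
Proof.
move=> xN.
have xo s y : HR s -> s != 0 -> wsp s y -> form x y = 0.
  move=> Hs s0 sy; have [k Hk sk] : exists2 k, H k & form s k != 0.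
    apply: contrapT => n; move/eqP: s0; apply; apply: (rg_Hnd X (rg_HRH X Hs)) => k Hk.
    by apply: contrapT => /eqP sk; apply: n; exists k.
  have [s1|s1] := eqVneq (ip s h) 0.
    by rewrite (wsp_ht0 Y Hs s0 s1 sy) bil0r.
  have := rg_inv X x y k; rewrite (xN y (rN Hs s1 sy)) bil0l (lieC y) (sy k Hk).
  by rewrite bilNr bilZr => /eqP; rewrite oppr_eq0 mulf_eq0 (negPf sk) => /eqP.
have Hx : H x.
  apply/(rg_H X) => k Hk; rewrite bil0l scale0r; apply: (rg_nd X) => y.
  have [r [-> rP]] := rg_dec X y; rewrite bil_sumr big_seq big1// => p /rP[Hp pp].
  rewrite (form_lie_l X) (pp k Hk) bilZr; have [e|e] := eqVneq p.1 0.
    by rewrite e bil0l mul0r oppr0.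
  by rewrite (xo _ _ Hp e pp) mulr0 oppr0.
split=> // y; have [r [-> rP]] := rg_dec X y.
rewrite lie_sumr big_seq big1// => p /rP[Hp pp].
have [p0|p0] := eqVneq (ip p.1 h) 0; last by apply: xN; exact: rN pp.
by apply: H_commute => //; case: (weight_trichotomy Hp pp p0).
Qed.

(** The image of [p] is a complement of [N] in [g], contained in [H].  It is
    assembled from a complement of [N] in the center and a complement of the
    sum of [N] with the center in [H]: an element acting on [N] as one of [N]
    belongs to that sum, hence to the first summand. *)
Lemma outer_complement : exists p : {linear g -> g},
  [/\ (forall x, H (p x)), (forall x, N (x - p x)), (forall x, N x -> p x = 0)
    & forall x n, N n -> (forall y, N y -> [Lie p x, y] = [Lie n, y]) -> center (p x)].
Proof.
have sZ := center_subspace.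
have ZH : center `<=` H by move=> x [].
have sNZ := subspaceI sN sZ; have sNH := subspaceI sN sH.
have [Z' [sZ' Z'Z Z'0 ZZ']] := complement_exists sNZ sZ (@subIsetr _ _ _).
have sW := subspace_sum sNH sZ.
have WH : sum_space (N `&` H) center `<=` H.
  move=> x [a [_ Ha] Zx]; rewrite -(subrK a x); case: (sH) => _ HD _.
  by apply: HD => //; exact: ZH.
have [C [sC CH C0 HC]] := complement_exists sW sH WH.
have sD := subspace_sum sZ' sC.
case: (sH) => H0 HD _; case: (sW) => W0 WD _.
have ZW x : center x -> sum_space (N `&` H) center x.
  by move=> Zx; exists 0; rewrite ?subr0//; split.
have DW x : sum_space Z' C x -> sum_space (N `&` H) center x -> Z' x.
  move=> [z Zz Cxz] Wx; have xz0 : x - z = 0.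
    by apply: C0 => //; apply: (subspaceB sW) => //; apply: ZW; exact: Z'Z.
  by move/eqP: xz0; rewrite subr_eq0 => /eqP ->.
have DH x : sum_space Z' C x -> H x.
  move=> [z /Z'Z/ZH Hz /CH Hxz]; rewrite -(subrK z x); exact: HD.
have ND0 x : sum_space Z' C x -> N x -> x = 0.
  move=> Dx Nx; have Z'x : Z' x.
    apply: DW => //; exists x; first by split=> //; exact: DH.
    by rewrite subrr; case: sZ.
  by apply: Z'0 => //; split=> //; exact: Z'Z.
have DNT x : sum_space (sum_space Z' C) N x.
  have [n Nn Hxn] := sum_NH x; have [w [n' [Nn' _] Zw] Cw] := HC _ Hxn.
  have [m [Nm _] Zm] := ZZ' _ Zw.
  exists ((w - n' - m) + (x - n - w)).
    by exists (w - n' - m) => //; rewrite addrC addKr.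
  have -> : w - n' - m + (x - n - w) = x - (n + n' + m).
    by rewrite addrC -[w - n' - m]addrA -opprD addrA subrK -addrA -opprD addrA.
  rewrite subKr.
  by apply: ND => //; exact: ND.
have [p [pD pN]] := direct_projection sD sN ND0 DNT.
have p0 x : N x -> p x = 0.
  move=> Nx; apply: ND0 => //; have := subspaceB sN Nx (pN x).
  by rewrite opprB addrC subrK.
exists p; split=> // [x|x n Nn pn]; first exact: DH.
apply: Z'Z; apply: DW => //; exists n.
  split=> //; have Zc : center (p x - n).
    by apply: centralizing_center => y Ny; rewrite lieBl pn// subrr.
  rewrite -(subKr (p x) n); apply: (subspaceB sH); [exact: DH|exact: ZH].
by apply: centralizing_center => y Ny; rewrite lieBl pn// subrr.
Qed.

End Subalgebra.

(** The quotient of the universal algebra by the kernel of [phi] is the image [N],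
    and the derivation attached to a class in [g / N] is the adjoint action of
    its representative in the complement of [N]. *)
Theorem root_graded_bkm : borcherds_kac_moody g.
Proof.
have [I [wt [e [f [idx [sg S]]]]]] := simple_system_exists X Y.
have [phi [phi_lie rE rF phi_h]] := uni_morphism X Y S.
have YN := height_vectorN X Y; have SN := simple_system_opp X Y S.
pose U := universal_bkm (cartan form wt sg).
pose N : set g := [set x | exists u : U, phi u = x].
have sN : subspace N.
  split=> [|x y [u <-] [v <-]|a x [u <-]].
  - by exists 0; rewrite linear0.
  - by exists (u + v); rewrite linearD.
  - by exists (a *: u); rewrite linearZ.
have NB x y : N x -> N y -> N [Lie x, y].
  by move=> [u <-] [v <-]; exists [Lie u, v]; rewrite phi_lie.
have [eps eps0 gap] := height_gap Y.
have pos_sub h' (Y' : height_vector form H HR h') wt' e' f' idx' :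
    gap_of form H HR eps h' -> simple_system form H HR h' wt' e' f' idx' sg ->
    (forall i : I, N (e' i)) -> forall s x, HR s -> 0 < ip s h' -> wsp s x -> N x.
  move=> gap' S' Ne s x Hs s0 sx; have [N0 ND NZ] := sN.
  have monN l y : mon (letter form H HR h') l y -> N y.
    elim=> [t z [st tz]|l1 l2 z w _ Nz _ Nw]; last exact: NB.
    rewrite (ss_exp_e S' st tz) big_seq; elim/big_ind: _ => // i _; exact: NZ.
  elim: (spanned_pos X eps0 Y' gap' Hs s0 sx) => // l y z ly _ _ Nz.
  by apply: ND => //; exact: monN ly.
have rN s x : HR s -> ip s h != 0 -> wsp s x -> N x.
  move=> Hs s0 sx; have [s1|s1] := ltP 0 (ip s h).
    apply: (pos_sub _ Y _ _ _ _ gap S) sx => // i.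
    by exists (uni_e form wt sg i); exact: (br_e rE).
  apply: (pos_sub _ YN _ _ _ _ (gap_ofN X gap) SN) sx => //.
    by move=> i; exists (uni_f form wt sg i); exact: (br_f rE).
  by rewrite ipNr oppr_gt0 lt_neqAle s0.
have derN := derived_sub sN NB rN.
have [p [pH pN p0 pout]] := outer_complement sN rN.
have kerS : subspace [set u : U | phi u = 0].
  split=> /= [|x y x0 y0|a x x0]; first exact: linear0.
    by rewrite linearD x0 y0 addr0.
  by rewrite linearZ /= x0 scaler0.
have kerI (x y : U) : phi y = 0 -> phi [Lie x, y] = 0.
  by move=> y0; rewrite phi_lie y0 lie0r.
pose C : lie_ideal U := @LieIdeal _ U (fun u => phi u = 0) kerS kerI.
pose NI : lie_ideal g := @LieIdeal _ g N sN (fun x y _ => derN x y).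
have [pi [pi_lie pi_surj pi0]] := quotient_projection NI.
have [iota [iota_lie iota_inj iotaP]] :=
  @quotient_embedding _ U C g phi phi_lie (fun x => iff_refl _).
have iotaN q : N (iota q) by apply/iotaP; exists q.
exists I, (cartan form wt sg), C, (lie_quot NI); split.
- exact: (cartan_generalized X Y S).
- by move=> c x c0; apply: (kernel_central X Y S phi_lie rE rF phi_h c0).
- move=> x y; have [x' <-] := pi_surj x; have [y' <-] := pi_surj y.
  by rewrite -pi_lie; apply/pi0; exact: derN.
have [s piK] := choice pi_surj.
pose r d : g := p (s d).
have rD a d d' : r (a *: d + d') = a *: r d + r d'.
  apply/eqP; rewrite -subr_eq0 -linearP -linearB; apply/eqP/p0/pi0.
  by rewrite linearB linearP !piK subrr.
have r_comm d d' : [Lie r d, r d'] = 0 by exact: H_commute (pH _) (pH _).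
have /choice[delta deltaP] : forall d, exists delta : {linear lie_quot C -> lie_quot C},
    forall q, iota (delta q) = [Lie r d, iota q].
  move=> d; have /choice[t tP] : forall q, exists q', iota q' = [Lie r d, iota q].
    by move=> q; apply/iotaP; exact: derN.
  have tl : linear t.
    by move=> a q q'; apply: iota_inj; rewrite tP !linearP !tP lieDr lieZr.
  pose tL := GRing.isLinear.Build R[i] (lie_quot C) (lie_quot C) *:%R t tl.
  by exists (HB.pack t tL : {linear lie_quot C -> lie_quot C}).
exists iota, pi, delta; split; first split.
- exact: iota_lie.
- exact: pi_lie.
- exact: iota_inj.
- exact: pi_surj.
- by move=> x; rewrite pi0 iotaP.
- split.
  + move=> d x y; apply: iota_inj.
    by rewrite deltaP iota_lie lie_leibniz linearD !iota_lie !deltaP.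
  + by move=> a d d' n; apply: iota_inj; rewrite linearP !deltaP rD lieDl lieZl.
  + move=> d d' n; apply: iota_inj; rewrite linearB !deltaP -lie_leibnizl r_comm lie0l.
    have [x xE] := pi_surj d; have [y yE] := pi_surj d'.
    have -> : [Lie d, d'] = 0 by rewrite -xE -yE -pi_lie; apply/pi0; exact: derN.
    have -> : r 0 = 0 by apply/p0/pi0; rewrite piK.
    by rewrite lie0l.
- move=> d; exists (r d); last by move=> n; rewrite deltaP.
  rewrite -[RHS]piK; apply/eqP; rewrite -subr_eq0 -linearB; apply/eqP/pi0.
  by rewrite -opprB; exact: (subspaceN sN (pN _)).
- move=> d [m mE] n; apply: iota_inj; rewrite deltaP linear0.
  suff [_ rz] : center (r d) by exact: rz.
  apply: (pout _ (iota m)) => // y /iotaP[q <-].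
  by rewrite -[p _]/(r d) -deltaP mE iota_lie.
Qed.

End Assembly.

(** * From functionals to dual vectors *)

Section Weights.
Context (R : realType) (g : lieAlgType R[i]) (form : {biscalar g}) (H HR : set g).
Local Notation "a %:C" := (real_complex R a).
Hypothesis form_invariant : forall x y z, form x [Lie y, z] = form [Lie x, y] z.
Hypothesis form_nonsingular : forall x, (forall y, form x y = 0) -> x = 0.
Hypothesis H_subalgebra : subalgebra H.
Hypothesis H_self_centralizing : centralizer H = H.
Hypothesis eigen_sum : forall x, exists2 s : seq g,
     (forall y, y \in s -> exists alpha : H -> R[i], weight_space alpha y)
     & x = \sum_(y <- s) y.
Hypothesis HR_real : totally_real_structure H HR.
Hypothesis form_real : forall x y, HR x -> HR y -> form x y \is Num.real.
Hypothesis root_real : forall alpha : H -> R[i], is_root alpha ->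
     forall k : H, HR (val k) -> alpha k \is Num.real.
Implicit Types (alpha beta : H -> R[i]).

Let HT k (Hk : H k) : H := exist _ k (mem_set Hk).

Lemma H_zero_weight x : H x <-> wsp form H 0 x.
Proof.
rewrite -[X in X x <-> _]H_self_centralizing; split=> h0 k Hk.
  by rewrite bil0l scale0r; exact: h0.
by rewrite h0// bil0l scale0r.
Qed.

Lemma weight_lie alpha x k : weight_space alpha x -> forall Hk : H k,
  [Lie k, x] = alpha (HT Hk) *: x.
Proof. by move=> ax Hk; rewrite -(ax (HT Hk)). Qed.

Lemma weight_sum_orth alpha beta x y k (Hk : H k) : weight_space alpha x ->
  weight_space beta y -> (alpha (HT Hk) + beta (HT Hk)) * form x y = 0.
Proof.
move=> ax bx; have := form_invariant x k y.
rewrite (weight_lie bx) bilZr (lieC x) (weight_lie ax) bilNl bilZl => /eqP.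
by rewrite -subr_eq0 opprK -mulrDl addrC => /eqP.
Qed.

(** An element of [H] is orthogonal to all vectors of nonzero weight. *)
Lemma H_nondegenerate t : H t -> (forall k, H k -> form t k = 0) -> t = 0.
Proof.
move=> Ht tH; apply: form_nonsingular => x; have [s sP ->] := eigen_sum x.
rewrite bil_sumr big_seq big1// => y /sP[alpha ay].
have [a0|/existsNP[k /eqP ak]] := pselect (forall k, alpha k = 0).
  apply: tH; rewrite -H_self_centralizing => k Hk.
  by rewrite (weight_lie ay Hk) a0 scale0r.
have Hk : H (val k) by exact: set_mem (valP k).
have := form_invariant t (val k) y; rewrite (ay k) bilZr.
have -> : [Lie t, val k] = 0.
  by move: Ht; rewrite -{1}H_self_centralizing => /(_ _ Hk) tk; rewrite lieC tk oppr0.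
by rewrite bil0l => /eqP; rewrite mulf_eq0 (negPf ak) => /eqP.
Qed.

Lemma HRH : HR `<=` H. Proof. by case: HR_real. Qed.
Lemma HRZ (a : R) x : HR x -> HR (a%:C *: x).
Proof. by case: HR_real => _ [_ _ h] _; exact: h. Qed.

(** Writing [t = p + i q], the products of [q] with [HR] are the imaginary parts of
    those of [t], hence vanish. *)
Lemma real_dual_vector t : H t -> (forall k, HR k -> form t k \is Num.real) -> HR t.
Proof.
case: HR_real => _ [_ HRD _] HRE Ht tr; have [[p q] [[/= Hp Hq tE] _]] := HRE t Ht.
suff q0 : q = 0 by rewrite tE q0 scaler0 addr0.
have qHR k : HR k -> form q k = 0.
  move=> Hk; have := tr k Hk; rewrite tE bilDl bilZl.
  have /complex_realP[a ->] := form_real Hp Hk.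
  have /complex_realP[b ->] := form_real Hq Hk.
  rewrite rpredDl; last by apply/complex_realP; exists a.
  move=> /RIm_real; rewrite /= => /eqP; rewrite !(mul0r, mulr0, mul1r, add0r, addr0).
  by rewrite fmorph_eq0 => /eqP ->.
apply: H_nondegenerate => [|k Hk]; first exact: HRH.
have [[k1 k2] [[/= H1 H2 ->] _]] := HRE k Hk.
by rewrite bilDr bilZr !qHR// mulr0 addr0.
Qed.

(** Some weight vector [z] is not orthogonal to [x]; its weight is [- alpha], and
    [[x, z]] is the dual vector up to the factor [form x z]. *)
Lemma weight_dual alpha x : weight_space alpha x -> x <> 0 ->
  exists2 t, HR t & forall k : H, form t (val k) = alpha k.
Proof.
move=> ax x0; have [a0|na] := pselect (alpha = fun=> 0).
  by exists 0 => [|k]; [case: HR_real => _ []|rewrite a0 bil0l].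
have ra : is_root alpha by split=> //; exists x.
have [y xy0] : exists y, form x y <> 0.
  apply: contrapT => n; apply: x0; apply: form_nonsingular => y.
  by apply: contrapT => xy; apply: n; exists y.
have [z [beta bz] xz0] : exists2 z, (exists beta, weight_space beta z) & form x z != 0.
  have [s sP yE] := eigen_sum y; apply: contrapT => n; apply: xy0.
  rewrite yE bil_sumr big_seq big1// => z /sP az.
  by apply: contrapT => /eqP xz; apply: n; exists z.
have ab k (Hk : H k) : beta (HT Hk) = - alpha (HT Hk).
  have /eqP := weight_sum_orth Hk ax bz; rewrite mulf_eq0 (negPf xz0) orbF.
  by rewrite addrC addr_eq0 => /eqP.
have Hxz : H [Lie x, z].
  rewrite -H_self_centralizing => k Hk; rewrite lie_leibniz.
  by rewrite (weight_lie ax Hk) (weight_lie bz Hk) lieZl lieZr -scalerDl ab subrr scale0r.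
pose t := (form x z)^-1 *: [Lie x, z].
have Ht : H t by case: H_subalgebra => -[_ _ HZ] _; exact: HZ.
have tE k (Hk : H k) : form t k = alpha (HT Hk).
  rewrite /t bilZl -form_invariant (lieC z) (weight_lie bz Hk) ab scaleNr opprK bilZr.
  by rewrite mulrCA mulVf// mulr1.
have tE' (k : H) : form t (val k) = alpha k.
  have Hk : H (val k) by exact: set_mem (valP k).
  by rewrite (tE _ Hk); congr alpha; exact: val_inj.
exists t => //; apply: real_dual_vector => // k Hk.
by rewrite (tE _ (HRH Hk)); apply: root_real.
Qed.

Definition weight_of (t : g) : H -> R[i] := fun k => form t (val k).

Lemma wsp_weight t x : wsp form H t x <-> weight_space (weight_of t) x.
Proof.
split=> [tx k|tx k Hk]; first by apply: tx; exact: set_mem (valP k).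
exact: (weight_lie tx Hk).
Qed.

Lemma weight_of_inj s t : H s -> H t -> weight_of s = weight_of t -> s = t.
Proof.
move=> Hs Ht st; apply/eqP; rewrite -subr_eq0; apply/eqP; apply: H_nondegenerate.
  by case: H_subalgebra => sH _; exact: subspaceB.
by move=> k Hk; rewrite bilBl -[form s k]/(weight_of s (HT Hk)) st subrr.
Qed.

Lemma root_weight t : root form H HR t -> is_root (weight_of t).
Proof.
move=> [Ht t0 [x tx x0]]; split; last by exists x => //; apply/wsp_weight.
move=> w0; apply: t0; apply: H_nondegenerate => [|k Hk]; first exact: HRH.
by rewrite -[form t k]/(weight_of t (HT Hk)) w0.
Qed.

Lemma dual_vector_weight t : H t -> dual_vector form (weight_of t) = t.
Proof.
move=> Ht; apply: xget_subset1 => // u v [Hu uE] [Hv vE]; apply: weight_of_inj => //.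
by apply/funext => k; rewrite /weight_of uE vE.
Qed.

End Weights.

Theorem lemma3p4p2 (R : realType) (g : lieAlgType R[i])
  (form : {biscalar g}) (H HR : set g) (h : H)
  (form_sym : forall x y, form x y = form y x)
  (form_invariant : forall x y z, form x [Lie y, z] = form [Lie x, y] z)
  (form_nonsingular : forall x, (forall y, form x y = 0) -> x = 0)
  (H_subalgebra : subalgebra H)
  (H_self_centralizing : centralizer H = H)
  (eigen_sum : forall x, exists2 s : seq g,
     (forall y, y \in s -> exists alpha : H -> R[i], weight_space alpha y)
     & x = \sum_(y <- s) y)
  (root_finite_mult : forall alpha : H -> R[i],
     is_root alpha -> finite_dim (weight_space alpha))
  (HR_real : totally_real_structure H HR)
  (form_real : forall x y, HR x -> HR y -> form x y \is Num.real)
  (root_real : forall alpha : H -> R[i], is_root alpha ->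
     forall k : H, HR (val k) -> alpha k \is Num.real)
  (h_real : HR (val h))
  (h_centralizer : centralizer [set val h] = H)
  (h_finite : forall M : R, finite_set
     [set alpha : H -> R[i] | is_root alpha /\ `|alpha h| < M%:C%C])
  (norm_bounded : exists M : R, forall alpha : H -> R[i], is_root alpha ->
     root_product form alpha alpha <= M%:C%C)
  (nonpositive_norm : forall alpha beta : H -> R[i],
     is_root alpha -> is_root beta ->
     root_product form alpha alpha <= 0 -> root_product form beta beta <= 0 ->
     (0 < alpha h /\ 0 < beta h) \/ (alpha h < 0 /\ beta h < 0) ->
     root_product form alpha beta <= 0 /\
     (root_product form alpha beta = 0 ->
      forall x y, weight_space alpha x -> weight_space beta y -> [Lie x, y] = 0)) :
  borcherds_kac_moody g.
Proof.
have [HRH [HR0 HRD HRZ] _] := HR_real.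
have nd := H_nondegenerate form_invariant form_nonsingular H_self_centralizing eigen_sum.
have wsp0P := H_zero_weight form H_self_centralizing.
pose w : g -> H -> R[i] := weight_of form (H := H).
have rootP t : root form H HR t -> is_root (w t).
  exact: (root_weight form_invariant form_nonsingular H_self_centralizing eigen_sum HR_real).
have real_ip s t : HR s -> HR t -> form s t = (ip form s t)%:C%C.
  by move=> Hs Ht; rewrite /ip RRe_real// form_real.
have dualE t : HR t -> dual_vector form (w t) = t.
  move=> Ht; apply: (dual_vector_weight form_invariant form_nonsingular H_subalgebra
    H_self_centralizing eigen_sum); exact: HRH.
have prodE s t : HR s -> HR t -> root_product form (w s) (w t) = (ip form s t)%:C%C.
  by move=> Hs Ht; rewrite /root_product !dualE//; exact: real_ip.
have hE t : HR t -> w t h = (ip form t (val h))%:C%C by move=> Ht; exact: real_ip.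
have X : root_graded form H HR.
  split=> //.
  - by move=> x Hx; have := HRZ (-1) x Hx; rewrite rmorphN rmorph1 scaleN1r.
  - move=> x; have [s sP ->] := eigen_sum x.
    have /choice[t tP] : forall y, exists t, y \in s -> HR t /\ wsp form H t y.
      move=> y; have [ys|] := boolP (y \in s); last by exists 0.
      have [->|/eqP y0] := eqVneq y 0; first by exists 0 => _; split=> //; exact: wsp0.
      have [alpha ay] := sP y ys.
      have [t Ht tE] := weight_dual form_invariant form_nonsingular H_subalgebra
        H_self_centralizing eigen_sum HR_real form_real root_real ay y0.
      exists t => _; split=> //; apply/wsp_weight.
      by rewrite (_ : weight_of _ _ = alpha)//; apply/funext => k; exact: tE.
    exists [seq (t y, y) | y <- s]; rewrite big_map; split=> // _ /mapP[y ys ->].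
    exact: tP.
  - move=> t rt; have [r rP] := finite_dim_lspan (root_finite_mult _ (rootP _ rt)).
    by exists r => x tx; apply: rP; apply/wsp_weight.
  - have [M MP] := norm_bounded; exists M => t rt; have [Ht _ _] := rt.
    by have := MP _ (rootP _ rt); rewrite prodE// lecR.
apply: (root_graded_bkm X (h := val h)); split=> //.
- move=> t [Ht t0 [x tx x0]]; apply/eqP => th.
  have Hx : H x.
    rewrite -h_centralizer => k ->; rewrite (tx (val h)); last exact: HRH.
    by rewrite real_ip// th scale0r.
  apply: t0; apply: nd => [|k Hk]; first exact: HRH.
  have := tx k Hk; rewrite (proj1 (wsp0P x) Hx k Hk) bil0l scale0r => /esym/eqP.
  by rewrite scaler_eq0 => /orP[/eqP//|/eqP].
- move=> M; have fin := finite_image (dual_vector form (H := H)) (h_finite M).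
  have /finite_seqP[r rE] := fin; exists r => t rt tM; have [Ht _ _] := rt.
  suff : [set` r] t by [].
  rewrite -rE; exists (w t); last exact: dualE.
  split; first exact: rootP.
  by rewrite hE// normc_def /= expr0n addr0 sqrtr_sqr ltcR.
- move=> s t rs rt s0 t0 st; have [Hs _ _] := rs; have [Ht _ _] := rt.
  have := @nonpositive_norm _ _ (rootP _ rs) (rootP _ rt).
  rewrite !prodE// !hE// => np.
  have [||| le0 comm] := np.
  + by rewrite (lecR _ 0).
  + by rewrite (lecR _ 0).
  + rewrite !(ltcR 0) !(ltcR _ 0); move: st.
    have [sp|sn|<-] := ltgtP 0 (ip form s (val h)); last by rewrite mul0r ltxx.
      by rewrite pmulr_rgt0// => ->; left.
    by rewrite nmulr_rgt0// => ->; right.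
  split; first by move: le0; rewrite (lecR _ 0).
  move=> st0 x y sx ty; apply: comm; rewrite ?st0//; exact/wsp_weight.
Qed.
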